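(* Let $T$ be a complete $\mathrm{NTP}_2$ theory, $A$ an extension base and $p(x)\in S(A)$ a simple type. (1) If $a\models p(x)$ and $b$ is an arbitrary tuple, then $a\mathop{\perp}_A b$ if and only if $b\mathop{\perp}_A a$. (2) Right transitivity: if $a\models p(x)$, $B\supseteq A$ is an extension base, $a\mathop{\perp}_A B$ and $a\mathop{\perp}_B C$, then $a\mathop{\perp}_A C$.
   Context: We work in a monster model of $T$. A formula $\phi(x,y)$ has $\mathrm{TP}_2$ if there is an array $(a_{\alpha,i})_{\alpha,i<\omega}$ such that $\{\phi(x,a_{\alpha,i})\}_{i<\omega}$ is $2$-inconsistent for every $\alpha$ and $\{\phi(x,a_{\alpha,f(\alpha)})\}_{\alpha<\omega}$ is consistent for every $f:\omega\to\omega$; $T$ is $\mathrm{NTP}_2$ if no formula has $\mathrm{TP}_2$. A set $A$ is an extension base if every type over $A$ has a global extension which does not fork over $A$. Write $a\mathop{\perp}_A b$ if $\operatorname{tp}(a/Ab)$ does not fork over $A$; when $A$ is an extension base in an $\mathrm{NTP}_2$ theory, a formula forks over $A$ if and only if it divides over $A$, so forking and dividing need not be distinguished. A (partial) type $p(x)$ over $A$ is simple if there are no formula $\phi(x,y)$, tree $(a_\eta)_{\eta\in\omega^{<\omega}}$ and $k<\omega$ such that $\{\phi(x,a_{\eta\frown i})\}_{i<\omega}$ is $k$-inconsistent for every $\eta\in\omega^{<\omega}$ and $\{\phi(x,a_{\eta|i})\}_{i<\omega}\cup p(x)$ is consistent for every $\eta\in\omega^\omega$. *)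

(* Defs.v *)
From mathcomp Require Import all_boot.
From mathcomp Require Import boolp classical_sets functions cardinality.

Set Implicit Arguments.
Unset Strict Implicit.
Unset Printing Implicit Defensive.

Local Open Scope classical_set_scope.
Local Open Scope card_scope.

Record language := Language {
  fun_symbol : Type;
  fun_arity : fun_symbol -> nat;
  rel_symbol : Type;
  rel_arity : rel_symbol -> nat }.

Inductive term (L : language) (V : Type) : Type :=
| Var of V
| App (f : fun_symbol L) of ('I_(fun_arity f) -> term L V).

(* Formulas with free variables in V; the quantifier binds the variable None of
   option V.  Negation is Imp phi Bot, and the other connectives and the
   existential quantifier are definable classically. *)
Inductive formula (L : language) (V : Type) : Type :=
| Bot
| Equal of term L V & term L V
| Rel (r : rel_symbol L) of ('I_(rel_arity r) -> term L V)
| Imp of formula L V & formula L V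
| All of formula L (option V).

Arguments Var {L V} _.
Arguments App {L V} _ _.
Arguments Bot {L V}.
Arguments Equal {L V} _ _.
Arguments Rel {L V} _ _.
Arguments Imp {L V} _ _.
Arguments All {L V} _.

Definition Not L V (phi : formula L V) : formula L V := Imp phi Bot.

Definition sentence (L : language) := formula L void.

Fixpoint term_rename L V W (s : V -> W) (t : term L V) : term L W :=
  match t with
  | Var v => Var (s v)
  | App f ts => App f (fun i => term_rename s (ts i))
  end.

Fixpoint rename L V W (s : V -> W) (phi : formula L V) {struct phi} :
    formula L W :=
  match phi with
  | Bot => Bot
  | Equal t u => Equal (term_rename s t) (term_rename s u)
  | Rel r ts => Rel r (fun i => term_rename s (ts i))
  | Imp phi psi => Imp (rename s phi) (rename s psi)
  | All phi => All (rename (omap s) phi)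
  end.

Record structure (L : language) := Structure {
  carrier :> Type;
  carrier_inhabited : inhabited carrier;
  fun_interp : forall f : fun_symbol L,
    ('I_(fun_arity f) -> carrier) -> carrier;
  rel_interp : forall r : rel_symbol L,
    ('I_(rel_arity r) -> carrier) -> Prop }.

Arguments fun_interp {L} M f _ : rename.
Arguments rel_interp {L} M r _ : rename.

Fixpoint eval L (M : structure L) V (e : V -> M) (t : term L V) : M :=
  match t with
  | Var v => e v
  | App f ts => fun_interp M f (fun i => eval e (ts i))
  end.

Fixpoint sat L (M : structure L) V (e : V -> M) (phi : formula L V)
    {struct phi} : Prop :=
  match phi with
  | Bot => False
  | Equal t u => eval e t = eval e u
  | Rel r ts => rel_interp M r (fun i => eval e (ts i))
  | Imp phi psi => sat e phi -> sat e psi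
  | All phi => forall m : M, sat (fun o => if o is Some v then e v else m) phi
  end.

Definition models L (M : structure L) (T : set (sentence L)) : Prop :=
  forall phi, T phi -> sat (of_void M) phi.

Definition entails L (T : set (sentence L)) (phi : sentence L) : Prop :=
  forall M : structure L, models M T -> sat (of_void M) phi.

Definition complete_theory L (T : set (sentence L)) : Prop :=
  (exists M : structure L, models M T) /\
  (forall phi : sentence L, entails T phi \/ entails T (Not phi)).

(* Formulas in the variables x = (x_i)_(i : I) with parameters from M. *)
Definition pformula L (M : structure L) (I : Type) := formula L (I + M).

Section Types.
Context {L : language} {M : structure L}.
Implicit Types A B : set M.

Definition psat I (a : I -> M) (theta : pformula M I) : Prop :=
  sat (fun v => match v with inl i => a i | inr m => m end) theta.

(* The formula phi(x, b) obtained from phi(x, y). *)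
Definition inst I m (phi : formula L (I + 'I_m)) (b : 'I_m -> M) :
    pformula M I :=
  rename (fun v => match v with inl i => inl i | inr j => inr (b j) end) phi.

Definition formula_over I A (theta : pformula M I) : Prop :=
  exists (m : nat) (phi : formula L (I + 'I_m)) (b : 'I_m -> M),
    (forall j, A (b j)) /\ theta = inst phi b.

Definition realizes I (a : I -> M) (G : set (pformula M I)) : Prop :=
  forall theta, G theta -> psat a theta.

(* Finite satisfiability in M.  G need not be over a small set, so that this
   also makes sense for global types. *)
Definition consistent I (G : set (pformula M I)) : Prop :=
  forall D : set (pformula M I), finite_set D -> D `<=` G ->
    exists a : I -> M, realizes a D.

Definition complete_type I A (p : set (pformula M I)) : Prop :=
  [/\ p `<=` formula_over A,
      consistent p &
      forall theta, formula_over A theta -> p theta \/ p (Not theta)].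

Definition tp I (a : I -> M) A : set (pformula M I) :=
  [set theta | formula_over A theta /\ psat a theta].

(* k-inconsistency of an indexed family: repetitions count separately. *)
Definition k_inconsistent I (k : nat) (theta : nat -> pformula M I) : Prop :=
  forall t : 'I_k -> nat, injective t -> ~ consistent (range (theta \o t)).

Definition divides I A (theta : pformula M I) : Prop :=
  exists (m : nat) (phi : formula L (I + 'I_m)) (b : 'I_m -> M),
    theta = inst phi b /\
    exists (k : nat) (bs : nat -> 'I_m -> M),
      (forall i, tp (bs i) A = tp b A) /\
      k_inconsistent k (fun i => inst phi (bs i)).

(* The partial type G implies a finite disjunction of formulas dividing over A,
   i.e. it is inconsistent with the conjunction of their negations. *)
Definition forks I A (G : set (pformula M I)) : Prop :=
  exists (n : nat) (psi : 'I_n -> pformula M I),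
    (forall i, divides A (psi i)) /\
    ~ consistent (G `|` range (fun i => Not (psi i))).

(* a is independent from B over A: tp(a/AB) does not fork over A. *)
Definition indep I A (a : I -> M) B : Prop := ~ forks A (tp a (A `|` B)).

Definition simple_type I (p : set (pformula M I)) : Prop :=
  ~ exists (m : nat) (phi : formula L (I + 'I_m)) (a : seq nat -> 'I_m -> M)
      (k : nat),
    (forall eta : seq nat,
      k_inconsistent k (fun i => inst phi (a (rcons eta i)))) /\
    (forall eta : nat -> nat,
      consistent (range (fun i => inst phi (a (mkseq eta i))) `|` p)).

Definition TP2 n m (phi : formula L ('I_n + 'I_m)) : Prop :=
  exists a : nat -> nat -> 'I_m -> M,
    (forall alpha, k_inconsistent 2 (fun i => inst phi (a alpha i))) /\
    (forall f : nat -> nat,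
      consistent (range (fun alpha => inst phi (a alpha (f alpha))))).

Definition automorphism (s : M -> M) : Prop :=
  [/\ bijective s,
      forall f args, s (fun_interp M f args) = fun_interp M f (s \o args) &
      forall r args, rel_interp M r args <-> rel_interp M r (s \o args)].

End Types.

Definition NTP2 L (M : structure L) : Prop :=
  forall (n m : nat) (phi : formula L ('I_n + 'I_m)), ~ TP2 (M := M) phi.

(* Cardinality < kappa, where kappa is the cardinal of K. *)
Definition small (K X : Type) (A : set X) : Prop := ~ ([set: K] #<= A).

(* Every type over A in a small tuple of variables has a global extension which
   does not fork over A. *)
Definition extension_base (K : Type) L (M : structure L) (A : set M) : Prop :=
  forall (I : Type) (p : set (pformula M I)),
    small K [set: I] -> complete_type A p ->
    exists q : set (pformula M I),
      [/\ complete_type [set: M] q, p `<=` q & ~ forks A q].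

(* kappa-saturation: tuples of variables of any length < kappa are allowed. *)
Definition saturated (K : Type) L (M : structure L) : Prop :=
  forall (I : Type) (A : set M) (G : set (pformula M I)),
    small K [set: I] -> small K A ->
    G `<=` formula_over A -> consistent G ->
    exists a : I -> M, realizes a G.

Definition strongly_homogeneous (K : Type) L (M : structure L) : Prop :=
  forall (I : Type) (a b : I -> M),
    small K [set: I] -> tp a set0 = tp b set0 ->
    exists s : M -> M, automorphism s /\ forall i, s (a i) = b i.

(* M is a kappa-saturated, strongly kappa-homogeneous model of T, where kappa,
   the cardinal of K, is greater than |L| + aleph_0. *)
Definition monster (K : Type) L (T : set (sentence L)) (M : structure L) :
    Prop :=
  [/\ [/\ small K [set: nat],
          small K [set: fun_symbol L] & small K [set: rel_symbol L]],
      models M T,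
      saturated K M &
      strongly_homogeneous K M].

(* Main.v *)
(* Formulas act as definable predicates on tuples, whose sizes stay below the
   saturation of the monster model.

   NTP2 bounds the length of arrays with k-inconsistent rows and consistent paths.
   Hence, for a model M0, dividing over M0 is witnessed by a coheir
   sequence, formulas forking over M0 can be absorbed into a coheir at no cost, every
   type over M0 has a strict coheir, and Kim's lemma along strict coheirs shows that
   forking equals dividing over M0.  An extension base E inherits this, because any
   tuple is independent over E from some model containing E.

   For a simple type p, Kim's lemma holds along arbitrary Morley sequences over E:
   otherwise a long sequence, read backwards, produces a dividing chain with a
   realization of p.  Applied to a Morley sequence in tp(b/Ea), it turns
   nonforking of tp(b/Ea) into nondividing of tp(a/Eb).  Conversely, if tp(a/Eb) does
   not fork but tp(b/Ea) divides, take a_0, a_1, ... of the type of a over Eb, each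
   nondividing over E from b and the previous ones, and a model independent from
   them: replacing each a_l by a suitable coheir row produces an array contradicting
   NTP2.  Right transitivity is left transitivity, which is general, conjugated by
   symmetry. *)

From Stdlib Require List.
Require Import Defs.
From mathcomp Require Import all_boot.
From mathcomp Require Import boolp classical_sets functions cardinality.
From mathcomp Require Import filter.

Set Implicit Arguments.
Unset Strict Implicit.
Unset Printing Implicit Defensive.

Local Open Scope classical_set_scope.

(** All tuples are indexed by types embedding in one fixed [frame_index], infinite, closed under
    pairing and strictly below the saturation. Conjugates are obtained by realizing transported
    types, and nonforking is phrased without global types, by nondividing extensions over each
    larger small tuple. Two tools recur. If the type of c over E and a parameter does not divide
    over E, then a formula at that parameter dividing over E also divides over E c: this gives left
    transitivity, rows of arrays over earlier data, and the ascent from an extension base to a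
    model. And the terms of a coheir sequence may be exchanged for conjugates, which makes all paths
    of an array alike. In the hard direction of symmetry the dividing formula phi(y, a) has an
    arbitrary object variable, so simplicity controls only the parameters. It enters because every
    union of realizations of the type obeys the direction proved first: coheir sequences of such
    tuples are automatically strict, so they satisfy Kim's lemma, and the family of the a_l stays
    independent when its terms are replaced one at a time. *)

Definition join (T V W : Type) (a : V -> T) (b : W -> T) (v : V + W) : T :=
  match v with inl x => a x | inr y => b y end.

Definition restr (T Y : Type) (n : nat) (c : nat -> Y -> T) (p : 'I_n * Y) : T :=
  c p.1 p.2.

(** * Definable predicates and types of tuples *)

Section Definability.
Context {L : language} (M : structure L).
Implicit Types V W X Y Z : Type.

Lemma eval_rename V W (s : V -> W) (t : term L V) (e : W -> M) :
  eval e (term_rename s t) = eval (fun v => e (s v)) t.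
Proof.
elim: t => [//|f ts IH] /=; congr fun_interp; apply: funext => i; exact: IH.
Qed.

Lemma sat_rename V W (s : V -> W) (phi : formula L V) (e : W -> M) :
  sat e (rename s phi) <-> sat (fun v => e (s v)) phi.
Proof.
elim: phi W s e => {V} [V|V t u|V r ts|V phi IH psi IH'|V phi IH] W s e //=.
- by rewrite !eval_rename.
- suff -> : (fun i => eval e (term_rename s (ts i))) =
            (fun i => eval (fun v => e (s v)) (ts i)) by [].
  by apply: funext => i; rewrite eval_rename.
- by rewrite IH IH'.
- split=> H m; have := H m; rewrite IH;
    (suff -> : (fun v : option V => match omap s v with
       | Some x => e x | None => m end) =
       (fun o : option V => match o with Some v => e (s v) | None => m end) by []);
    by apply: funext => -[].
Qed.

(** Definability without parameters, up to equivalence; parameters enter as further arguments.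
    Closure under reindexing and under quantification over whole tuples takes the place of
    substitution in formulas. *)
Definition def V (P : (V -> M) -> Prop) : Prop :=
  exists phi : formula L V, forall e, P e <-> sat e phi.

Definition def2 V W (R : (V -> M) -> (W -> M) -> Prop) : Prop :=
  def (fun w => R (fun i => w (inl i)) (fun j => w (inr j))).

Definition def3 V X Y (R : (V -> M) -> (X -> M) -> (Y -> M) -> Prop) : Prop :=
  def (fun w => R (fun i => w (inl i)) (fun j => w (inr (inl j)))
                  (fun k => w (inr (inr k)))).

Lemma def_ext V (P Q : (V -> M) -> Prop) :
  (forall e, P e <-> Q e) -> def P -> def Q.
Proof. by move=> PQ [phi Pphi]; exists phi => e; rewrite -PQ. Qed.

Lemma def_comp V W (s : V -> W) (P : (V -> M) -> Prop) :
  def P -> def (fun w => P (fun i => w (s i))).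
Proof. by move=> [phi Pphi]; exists (rename s phi) => e; rewrite sat_rename. Qed.

Lemma def2E V W Z (R : (V -> M) -> (W -> M) -> Prop) (s : V -> Z) (t : W -> Z) :
  def2 R -> def (fun z => R (fun i => z (s i)) (fun j => z (t j))).
Proof. exact: (def_comp (join s t)). Qed.

Lemma def3E V X Y Z (R : (V -> M) -> (X -> M) -> (Y -> M) -> Prop)
    (s : V -> Z) (t : X -> Z) (u : Y -> Z) :
  def3 R -> def (fun z => R (fun i => z (s i)) (fun j => z (t j)) (fun k => z (u k))).
Proof. exact: (def_comp (join s (join t u))). Qed.

Lemma def_False V : def (fun _ : V -> M => False).
Proof. by exists Bot. Qed.

Lemma def_imp V (P Q : (V -> M) -> Prop) :
  def P -> def Q -> def (fun e => P e -> Q e).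
Proof.
move=> [phi Pp] [psi Qp]; exists (Imp phi psi) => e /=.
by rewrite -Pp -Qp.
Qed.

Lemma def_not V (P : (V -> M) -> Prop) : def P -> def (fun e => ~ P e).
Proof. by move=> dP; apply: def_imp => //; exact: def_False. Qed.

Lemma def_cst V (P : Prop) : def (fun _ : V -> M => P).
Proof.
have [p|np] := pselect P; last first.
  by apply: def_ext (def_False V) => e; split.
by apply: def_ext (def_not (def_False V)) => e; split=> [_|_ []].
Qed.

Lemma def_and V (P Q : (V -> M) -> Prop) :
  def P -> def Q -> def (fun e => P e /\ Q e).
Proof.
move=> dP dQ; apply: def_ext (def_not (def_imp dP (def_not dQ))) => e.
split; last by move=> [p q] /(_ p).
by move=> H; split; apply: contrapT => n; apply: H.
Qed.

Lemma def_or V (P Q : (V -> M) -> Prop) :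
  def P -> def Q -> def (fun e => P e \/ Q e).
Proof.
move=> dP dQ; apply: def_ext (def_imp (def_not dP) dQ) => e.
split; last by move=> [p /(_ p)|q _].
by have [p _|np H] := pselect (P e); [left|right; exact: H].
Qed.

Lemma def_eq V (i j : V) : def (fun e : V -> M => e i = e j).
Proof. by exists (Equal (Var i) (Var j)). Qed.

Lemma def_all_fin V (T : finType) (P : T -> (V -> M) -> Prop) :
  (forall t, def (P t)) -> def (fun e => forall t, P t e).
Proof.
move=> dP.
have dl (l : seq T) : def (fun e => forall t, t \in l -> P t e).
  elim: l => [|t l IH]; first by apply: def_ext (def_cst V True) => e.
  apply: def_ext (def_and (dP t) IH) => e; split.
    by move=> [Pt H] t'; rewrite in_cons => /orP [/eqP -> //|]; exact: H.
  move=> H; split; first by apply: H; rewrite mem_head.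
  by move=> t' tl; apply: H; rewrite in_cons tl orbT.
apply: def_ext (dl (enum T)) => e; split=> H t; last by move=> _.
by apply: H; rewrite mem_enum.
Qed.

Lemma def_ex_fin V (T : finType) (P : T -> (V -> M) -> Prop) :
  (forall t, def (P t)) -> def (fun e => exists t, P t e).
Proof.
move=> dP; have := def_not (def_all_fin (fun t => def_not (dP t))).
apply: def_ext => e; split; last by move=> [t Pt] /(_ t).
by move=> H; apply: contrapT => nE; apply: H => t Pt; apply: nE; exists t.
Qed.

Lemma def_all_lt V (n : nat) (P : nat -> (V -> M) -> Prop) :
  (forall i, def (P i)) -> def (fun e => forall i, i < n -> P i e).
Proof.
move=> dP; apply: def_ext (def_all_fin (fun i : 'I_n => dP i)) => e.
by split=> H i; [move=> lt; exact: (H (Ordinal lt))|exact: H].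
Qed.

Lemma def_ex_lt V (n : nat) (P : nat -> (V -> M) -> Prop) :
  (forall i, def (P i)) -> def (fun e => exists i, i < n /\ P i e).
Proof.
move=> dP; apply: def_ext (def_ex_fin (fun i : 'I_n => dP i)) => e; split.
  by move=> [i Pi]; exists i; split=> //; exact: ltn_ord.
by move=> [i [lt Pi]]; exists (Ordinal lt).
Qed.

Lemma eval_support V (t : term L V) :
  exists A : set V, finite_set A /\
    forall e e' : V -> M, (forall v, A v -> e v = e' v) -> eval e t = eval e' t.
Proof.
elim: t => [v|f ts IH] /=.
  by exists [set v]; split=> [|e e' H]; [exact: finite_set1|exact: H].
have /choice [A HA] := IH.
exists (\bigcup_i A i); split.
  by apply: bigcup_finite; [exact: finite_finset|move=> i _; have [] := HA i].
move=> e e' H; congr fun_interp; apply: funext => i.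
by have [_] := HA i; apply => v Av; apply: H; exists i.
Qed.

Lemma sat_support V (phi : formula L V) :
  exists A : set V, finite_set A /\
    forall e e' : V -> M, (forall v, A v -> e v = e' v) -> (sat e phi <-> sat e' phi).
Proof.
elim: phi => {V} [V|V t u|V r ts|V phi [A [fA HA]] psi [B [fB HB]]|V phi [A [fA HA]]] /=.
- by exists set0; split.
- have [A [fA HA]] := eval_support t; have [B [fB HB]] := eval_support u.
  exists (A `|` B); split=> [|e e' H]; first by rewrite finite_setU.
  by rewrite (HA e e') ?(HB e e') // => v Av; apply: H; [right|left].
- have /choice [A HA] := fun i => eval_support (ts i).
  exists (\bigcup_i A i); split.
    by apply: bigcup_finite; [exact: finite_finset|move=> i _; have [] := HA i].
  move=> e e' H; suff -> : (fun i => eval e (ts i)) = (fun i => eval e' (ts i)) by [].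
  apply: funext => i.
  by have [_] := HA i; apply => v Av; apply: H; exists i.
- exists (A `|` B); split=> [|e e' H]; first by rewrite finite_setU.
  by rewrite (HA e e') ?(HB e e') // => v Av; apply: H; [right|left].
- exists (Some @^-1` A); split.
    by apply: finite_preimage => // x y _ _ [].
  move=> e e' H; split=> K m.
    by apply: (HA _ _ _).1 (K m) => -[v Av|//]; rewrite H.
  by apply: (HA _ _ _).1 (K m) => -[v Av|//]; rewrite H.
Qed.

Lemma def_support V (P : (V -> M) -> Prop) : def P ->
  exists A : set V, finite_set A /\
    forall e e' : V -> M, (forall v, A v -> e v = e' v) -> (P e <-> P e').
Proof.
move=> [phi Pphi]; have [A [fA HA]] := sat_support phi.
by exists A; split=> // e e' /HA H; rewrite !Pphi.
Qed.

Lemma finite_set_seq (V : eqType) (A : set V) :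
  finite_set A -> exists l : seq V, forall v, A v -> v \in l.
Proof. by move=> /finite_seqP [l ->]; exists l. Qed.

(** Coordinates of [w] outside the finite support are irrelevant, so [h] may collapse them. The pair
    [g], [h] turns an arbitrary tuple of parameters into a finite one and back. *)
Lemma def_finite V W (R : (V -> M) -> (W -> M) -> Prop) : def2 R ->
  exists (n : nat) (g : 'I_n -> W) (h : W -> 'I_n),
    forall v w, R v w <-> R v (fun x => w (g (h x))).
Proof.
(* Classical equality makes the index types eqTypes, so that the support can be listed and
   searched. *)
move: R; elim/Peq: V => V; elim/Peq: W => W R dR.
have [[x0 _]|nW] := pselect (exists x : W, True); last first.
  have F (v : W) : False by apply: nW; exists v.
  have g : 'I_0 -> W by case.
  exists 0, g, (fun v => match F v with end) => v w.
  by rewrite (_ : (fun v => _) = w) //; apply: funext => x; case: (F x).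
have [A [/finite_set_seq [l0 Al] HA]] := def_support dR.
pose l := pmap (fun z : V + W => if z is inr x then Some x else None) l0.
(* [x0] heads the list so that it is nonempty; coordinates off the list have an out-of-range index,
   which [inord] sends to 0. *)
exists (size l).+1, (fun i => nth x0 (x0 :: l) i),
  (fun v => inord (index v (x0 :: l))) => v w.
apply: (HA (join v w) (join v (fun x => w (nth x0 (x0 :: l) _)))) => -[//|x] /Al xl0.
have xl : x \in l by rewrite mem_pmap; apply/mapP; exists (inr x).
congr (w _); rewrite inordK ?nth_index ?in_cons ?xl ?orbT //.
by rewrite -[X in _ < X]/(size (x0 :: l)) index_mem in_cons xl orbT.
Qed.

Lemma def_ex1 V (Q : (option V -> M) -> Prop) : def Q ->
  def (fun w : V -> M => exists u, Q (fun o => if o is Some v then w v else u)).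
Proof.
move=> [phi Qphi]; exists (Not (All (Not phi))) => e /=; split.
  by move=> [u]; rewrite Qphi => s /(_ u).
by move=> H; apply: contrapT => n; apply: H => m s; apply: n; exists m; rewrite Qphi.
Qed.

Lemma def_ex_update (V : eqType) (l : seq V) (Q : (V -> M) -> Prop) : def Q ->
  def (fun w => exists w', (forall z, z \notin l -> w' z = w z) /\ Q w').
Proof.
elim: l Q => [|x l IH] Q dQ.
  apply: def_ext dQ => e; split=> [q|[w' [H]]]; first by exists e.
  by suff -> : w' = e by []; apply: funext => z; exact: H.
have := def_ex1 (def_comp (fun z => if z == x then None else Some z) (IH Q dQ)).
apply: def_ext => e; split.
  move=> [u [w' [H q]]]; exists w'; split=> // z.
  by rewrite in_cons negb_or => /andP [/negPf zx /H]; rewrite zx.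
move=> [w' [H q]]; exists (w' x), w'; split=> // z zl.
case: eqP => [->//|/eqP zx]; apply: H; by rewrite in_cons negb_or zx.
Qed.

(** A formula sees finitely many coordinates of [v], so quantifying over an infinite tuple amounts
    to finitely many first-order quantifiers. *)
Lemma def_ex V W (R : (V -> M) -> (W -> M) -> Prop) : def2 R ->
  def (fun w => exists v, R v w).
Proof.
move=> dR.
have [u0] := carrier_inhabited M.
(* Eliminate on [V + W] first, ignoring the given [V]-coordinates; these are then all identified
   with one dummy variable, whose value is [u0]. *)
suff dS : def (fun w : V + W -> M => exists v, R v (fun j => w (inr j))).
  apply: def_ext (def_ex1 (def_comp
    (fun z : V + W => match z with inl _ => None | inr j => Some j end) dS)) => e /=.
  by split=> [[_]|H] //; exists u0.
move: R dR; elim/Peq: V => V; elim/Peq: W => W R dR.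
have [A [/finite_set_seq [l0 Al] HA]] := def_support dR.
pose l := [seq z <- l0 | if z is inl _ then true else false].
apply: def_ext (def_ex_update l dR) => e; split.
  move=> [w' [H q]]; exists (fun i => w' (inl i)).
  suff -> : (fun j => e (inr j)) = (fun j => w' (inr j)) by [].
  by apply: funext => j; rewrite H // mem_filter.
move=> [v q]; pose w' z := if z \in l then join v (fun j => e (inr j)) z else e z.
exists w'; split=> [z /negPf zl|]; first by rewrite /w' zl.
apply/(HA w' (join v (fun j => e (inr j)))) => // z /Al zl.
by case: z zl => [i|j] zl; rewrite /w' mem_filter zl.
Qed.

Lemma def_all V W (R : (V -> M) -> (W -> M) -> Prop) : def2 R ->
  def (fun w => forall v, R v w).
Proof.
move=> dR; have := def_not (def_ex (def_not dR : def2 (fun v w => ~ R v w))).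
apply: def_ext => e; split; last by move=> H [v]; apply.
by move=> H v; apply: contrapT => n; apply: H; exists v.
Qed.

(** Equality of types over the empty set. Over a base [E] it is used as [teq (join E a) (join E b)];
    as the two bases may differ, the same relation also expresses conjugacy of bases. *)
Definition teq V (a b : V -> M) : Prop := forall P, def P -> P a -> P b.

Lemma teq_refl V (a : V -> M) : teq a a. Proof. by []. Qed.

Lemma teq_sym V (a b : V -> M) : teq a b -> teq b a.
Proof.
by move=> ab P dP Pb; apply: contrapT => nPa; exact: (ab _ (def_not dP) nPa).
Qed.

Lemma teq_trans V (a b c : V -> M) : teq a b -> teq b c -> teq a c.
Proof. by move=> ab bc P dP /(ab P dP)/(bc P dP). Qed.

Lemma teqE V (a b : V -> M) P : teq a b -> def P -> P a <-> P b.
Proof. by move=> ab dP; split; [apply: ab|apply: (teq_sym ab)]. Qed.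

Lemma teq_re V W (s : W -> V) (a b : V -> M) (a' b' : W -> M) : teq a b ->
  (forall w, a' w = a (s w)) -> (forall w, b' w = b (s w)) -> teq a' b'.
Proof.
move=> ab ha hb P dP.
rewrite (_ : a' = fun w => a (s w)) 1?(_ : b' = fun w => b (s w)); try exact: funext.
exact: (ab _ (def_comp s dP)).
Qed.

Definition selects V W (f : (W -> M) -> (V -> M)) : Prop :=
  exists s : V -> W, forall w, f w = fun i => w (s i).

Lemma selects_var V W (s : V -> W) : selects (fun w => fun i => w (s i)).
Proof. by exists s. Qed.

Lemma selects_join V V' W (f : (W -> M) -> (V -> M)) (g : (W -> M) -> (V' -> M)) :
  selects f -> selects g -> selects (fun w => join (f w) (g w)).
Proof.
move=> [s fs] [t gt]; exists (join s t) => w; rewrite fs gt.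
by apply: funext => -[].
Qed.

Lemma def_selects V W (P : (V -> M) -> Prop) (f : (W -> M) -> (V -> M)) :
  def P -> selects f -> def (fun w => P (f w)).
Proof.
move=> dP [s fs]; apply: def_ext (def_comp s dP) => w; by rewrite fs.
Qed.

Lemma def2_selects V V' W (R : (V -> M) -> (V' -> M) -> Prop) (f : (W -> M) -> (V -> M))
    (g : (W -> M) -> (V' -> M)) :
  def2 R -> selects f -> selects g -> def (fun w => R (f w) (g w)).
Proof.
move=> dP [s fs] [t gt]; apply: def_ext (def2E s t dP) => w; by rewrite fs gt.
Qed.

Lemma def3_selects V V' V'' W (R : (V -> M) -> (V' -> M) -> (V'' -> M) -> Prop)
    (f : (W -> M) -> (V -> M)) (g : (W -> M) -> (V' -> M)) (h : (W -> M) -> (V'' -> M)) :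
  def3 R -> selects f -> selects g -> selects h -> def (fun w => R (f w) (g w) (h w)).
Proof.
move=> dP [s fs] [t gt] [u hu]; apply: def_ext (def3E s t u dP) => w; by rewrite fs gt hu.
Qed.

End Definability.

Arguments teq {L M V} a b.
Arguments teq_refl {L M V} a.
Arguments teq_re {L M V W} s {a b a' b'}.
Arguments def {L M V} P.
Arguments def2 {L M V W} R.
Arguments def3 {L M V X Y} R.

Definition flat (T V : Type) (e : nat -> V -> T) (p : nat * V) : T := e p.1 p.2.

Ltac selects_tac :=
  rewrite /restr /flat /=;
  repeat first [ apply: selects_join | apply: selects_var | exact: (selects_var id) ].

(* Structural proof that a predicate assembled from definable relations is definable. *)
Ltac definable :=
  rewrite /def2 /def3 /=;
  repeat first
    [ assumption
    | apply: def_cst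
    | apply: def_and
    | apply: def_or
    | apply: def_not
    | apply: def_imp
    | match goal with
      | |- def (fun _ => forall _ : nat, is_true (leq _ _) -> _) => apply: def_all_lt => ?
      | |- def (fun _ => exists _ : nat, is_true (leq _ _) /\ _) => apply: def_ex_lt => ?
      | |- def (fun _ => forall _ : _ -> _, _) => apply: def_all; rewrite /def2 /=
      | |- def (fun _ => exists _ : _ -> _, _) => apply: def_ex; rewrite /def2 /=
      | |- def (fun _ => forall _, _) => apply: def_all_fin => ?
      | |- def (fun _ => exists _, _) => apply: def_ex_fin => ?
      | H : def3 ?R |- def (fun _ => ?R _ _ _) => apply: (def3_selects H); solve [selects_tac]
      | H : def2 ?R |- def (fun _ => ?R _ _) => apply: (def2_selects H); solve [selects_tac]
      | H : def ?R |- def (fun _ => ?R _) => apply: (def_selects H); solve [selects_tac]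
      | H : forall _, def3 (_ _) |- def (fun _ => _ _ _ _ _) =>
          apply: (def3_selects (H _)); solve [selects_tac]
      | H : forall _, def2 (_ _) |- def (fun _ => _ _ _ _) =>
          apply: (def2_selects (H _)); solve [selects_tac]
      end ].

(** * Saturation *)

Definition embeds (T U : Type) : Prop := exists f : T -> U, injective f.

Lemma embeds_refl T : embeds T T. Proof. by exists id. Qed.

Lemma embeds_trans T U V : embeds T U -> embeds U V -> embeds T V.
Proof. by move=> [f fi] [g gi]; exists (g \o f); exact: inj_comp. Qed.

Lemma embeds_left_inverse (T U : Type) (t0 : T) (f : T -> U) : injective f ->
  exists g : U -> T, cancel f g.
Proof.
move=> fi.
have /choice [g Hg] : forall u, exists t, forall t', f t' = u -> t' = t.
  move=> u; have [[t E]|H] := pselect (exists t, f t = u).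
    by exists t => t' E'; apply: fi; rewrite E E'.
  by exists t0 => t' E; case: H; exists t'.
by exists g => t; rewrite -(Hg (f t) t).
Qed.

Lemma card_le_inj (K T : Type) (A : set T) :
  ([set: K] #<= A)%card <-> exists f : K -> T, injective f /\ forall k, A (f k).
Proof.
split=> [/card_leP [f]|[f [fi fA]]].
  exists (fun k : K => val (f (to_setT k))); split=> [x y /val_inj|k].
    by move/(@inj _ _ _ f) => H; have := H (in_setT _) (in_setT _) => -[].
  exact: set_valP.
have E : (f @` [set: K] #= [set: K])%card.
  by apply: inj_card_eq => x y _ _; exact: fi.
apply: (@card_le_trans _ _ _ (f @` [set: K])).
  by move: E; rewrite card_eq_le => /andP [].
by apply: subset_card_le => _ [k _ <-]; exact: fA.
Qed.

Lemma small_embeds (K Th T : Type) (A : set T) (f : T -> Th) :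
  injective f -> small K [set: Th] -> small K A.
Proof.
move=> fi sT KA; apply: sT; apply/card_le_inj.
have [g [gi _]] := (card_le_inj _ _).1 KA.
by exists (f \o g); split=> //; exact: inj_comp.
Qed.

Lemma finite_set_list (T : Type) (A : set T) :
  finite_set A -> exists l : seq T, forall x, A x -> List.In x l.
Proof.
move: A; elim/Peq: T => T A /finite_set_seq [l Al]; exists l => x /Al.
elim: l {Al} => [//|y l IH]; rewrite in_cons => /orP [/eqP ->|/IH]; by [left|right].
Qed.

(* All index types used below embed in [frame_index], which is strictly smaller
   than the saturation cardinal of M and closed under pairing. *)
Class framed (L : language) (M : structure L) := Framed {
  frame_index : Type;
  frame_pair : frame_index * frame_index -> frame_index;
  frame_pair_inj : injective frame_pair;
  frame_nat : nat -> frame_index;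
  frame_nat_inj : injective frame_nat;
  frame_fun : embeds (fun_symbol L) frame_index;
  frame_rel : embeds (rel_symbol L) frame_index;
  frame_sat : forall (V X : Type) (e : X -> M) (G : set (pformula M V)),
    embeds V frame_index -> embeds X frame_index ->
    G `<=` formula_over (range e) -> consistent G -> exists a, realizes a G }.

Section Saturation.
Context {L : language} {M : structure L} {F : framed M}.

Definition sml (V : Type) := embeds V frame_index.

Lemma sml_nat : sml nat. Proof. by exists frame_nat; exact: frame_nat_inj. Qed.

Lemma sml_prod V W : sml V -> sml W -> sml (V * W).
Proof.
move=> [f fi] [g gi]; exists (fun p => frame_pair (f p.1, g p.2)) => -[a b] [c d] /frame_pair_inj.
by case=> /fi -> /gi ->.
Qed.

Lemma sml_sum V W : sml V -> sml W -> sml (V + W).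
Proof.
move=> [f fi] [g gi].
exists (fun z => match z with inl x => frame_pair (frame_nat 0, f x)
                            | inr y => frame_pair (frame_nat 1, g y) end).
by move=> [a|a] [b|b] /frame_pair_inj [] // => [/fi ->|/frame_nat_inj|/frame_nat_inj|/gi ->].
Qed.

Lemma sml_inj V W (f : V -> W) : injective f -> sml W -> sml V.
Proof. by move=> fi [g gi]; exists (g \o f); exact: inj_comp. Qed.

Lemma sml_ord n : sml 'I_n.
Proof. by apply: (sml_inj _ sml_nat); exact: ord_inj. Qed.

Lemma sml_sig V (P : V -> Prop) : sml V -> sml {x | P x}.
Proof.
by apply: (@sml_inj _ _ (@sval _ P)) => -[x Px] [y Py] /= xy; exact: eq_exist.
Qed.

Lemma psat_inst V m (phi : formula L (V + 'I_m)) (b : 'I_m -> M) (v : V -> M) :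
  psat v (inst phi b) <-> sat (join v b) phi.
Proof.
rewrite /psat /inst sat_rename.
rewrite (_ : (fun _ => _) = join v b) //.
by apply: funext => -[].
Qed.

(** Saturation for a directed family: a single condition has to be satisfiable, not finitely many.
    The families below consist of all consequences of some finite data, so that a conjunction
    provides the upper bound. *)
Lemma realize_directed V X (e : X -> M) (G : set ((V + X -> M) -> Prop)) :
  sml V -> sml X -> (exists P, G P) -> (forall P, G P -> def P) ->
  (forall P Q, G P -> G Q ->
     exists R, G R /\ forall v, R (join v e) -> P (join v e) /\ Q (join v e)) ->
  (forall P, G P -> exists v, P (join v e)) ->
  exists v, forall P, G P -> P (join v e).
Proof.
move=> sV sX [P0 GP0] Gdef Gdir Gsat.
pose good (P : (V + X -> M) -> Prop) (theta : pformula M V) :=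
  formula_over (range e) theta /\ forall v, psat v theta <-> P (join v e).
have good_ex P : G P -> exists theta, good P theta.
  move=> /Gdef dP.
  have dP2 : def2 (fun v w => P (join v w)).
    by apply: def_ext dP => w; rewrite (_ : join _ _ = w) //; apply: funext => -[].
  have [n [g [h Pgh]]] := def_finite dP2; have [phi Pphi] := dP2.
  exists (inst (rename (fun z => match z with inl v => inl v | inr x => inr (h x) end) phi)
               (fun i => e (g i))); split.
    by do 3 eexists; split; last by []; move=> j; exists (g j).
  move=> v; rewrite psat_inst sat_rename Pgh.
  have := Pphi (join v (fun x => e (g (h x)))).
  suff -> : join v (fun x => e (g (h x))) = fun z => join v (fun i => e (g i))
      match z with inl v => inl v | inr x => inr (h x) end by move=> <-.
  by apply: funext => -[].
pose GG : set (pformula M V) := [set theta | exists P, G P /\ good P theta].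
have [||v vGG] := @frame_sat _ _ _ V X e GG sV sX.
- by move=> theta [P [_ [+ _]]].
- move=> D /finite_set_list [l Dl] DGG.
  suff [R [GR Rl]] : exists R, G R /\ forall v, R (join v e) ->
      forall theta, D theta -> List.In theta l -> psat v theta.
    have [v Rv] := Gsat _ GR; exists v => theta Dt; exact: (Rl v Rv _ Dt (Dl _ Dt)).
  elim: l {Dl} => [|theta l [R [GR Rl]]]; first by exists P0.
  have [Dt|nDt] := pselect (D theta); last first.
    by exists R; split=> // v /Rl H th Dth [E|]; [rewrite E in nDt|exact: H].
  have [P [GP [_ Pt]]] := DGG _ Dt.
  have [Q [GQ QPR]] := Gdir _ _ GP GR.
  exists Q; split=> // v /QPR [Pv Rv] th Dth [<-|]; first by rewrite Pt.
  exact: (Rl v Rv).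
exists v => P GP; have [theta gt] := good_ex _ GP.
by rewrite -gt.2; apply: vGG; exists P.
Qed.

(** Passing to the consequences of initial segments of levels makes the family directed; a level may
    be infinite, but must then be satisfied as a whole. *)
Lemma realize_chain V X (e : X -> M) (G : nat -> set ((V + X -> M) -> Prop)) :
  sml V -> sml X -> (forall n P, G n P -> def P) ->
  (forall n, exists v, forall m P, m <= n -> G m P -> P (join v e)) ->
  exists v, forall n P, G n P -> P (join v e).
Proof.
move=> sV sX Gdef Gsat.
pose G' : set ((V + X -> M) -> Prop) := [set P | def P /\ exists n, forall v,
  (forall m Q, m <= n -> G m Q -> Q (join v e)) -> P (join v e)].
have [||||v vG'] := @realize_directed V X e G' sV sX; last first.
- exists v => n P GP; apply: vG'; split; first exact: Gdef GP.
  by exists n => w H; exact: H GP.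
- by move=> P [_ [n nP]]; have [v /nP] := Gsat n; exists v.
- move=> P Q [dP [n nP]] [dQ [m mQ]]; exists (fun w => P w /\ Q w); split=> //.
  split; first exact: def_and.
  exists (maxn n m) => v H; split; [apply: nP|apply: mQ] => i R im; apply: H.
    by rewrite leq_max im.
  by rewrite leq_max im orbT.
- by move=> P [].
- by exists (fun _ => True); split; [exact: def_cst|exists 0].
Qed.

(** Plays the role of an automorphism taking [e] to [e']: the type of [d] over [e] is transported to
    [e'] and realized there. *)
Lemma realize_type V X (e e' : X -> M) (d : V -> M) :
  sml V -> sml X -> teq e e' -> exists d', teq (join e d) (join e' d').
Proof.
move=> sV sX ee'.
pose G : set ((V + X -> M) -> Prop) := [set P | def P /\ P (join d e)].
have [||||d' Gd'] := @realize_directed V X e' G sV sX.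
- by exists (fun _ => True); split=> //; exact: def_cst.
- by move=> P [].
- move=> P Q [dP Pd] [dQ Qd]; exists (fun w => P w /\ Q w); split=> //.
  by split=> //; exact: def_and.
- move=> P [dP Pd]; have dP' : def2 (fun v w => P (join v w)).
    by apply: def_ext dP => w; rewrite (_ : join _ _ = w) //; apply: funext => -[].
  by apply: (ee' _ (def_ex dP')); exists d.
exists d' => P dP Pd.
have := Gd' (fun w => P (join (fun i => w (inr i)) (fun i => w (inl i)))).
apply; split=> //.
apply: def_ext (def_comp (fun z => match z with inl x => inr x | inr x => inl x end) dP).
by move=> w; rewrite (_ : (fun i => _) = join (fun i => w (inr i)) (fun i => w (inl i))) //;
  apply: funext => -[].
Qed.

End Saturation.

Lemma finite_set_bound (T : Type) (A : set T) (f : T -> nat) :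
  finite_set A -> exists n, forall x, A x -> f x < n.
Proof.
move=> /finite_set_list [l Al].
suff [n ln] : exists n, forall x, List.In x l -> f x < n by exists n => x /Al/ln.
elim: l {Al} => [|y l [n ln]]; first by exists 0.
exists (maxn (f y).+1 n) => x [<-|/ln H]; first by rewrite leq_max leqnn.
by rewrite leq_max H orbT.
Qed.

Definition incr (h : nat -> nat) : Prop := forall i j, i < j -> h i < h j.

Lemma incr_id : incr id. Proof. by []. Qed.

Lemma incr_comp g h : incr g -> incr h -> incr (fun i => g (h i)).
Proof. by move=> gi hi i j /hi/gi. Qed.

Lemma incr_inj h : incr h -> injective h.
Proof.
move=> hi i j E; have [/hi|/hi|//] := ltngtP i j; by rewrite E ltnn.
Qed.

Lemma incr_extend (s : seq nat) : sorted ltn s ->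
  exists g, incr g /\ forall i, i < size s -> g i = nth 0 s i.
Proof.
(* [sumn s] bounds all entries of [s], so the continuation stays increasing. *)
move=> srt; pose g i := if i < size s then nth 0 s i else (sumn s + i).+1.
have le i : i < size s -> nth 0 s i <= sumn s.
  elim: s i {srt g} => [//|x s IH] [|i] /=; first by rewrite leq_addr.
  by move=> /IH H; rewrite (leq_trans H) ?leq_addl.
exists g; split=> [i j ij|i si]; last by rewrite /g si.
rewrite /g; case: (ltnP j (size s)) => js.
  rewrite (ltn_trans ij js); have := sorted_ltn_nth ltn_trans 0 srt i j.
  by rewrite !inE; apply=> //; exact: ltn_trans js.
case: ifP => [/le H'|_]; last by rewrite !ltnS ltn_add2l.
by rewrite ltnS (leq_trans H') ?leq_addr.
Qed.

(** Sort the values of [t]. Inconsistency is stated for injective choices of indices and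
    indiscernibility for increasing ones; this reconciles the two. *)
Lemma injective_incr N (t : 'I_N -> nat) : injective t ->
  exists g, incr g /\ forall i, i < N -> exists j, g i = t j.
Proof.
move=> ti; pose s := sort leq (codom t).
have us : uniq s by rewrite sort_uniq; apply/injectiveP.
have ss : size s = N by rewrite size_sort size_codom card_ord.
have [|g [gi gs]] := @incr_extend s.
  by rewrite ltn_sorted_uniq_leq us sort_sorted //; exact: leq_total.
exists g; split=> // i iN.
have : nth 0 s i \in codom t by rewrite -(mem_sort leq) mem_nth // ss.
by move=> /codomP [j Hj]; exists j; rewrite gs ?ss.
Qed.

(** * Indiscernible sequences *)

Section IteratedUltrafilter.
Variable W : set_system nat.
Hypothesis W_ultra : UltraFilter W.
Hypothesis W_unbounded : forall j, W [set i | j < i].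

(** The n-fold tensor power of [W], evaluated on sequences of length [n]. *)
Fixpoint iterW n (Q : seq nat -> Prop) : Prop :=
  if n is m.+1 then W [set j | iterW m (fun s => Q (j :: s))] else Q [::].

Lemma W_and A B : W A -> W B -> W (A `&` B).
Proof. exact: filterI. Qed.

Lemma W_sub A B : (forall x, A x -> B x) -> W A -> W B.
Proof. exact: filterS. Qed.

Lemma W_all A : (forall x, A x) -> W A.
Proof. by move=> H; apply: (W_sub _ (@filterT _ W _)) => x _. Qed.

Lemma iterW_sub n Q Q' : (forall s, Q s -> Q' s) -> iterW n Q -> iterW n Q'.
Proof.
elim: n Q Q' => [|n IH] Q Q' QQ' /=; first exact: QQ'.
by apply: W_sub => j; apply: IH => s; exact: QQ'.
Qed.

Lemma iterW_and n Q Q' : iterW n Q -> iterW n Q' -> iterW n (fun s => Q s /\ Q' s).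
Proof.
elim: n Q Q' => [//|n IH] Q Q' /= H H'.
by apply: W_sub (W_and H H') => j [/IH]; apply.
Qed.

Lemma iterW_not n Q : ~ iterW n Q -> iterW n (fun s => ~ Q s).
Proof.
elim: n Q => [//|n IH] Q /= H.
have [//|] := in_ultra_setVsetC [set j | iterW n (fun s => Q (j :: s))] W_ultra.
by apply: W_sub => j /IH.
Qed.

Lemma iterW_path n j : iterW n (fun s => size s = n /\ path ltn j s).
Proof.
elim: n j => [//|n IH] j /=; apply: W_sub (W_unbounded j) => i ji.
by apply: iterW_sub (IH i) => s [-> ->]; split=> //; rewrite andbT.
Qed.

Lemma iterW_ex n Q : iterW n Q -> exists s, [/\ size s = n, sorted ltn s & Q s].
Proof.
have ex m Q' : iterW m Q' -> exists s, Q' s.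
  elim: m Q' => [|m IH] Q' /=; first by exists [::].
  by move=> /(@filter_ex _ _ _) [j /IH [s]]; exists (j :: s).
move=> /(iterW_and (iterW_path n 0))/ex [s [[ss p] q]]; exists s; split=> //.
exact: path_sorted p.
Qed.

(** Quantifying by [W] over an index that [Q] ignores changes nothing. Hence a generic property of
    [n] indices holds at any increasing choice from [m] generic ones, which is the source of
    indiscernibility. *)
Lemma iterW_select n m h Q : incr h -> (forall i, i < n -> h i < m) ->
  iterW n Q -> iterW m (fun s => Q (mkseq (fun i => nth 0 s (h i)) n)).
Proof.
elim: m n h Q => [|m IH] n h Q hi hm.
  by case: n hm => [//|n] /(_ 0 isT).
case: n hm => [|n] hm /= H.
  by apply: W_all => j; apply: (IH 0 h (fun=> _)) => // i.
have [h0|h0] := posnP (h 0).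
  apply: W_sub H => j H.
  have hS i : h i.+1 = (h i.+1).-1.+1.
    by rewrite prednK //; apply: leq_ltn_trans (hi i i.+1 _).
  apply: iterW_sub (IH n (fun i => (h i.+1).-1) _ _ _ H) => [s||].
  - rewrite /mkseq /= h0 /= -[1]/(1 + 0) iotaDl -map_comp.
    by congr Q; congr cons; apply: eq_map => i /=; rewrite add1n [h _]hS.
  - by move=> i j' ij; rewrite -ltnS -!hS hi.
  - by move=> i ni; rewrite -ltnS -hS; exact: hm.
apply: W_all => j.
have hS i : h i = (h i).-1.+1.
  by case: i => [|i]; rewrite prednK //; apply: leq_ltn_trans (hi 0 i.+1 _).
apply: iterW_sub (IH n.+1 (fun i => (h i).-1) _ _ _ H) => [s||].
- congr Q; apply: eq_map => i; by rewrite [in RHS]hS.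
- by move=> i j' ij; rewrite -ltnS -!hS hi.
- by move=> i ni; rewrite -ltnS -hS; exact: hm.
Qed.

(** Stated on infinite index sequences with only the first [n] values controlled, so that properties
    depending on different numbers of terms can be combined. *)
Definition generic (n : nat) (P : (nat -> nat) -> Prop) : Prop :=
  iterW n (fun s => forall g, incr g -> (forall i, i < n -> g i = nth 0 s i) -> P g).

Lemma generic_widen n m P : n <= m -> generic n P -> generic m P.
Proof.
move=> nm H.
apply: iterW_sub (iterW_select (h := id) incr_id _ H) => [s K g gi gs|i ni].
  by apply: K => // i ni; rewrite nth_mkseq // gs // (leq_trans ni).
exact: leq_trans ni nm.
Qed.

Lemma generic_select n h P : incr h -> generic n P ->
  generic (h n) (fun g => P (fun i => g (h i))).
Proof.
move=> hi H; apply: iterW_sub (iterW_select hi (fun i => hi i n) H) => s K g gi gs.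
apply: K => [|i ni]; first exact: incr_comp.
by rewrite nth_mkseq // gs // hi.
Qed.

Lemma generic_and n P Q : generic n P -> generic n Q -> generic n (fun g => P g /\ Q g).
Proof.
move=> H K; apply: iterW_sub (iterW_and H K) => s [p q] g gi gs.
by split; [apply: p|apply: q].
Qed.

Lemma generic_dec n P :
  (forall g g', (forall i, i < n -> g i = g' i) -> P g -> P g') ->
  ~ generic n P -> generic n (fun g => ~ P g).
Proof.
move=> dP /iterW_not; apply: iterW_sub => s H g gi gs Pg; apply: H => g' _ gs'.
by apply: dP Pg => i ni; rewrite gs // gs'.
Qed.

Lemma generic_ex n P : generic n P -> exists g, incr g /\ P g.
Proof.
move=> /iterW_ex [s [ss /incr_extend [g [gi gs]] H]]; exists g; split=> //.
by apply: H => // i ni; rewrite gs // ss.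
Qed.

End IteratedUltrafilter.

Lemma unbounded_ultrafilter :
  exists W : set_system nat, UltraFilter W /\ forall j, W [set i | j < i].
Proof.
have [W [uW evW]] := ultraFilterLemma (eventually_filter).
by exists W; split=> // j; apply: evW; exists j.+1.
Qed.

Section Indiscernible.
Context {L : language} {M : structure L} {F : framed M}.

(* The pattern of the sequence e that is generic for the ultrafilter is realized
   by an indiscernible sequence. *)
Lemma indiscernible V B (e : nat -> V -> M) (b : B -> M) : sml V -> sml B ->
  exists e' : nat -> V -> M,
    (forall P, def P -> (forall g, incr g -> P (join (flat (fun i => e (g i))) b)) ->
       P (join (flat e') b)) /\
    (forall h, incr h -> teq (join b (flat (fun i => e' (h i)))) (join b (flat e'))).
Proof.
move=> sV sB; have [W [uW Wj]] := unbounded_ultrafilter.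
pose gen P n := generic W n (fun g => P (join (flat (fun i => e (g i))) b)).
pose G : set ((nat * V + B -> M) -> Prop) := [set P | def P /\ exists n, gen P n].
have G_and P Q : G P -> G Q -> G (fun w => P w /\ Q w).
  move=> [dP [n Pn]] [dQ [m Qm]]; split; first exact: def_and.
  exists (maxn n m); apply: generic_and.
    exact: generic_widen (leq_maxl n m) Pn.
  exact: generic_widen (leq_maxr n m) Qm.
have [||||e0 e0G] := @realize_directed _ _ F _ _ b G (sml_prod sml_nat sV) sB.
- by exists (fun _ => True); split; [exact: def_cst|exists 0].
- by move=> P [].
- by move=> P Q GP GQ; exists (fun w => P w /\ Q w); split=> //; exact: G_and.
- by move=> P [_ [n /(generic_ex uW Wj) [g [_ Pg]]]]; eexists; exact: Pg.
(* [P] involves finitely many terms of the sequence, so the ultrafilter decides it: the generic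
   pattern is a complete type. *)
have gen_dec P : def P -> exists n, gen P n \/ gen (fun w => ~ P w) n.
  move=> dP; have [A [fA HA]] := def_support dP.
  have [n An] := finite_set_bound (fun z : nat * V + B => if z is inl p then p.1 else 0) fA.
  exists n; have [|H] := pselect (gen P n); [by left|right].
  apply: generic_dec H => g g' gg'; apply: (HA _ _ _).1.
  by case=> [[i v]|//] /An /= ni; rewrite /flat /= gg'.
have e0_iff P : def P -> P (join e0 b) -> G P.
  move=> dP Pe; split=> //; have [n [|H]] := gen_dec P dP; first by exists n.
  by have := e0G _ (conj (def_not dP) (ex_intro _ n H)).
have E : flat (fun i v => e0 (i, v)) = e0 by apply: funext => -[].
exists (fun i v => e0 (i, v)); split=> [P dP H|h hi].
  by rewrite E; apply: e0G; split=> //; exists 0 => g gi _; exact: H.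
apply: teq_sym => P dP; rewrite E => Pe.
pose s (z : B + nat * V) : nat * V + B := match z with inl x => inr x | inr p => inl p end.
have [_ [n Pn]] : G (fun w => P (fun z => w (s z))).
  apply: e0_iff; first exact: def_comp.
  by rewrite (_ : (fun z => _) = join b e0) //; apply: funext => -[].
pose sh (z : B + nat * V) : nat * V + B :=
  match z with inl x => inr x | inr p => inl (h p.1, p.2) end.
rewrite (_ : join b _ = fun z => join e0 b (sh z)); last by apply: funext => -[].
apply: (e0G (fun w => P (fun z => w (sh z)))); split; first exact: def_comp.
(* The selected indices [h 0, ..., h (n-1)] all lie below [h n]. *)
exists (h n); apply: iterW_sub (generic_select uW hi Pn) => // t Ht g gi gt.
have := Ht g gi gt; congr P; by apply: funext => -[].
Qed.

End Indiscernible.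

Definition kinc (T : Type) (k : nat) (G : nat -> T -> Prop) : Prop :=
  forall t : 'I_k -> nat, injective t -> ~ exists x, forall i, G (t i) x.

Definition is_array (T S : Type) (psi : T -> S -> Prop) (k n : nat)
    (A : nat -> nat -> S) : Prop :=
  (forall l, l < n -> kinc k (fun j x => psi x (A l j))) /\
  (forall f : nat -> nat, exists x, forall l, l < n -> psi x (A l (f l))).

Lemma kinc_sub (T : Type) k (G : nat -> T -> Prop) (h : nat -> nat) :
  injective h -> kinc k G -> kinc k (fun j => G (h j)).
Proof. by move=> hi H t ti; apply: (H (fun i => h (t i))) => i j /hi/ti. Qed.

Lemma kinc_mono (T : Type) k k' (G : nat -> T -> Prop) : k <= k' -> kinc k G -> kinc k' G.
Proof.
move=> kk H t ti [x Hx]; apply: (H (fun i => t (widen_ord kk i))).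
  by move=> i j /ti/(congr1 val) /= E; exact: val_inj.
by exists x.
Qed.

(** * Arrays in NTP2 theories *)

Section Arrays.
Context {L : language} {M : structure L} {F : framed M}.

Definition array_tuple Y (A : nat -> nat -> Y -> M) : nat * (nat * Y) -> M :=
  flat (fun l => flat (A l)).

(** Rows are made indiscernible one at a time, each over all the others. What was achieved for
    earlier rows survives, because the new row satisfies whatever held of every increasing
    subsequence of the old one. *)
Lemma mutually_indiscernible V Y (psi : (V -> M) -> (Y -> M) -> Prop) k n A :
  sml Y -> def2 psi -> is_array psi k n A ->
  exists A', is_array psi k n A' /\
    forall g, (forall l, incr (g l)) -> (forall l, n <= l -> g l = id) ->
      teq (array_tuple (fun l j => A' l (g l j))) (array_tuple A').
Proof.
move=> sY dpsi arrA.
suff H t : t <= n -> exists A', is_array psi k n A' /\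
    forall g, (forall l, incr (g l)) -> (forall l, t <= l -> g l = id) ->
      teq (array_tuple (fun l j => A' l (g l j))) (array_tuple A') by exact: H.
elim: t => [_|t IH tn].
  exists A; split=> // g _ gid.
  suff -> : (fun l j => A l (g l j)) = A by [].
  by apply: funext => l; rewrite gid.
have [{arrA}{}A [[rA pA] A_ind]] := IH (ltnW tn).
(* The parameters are the other rows; row [t] is masked by a second copy of row [t.+1] to keep the
   index type. *)
pose b := array_tuple (fun l => if l == t then A t.+1 else A l).
have [e [eE eI]] := indiscernible (A t) b sY (sml_prod sml_nat (sml_prod sml_nat sY)).
pose A' l := if l == t then e else A l.
pose s (p : nat * (nat * Y)) : nat * Y + nat * (nat * Y) :=
  if p.1 == t then inl p.2 else inr p.
have A's l j y : A' l j y = join (flat e) b (s (l, (j, y))).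
  by rewrite /A' /s /=; case: ifP => //= lt; rewrite /b /array_tuple /flat /= lt.
exists A'; split; [split=> [l ln|f]|].
- rewrite /A'; case: eqP => [lt|_]; last exact: rA.
  move=> i ii.
  apply: (eE (fun w => ~ exists x, forall c, psi x (fun y => w (inl (i c, y))))); first definable.
  move=> g gi; have := kinc_sub (incr_inj gi) (rA t tn); exact.
- have := eE (fun w => exists x, forall l, l < n -> psi x (fun y => w (s (l, (f l, y))))).
  case=> [|g gi|x Hx]; first definable.
    have [x Hx] := pA (fun l => if l == t then g (f l) else f l).
    exists x => l ln; have := Hx l ln; congr psi; apply: funext => y.
    by rewrite /s /=; case: eqP => [->|/eqP/negPf lt] //=; rewrite /b /array_tuple /flat /= lt.
  exists x => l ln; have := Hx l ln; congr psi; apply: funext => y.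
  by rewrite A's.
- move=> g gi gid; pose g' l := if l == t then id else g l.
  (* Invariance under shifts of the other rows holds with row [t] replaced by any of its
     subsequences, hence also with [e]. *)
  have step1 : teq (array_tuple (fun l j => A' l (g' l j))) (array_tuple A').
    move=> P dP HP.
    pose sg (p : nat * (nat * Y)) := s (p.1, (g' p.1 p.2.1, p.2.2)).
    have E1 (w : _ -> M) : join (flat e) b = w -> array_tuple A' = fun p => w (s p).
      by move=> <-; apply: funext => -[l [j y]]; rewrite -A's.
    have E2 (w : _ -> M) : join (flat e) b = w ->
        array_tuple (fun l j => A' l (g' l j)) = fun p => w (sg p).
      by move=> <-; apply: funext => -[l [j y]]; rewrite -A's.
    move: HP; rewrite (E1 _ erefl) (E2 _ erefl).
    apply: (eE (fun w => P (fun p => w (sg p)) -> P (fun p => w (s p)))).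
      by apply: def_imp; exact: def_comp.
    move=> h hi.
    pose hh (p : nat * (nat * Y)) := (p.1, (if p.1 == t then h p.2.1 else p.2.1, p.2.2)).
    have g'i l : incr (g' l) by rewrite /g'; case: ifP => // _; exact: incr_id.
    have g'id l : t <= l -> g' l = id.
      move=> tl; rewrite /g'; case: ifP => // /negbT lt; apply: gid.
      by rewrite ltn_neqAle eq_sym lt.
    have := A_ind g' g'i g'id _ (def_comp hh dP).
    set a1 := (X in P X -> _); set a2 := (X in _ -> P X); set a3 := (X in _ -> P X -> _).
    set a4 := (X in _ -> _ -> P X).
    have -> : a1 = a3.
      apply: funext => -[l [j y]]; rewrite /a1 /a3 /array_tuple /flat /hh /sg /s /g' /=.
      by case: eqP => [->|/eqP/negPf lt] //=; rewrite /b /array_tuple /flat /= lt.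
    have -> : a2 = a4.
      apply: funext => -[l [j y]]; rewrite /a2 /a4 /array_tuple /flat /hh /sg /s /g' /=.
      by case: eqP => [->|/eqP/negPf lt] //=; rewrite /b /array_tuple /flat /= lt.
    exact.
  apply: teq_trans step1.
  pose sg (p : nat * (nat * Y)) : nat * (nat * Y) + nat * Y :=
    if p.1 == t then inr p.2 else inl (p.1, (g' p.1 p.2.1, p.2.2)).
  apply: (teq_re sg (eI _ (gi t))) => -[l [j y]]; rewrite /sg /A' /g' /array_tuple /flat /=.
    by case: eqP => [lt|/eqP/negPf lt]; rewrite /= /b /array_tuple /flat /= ?lt.
  by case: eqP => [lt|/eqP/negPf lt]; rewrite /= /b /array_tuple /flat /= ?lt.
Qed.

Lemma k_inconsistentE V k (theta : nat -> pformula M V) :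
  k_inconsistent k theta <-> kinc k (fun i x => psat x (theta i)).
Proof.
split=> H t ti.
  move=> [x Hx]; apply: (H t ti) => D _ DR; exists x => th /DR [i _ <-]; exact: Hx.
move=> con; have [||x Hx] := con (range (theta \o t)).
- by apply: finite_image; exact: finite_finset.
- exact: subset_refl.
- by apply: (H t ti); exists x => i; apply: Hx; exists i.
Qed.

Lemma def_finite_both V Y (psi : (V -> M) -> (Y -> M) -> Prop) : def2 psi ->
  exists (p n : nat) (phi : formula L ('I_p + 'I_n)) (gV : 'I_p -> V) (gY : 'I_n -> Y)
    (hV : V -> 'I_p),
    (forall x y, psi x y <-> psat (fun i => x (gV i)) (inst phi (fun i => y (gY i)))) /\
    (forall u y, psi (fun i => u (hV i)) y <-> psat u (inst phi (fun i => y (gY i)))).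
Proof.
move=> dpsi; have [n [gY [hY HY]]] := def_finite dpsi.
have dpsi' : def2 (fun y x => psi x y) by definable.
have [p [gV [hV HV]]] := def_finite dpsi'.
have [phi Hphi] := dpsi.
exists p, n, (rename (fun z => match z with inl v => inl (hV v) | inr y => inr (hY y) end) phi).
exists gV, gY, hV.
suff H u y : psi (fun i => u (hV i)) y <->
    psat u (inst (rename (fun z : V + Y => match z with inl v => inl (hV v)
                            | inr y => inr (hY y) end) phi) (fun i => y (gY i))).
  by split=> // x y; rewrite -H HV.
rewrite psat_inst sat_rename HY.
have := Hphi (join (fun i => u (hV i)) (fun i => y (gY (hY i)))).
suff -> : join (fun i => u (hV i)) (fun i => y (gY (hY i))) =
  fun z => join u (fun i => y (gY i)) (match z with inl v => inl (hV v)
                            | inr y => inr (hY y) end) by [].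
by apply: funext => -[].
Qed.

(** Compactness turns arrays with every finite number of rows into one with infinitely many; finite
    support then cuts both tuples of variables down to those of a formula. *)
Lemma TP2_of_arrays V Y (psi : (V -> M) -> (Y -> M) -> Prop) :
  sml Y -> def2 psi -> (forall n, exists A, is_array psi 2 n A) ->
  ~ NTP2 M.
Proof.
move=> sY dpsi HA ntp2.
have sY3 : sml (nat * (nat * Y)) := sml_prod sml_nat (sml_prod sml_nat sY).
have sv : sml void by exists (fun v : void => match v with end) => -[].
pose G N : set ((nat * (nat * Y) + void -> M) -> Prop) := [set P |
  (exists l (t : 'I_2 -> nat), [/\ l <= N, injective t &
     P = fun w => ~ exists x, forall c, psi x (fun y => w (inl (l, (t c, y))))]) \/
  (exists f, P = fun w => exists x, forall l, l < N -> psi x (fun y => w (inl (l, (f l, y)))))].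
have [|N|a0 Ha] := @realize_chain _ _ F _ _ (of_void M) G sY3 sv.
- by move=> N P [[l [t [_ _ ->]]]|[f ->]]; definable.
- have [A [rA pA]] := HA N.+1; exists (array_tuple A) => m P mN.
  case=> [[l [t [lm ti ->]]]|[f ->]].
    by apply: (rA l _ t ti); rewrite ltnS (leq_trans lm).
  have [x Hx] := pA f; exists x => l lm; apply: Hx; apply: leq_trans lm _; exact: leqW.
pose a l j y := a0 (l, (j, y)).
have [p [n [phi [gV [gY [hV [H1 H2]]]]]]] := def_finite_both dpsi.
apply: (ntp2 p n phi); exists (fun l j i => a l j (gY i)); split.
  move=> l; apply/k_inconsistentE => t ti [u Hu].
  have : exists x, forall c, psi x (a l (t c)).
    by exists (fun i => u (hV i)) => c; rewrite H2.
  by have := Ha l _ (or_introl (ex_intro _ l (ex_intro _ t (And3 (leqnn l) ti erefl)))).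
move=> f D fD DR.
have /choice [al Hal] : forall th : pformula M 'I_p, exists al, D th ->
    inst phi (fun i => a al (f al) (gY i)) = th.
  move=> th; have [/DR [al _ E]|nD] := pselect (D th); first by exists al.
  by exists 0.
have [N HN] := finite_set_bound al fD.
have [x Hx] := Ha N _ (or_intror (ex_intro _ f erefl)).
exists (fun i => x (gV i)) => th Dth; rewrite -(Hal th Dth) -H1.
exact: (Hx _ (HN _ Dth)).
Qed.

(** Any [uphalf k] pairs of neighbours contain at least [k] distinct terms. *)
Lemma pair_array_kinc V Y (psi : (V -> M) -> (Y -> M) -> Prop) k (A : nat -> Y -> M) :
  kinc k (fun j x => psi x (A j)) ->
  kinc (uphalf k) (fun j x => psi x (A j.*2) /\ psi x (A j.*2.+1)).
Proof.
move=> H t ti [x Hx].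
have lt (c : 'I_k) : c./2 < uphalf k.
  rewrite uphalfE gtn_half_double ltnS; apply: leq_ltn_trans (ltn_ord c).
  by rewrite -[leqRHS]odd_double_half leq_addl.
pose t2 (c : 'I_k) := odd c + (t (Ordinal (lt c))).*2.
apply: (H t2) => [c d|].
  move=> E; have := congr1 odd E; have := congr1 half E.
  rewrite /t2 !oddD !odd_double !addbF !oddb !half_bit_double => /ti [E2] E1.
  by apply: val_inj; rewrite /= -[val c]odd_double_half -[val d]odd_double_half E1 E2.
exists x => c; have [] := Hx (Ordinal (lt c)); rewrite /t2.
by case: (odd c).
Qed.

(* Among mutually indiscernible arrays, either pairs of neighbours in a row stay
   jointly consistent, which halves k, or finitely many rows refute them, and then
   grouping the rows in blocks of that size makes the new rows 2-inconsistent. *)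
Theorem no_arrays V Y (psi : (V -> M) -> (Y -> M) -> Prop) k :
  NTP2 M -> sml Y -> def2 psi -> exists n, forall A, ~ is_array psi k n A.
Proof.
move=> ntp2 sY dpsi; apply: contrapT => H.
have {}H n : exists A, is_array psi k n A.
  by apply: contrapT => K; apply: H; exists n => A HA; apply: K; exists A.
elim/ltn_ind: k Y psi sY dpsi H => k IH Y psi sY dpsi H.
have [k2|k2] := leqP k 2.
  apply: (TP2_of_arrays sY dpsi _ ntp2) => n; have [A [rA pA]] := H n.
  by exists A; split=> // l ln; exact: kinc_mono (rA l ln).
pose mutual n (A : nat -> nat -> Y -> M) := forall g, (forall l, incr (g l)) -> (forall l, n <= l -> g l = id) ->
      teq (array_tuple (fun l j => A l (g l j))) (array_tuple A).
have {}H n : exists A, is_array psi k n A /\ mutual n A.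
  by have [A /(mutually_indiscernible sY dpsi)] := H n.
pose good n := exists A, [/\ is_array psi k n A, mutual n A &
  exists x, forall l, l < n -> psi x (A l 0) /\ psi x (A l 1)].
have [all_good|] := pselect (forall n, good n).
  pose psi' x (c : bool * Y -> M) := psi x (fun y => c (false, y)) /\ psi x (fun y => c (true, y)).
  have dpsi' : def2 psi' by rewrite /psi'; definable.
  have sbY : sml (bool * Y).
    by apply: sml_prod sY; apply: sml_inj sml_nat; exact: (can_inj oddb).
  apply: (IH (uphalf k) _ _ psi' sbY dpsi').
    by rewrite uphalfE ltn_half_double -addnn -[k.+1]addn1 ltn_add2l ltnW.
  move=> n; have [A [[rA pA] mA [x Hx]]] := all_good n.
  exists (fun l j (c : bool * Y) => A l (c.1 + j.*2) c.2); split.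
    by move=> l ln; exact: (pair_array_kinc (rA l ln)).
  (* Shifting row [l] by [(f l).*2] carries the columns 0 and 1 to the pair numbered [f l]. *)
  move=> f; pose g l j := if l < n then (f l).*2 + j else j.
  have gi l : incr (g l) by move=> i j ij; rewrite /g; case: ifP; rewrite ?ltn_add2l.
  have gid l : n <= l -> g l = id.
    by move=> nl; apply: funext => j; rewrite /g ltnNge nl.
  have := teq_sym (mA g gi gid) (P := fun w => exists x, forall l, l < n ->
    psi x (fun y => w (l, (0, y))) /\ psi x (fun y => w (l, (1, y)))).
  case=> [||x' Hx']; [by definable|by exists x|].
  exists x' => l ln; have := Hx' l ln; rewrite /psi' /array_tuple /flat /g /= ln addn0.
  by rewrite add0n [_ + 1]addnC.
move=> /existsNP [n ngood].
have [n0|n0] := posnP n.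
  apply: ngood; have [A [aA mA]] := H n; exists A; split=> //.
  by have [u] := carrier_inhabited M; exists (fun=> u); rewrite n0.
(* A new parameter is a column of a block of [n] rows. *)
pose psi' x (c : nat * Y -> M) := forall r, r < n -> psi x (fun y => c (r, y)).
have dpsi' : def2 psi' by rewrite /psi'; definable.
apply: (TP2_of_arrays (sml_prod sml_nat sY) dpsi' _ ntp2) => N.
have [A [[rA pA] mA]] := H (N * n).
exists (fun be j (c : nat * Y) => A (be * n + c.1) j c.2); split=> [be beN|f]; last first.
  have [x Hx] := pA (fun l => f (l %/ n)); exists x => be beN r rn.
  have lt : be * n + r < N * n.
    by rewrite (leq_trans (n := be.+1 * n)) ?leq_mul2r ?beN ?orbT // mulSn addnC ltn_add2r.
  by have := Hx _ lt; rewrite divnMDl // divn_small // addn0.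
have lt r : r < n -> be * n + r < N * n.
  by move=> rn; rewrite (leq_trans (n := be.+1 * n)) ?leq_mul2r ?beN ?orbT // mulSn addnC ltn_add2r.
(* Two columns of one block with a common solution, moved to the positions 0 and 1, would make the
   block good. *)
move=> t ti [x Hx]; apply: ngood.
have [lo [hi [lohi Hlo Hhi]]] : exists lo hi, [/\ lo < hi,
   psi' x (fun c => A (be * n + c.1) lo c.2) & psi' x (fun c => A (be * n + c.1) hi c.2)].
  have [E|lt'|lt'] := ltngtP (t ord0) (t ord_max).
  - by exists (t ord0), (t ord_max); split.
  - by exists (t ord_max), (t ord0); split.
  - by have := ti _ _ lt'.
pose in_blk l := (be * n <= l) && (l < be * n + n).
exists (fun l => A (be * n + l)); split.
- split=> [l ln|f]; first exact: rA (lt l ln).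
  have [z Hz] := pA (fun l => f (l - be * n)); exists z => l ln.
  by have := Hz _ (lt l ln); rewrite addKn.
- move=> g gi gid; pose g' l := if in_blk l then g (l - be * n) else id.
  have g'i l : incr (g' l) by rewrite /g'; case: ifP => // _; exact: incr_id.
  have g'id l : N * n <= l -> g' l = id.
    move=> Nl; rewrite /g' /in_blk; case: ifP => // /andP [_ K].
    suff : N * n < N * n by rewrite ltnn.
    apply: leq_ltn_trans Nl (leq_trans K _).
    by rewrite addnC -mulSn leq_mul2r beN orbT.
  pose s (p : nat * (nat * Y)) := (be * n + p.1, p.2).
  apply: (teq_re s (mA g' g'i g'id)) => // -[l [j y]].
  rewrite /array_tuple /flat /s /= /g' /in_blk leq_addr ltn_add2l addKn /=.
  by case: ltnP => // /gid ->.
(* This increasing map carries the columns 0 and 1 to [lo] and [hi]. *)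
- pose g' l j := if in_blk l then (if j is j'.+1 then hi + j' else lo) else j.
  have g'i l : incr (g' l).
    move=> i j; rewrite /g'; case: ifP => // _; case: j => [//|j]; case: i => [|i] ij.
      by rewrite ltn_addr.
    by rewrite ltn_add2l.
  have g'id l : N * n <= l -> g' l = id.
    move=> Nl; apply: funext => j; rewrite /g' /in_blk; case: ifP => // /andP [_ K].
    suff : N * n < N * n by rewrite ltnn.
    apply: leq_ltn_trans Nl (leq_trans K _).
    by rewrite addnC -mulSn leq_mul2r beN orbT.
  have := mA g' g'i g'id (fun w => exists x, forall l, l < n ->
    psi x (fun y => w (be * n + l, (0, y))) /\ psi x (fun y => w (be * n + l, (1, y)))).
  apply; first by definable.
  exists x => l ln; have := Hlo l ln; have := Hhi l ln.
  by rewrite /array_tuple /flat /g' /in_blk /= leq_addr ltn_add2l ln /= addn0.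
Qed.

End Arrays.

Lemma injective_extend N (t : 'I_N -> nat) : injective t ->
  exists tau : nat -> nat, injective tau /\ forall i : 'I_N, tau i = t i.
Proof.
move=> ti; pose m := \max_(i < N) t i.
pose tau i := if insub i is Some j then t j else (m + i).+1.
have tm j : t j <= m by exact: leq_bigmax.
exists tau; split=> [i j|i]; last by rewrite /tau valK.
rewrite /tau; case: insubP => [i' _ <-|_]; case: insubP => [j' _ <-|_].
- by move=> /ti ->.
- by move=> E; have := tm i'; rewrite E ltnNge leq_addr.
- by move=> E; have := tm j'; rewrite -E ltnNge leq_addr.
- by move=> [] /addnI.
Qed.

(** * Dividing and forking *)

Section Dividing.
Context {L : language} {M : structure L} {F : framed M}.

Definition Div V X Y (E : X -> M) (b : Y -> M)
    (psi : (V -> M) -> (X -> M) -> (Y -> M) -> Prop) (k : nat) : Prop :=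
  exists bs : nat -> Y -> M, (forall i, teq (join E (bs i)) (join E b)) /\
    kinc k (fun i x => psi x E (bs i)).

(* The type of c over (E, b) does not divide over E. *)
Definition ndiv V X Y (E : X -> M) (c : V -> M) (b : Y -> M) : Prop :=
  forall psi, def3 psi -> psi c E b -> forall k, ~ Div E b psi k.

(* The type of c over (E, b) does not fork over E, in the form: it extends to a
   non-dividing type over any larger small tuple. *)
Definition nfork V X Y (E : X -> M) (c : V -> M) (b : Y -> M) : Prop :=
  forall (W : Type) (d : W -> M), sml W ->
  exists c', teq (join (join E b) c') (join (join E b) c) /\ ndiv E c' (join b d).

Lemma Div_teq V X Y (E : X -> M) (b b' : Y -> M)
    (psi : (V -> M) -> (X -> M) -> (Y -> M) -> Prop) k :
  teq (join E b) (join E b') -> Div E b psi k -> Div E b' psi k.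
Proof.
move=> bb' [bs [H K]]; exists bs; split=> // i; exact: teq_trans (H i) bb'.
Qed.

(** Since the type of [c] over [b] does not divide, arbitrarily long finite parts of a dividing
    sequence are compatible with any one condition on [c]. So dividing over [E] can be witnessed by
    conjugates over [E] and [c], with the same [k]. *)
Lemma Div_conj V Z X Y (E : X -> M) (c : Z -> M) (b : Y -> M)
    (psi : (V -> M) -> (X -> M) -> (Y -> M) -> Prop) k :
  sml Z -> sml X -> sml Y -> def3 psi -> ndiv E c b -> Div E b psi k ->
  exists bs : nat -> Y -> M,
    (forall i, teq (join (join E c) (bs i)) (join (join E c) b)) /\
    kinc k (fun i x => psi x E (bs i)).
Proof.
move=> sZ sX sY dpsi cb [bs0 [bs0E bs0k]].
(* The unknowns are a copy of [c] and a sequence whose first [N] terms satisfy [Q] with it. *)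
pose cond N (Q : (Z -> M) -> (X -> M) -> (Y -> M) -> Prop) (v : Z + nat * Y -> M) :=
  (forall i, i < N -> Q (fun z => v (inl z)) E (fun y => v (inr (i, y)))) /\
  kinc k (fun i x => psi x E (fun y => v (inr (i, y)))).
pose GG : set (((Z + nat * Y) + X -> M) -> Prop) := [set P | def P /\ exists N Q,
   [/\ def3 Q, Q c E b & forall v, cond N Q v -> P (join v E)]].
have sV : sml (Z + nat * Y) by apply: sml_sum => //; apply: sml_prod => //; exact: sml_nat.
have [||||v Hv] := @realize_directed _ _ F _ _ E GG sV sX.
- exists (fun=> True); split; first exact: def_cst.
  by exists 0, (fun _ _ _ => True); split=> //; exact: def_cst.
- by move=> P [].
- move=> P P' [dP [N [Q [dQ Qc NQ]]]] [dP' [N' [Q' [dQ' Qc' NQ']]]].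
  exists (fun w => P w /\ P' w); split=> //; split; first exact: def_and.
  exists (maxn N N'), (fun x y z => Q x y z /\ Q' x y z); split=> //; first by definable.
  move=> v [H K]; split; [apply: NQ|apply: NQ']; split=> // i iN.
    by have [] := H i _ => //; rewrite leq_max iN.
  by have [] := H i _ => //; rewrite leq_max iN orbT.
- move=> P [dP [N [Q [dQ Qc NQ]]]].
  (* Otherwise [Q] itself would divide, with constant [N]. *)
  have : ~ kinc N (fun i x => Q x E (bs0 i)).
    by move=> K; apply: (cb Q dQ Qc N); exists bs0.
  move=> /existsNP [t /not_implyP [ti /contrapT [x Hx]]].
  have [tau [taui Htau]] := injective_extend ti.
  exists (join x (flat (fun i => bs0 (tau i)))); apply: NQ; split=> [i iN|].
    by have := Hx (Ordinal iN); rewrite -Htau.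
  exact: (kinc_sub taui bs0k).
pose c' z := v (inl z); pose bs' i y := v (inr (i, y)).
have Hk : kinc k (fun i x => psi x E (bs' i)).
  move=> t ti; apply: (Hv (fun w => ~ exists x, forall i,
    psi x (fun j => w (inr j)) (fun y => w (inl (inr (t i, y)))))).
  split; first by definable.
  by exists 0, (fun _ _ _ => True); split=> [||u [_]]; [exact: def_cst| |apply].
have Hc i : teq (join (join E c') (bs' i)) (join (join E c) b).
  apply: teq_sym => P dP HP.
  apply: (Hv (fun w => P (join (join (fun j => w (inr j)) (fun z => w (inl (inl z))))
    (fun y => w (inl (inr (i, y))))))).
  split; first by definable.
  exists i.+1, (fun x y z => P (join (join y x) z)); split=> //; first by definable.
  by move=> u [H _]; apply: H.
have cc' : teq (join E c') (join E c).
  by apply: (teq_re inl (Hc 0)) => -[].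
(* The sequence was found over the copy [c']; conjugation brings it back over [c]. *)
have [d' Hd] := realize_type (flat bs') (sml_prod sml_nat sY) (sml_sum sX sZ) cc'.
exists (fun i y => d' (i, y)); split=> [i|t ti].
  apply: teq_trans (Hc i); apply: teq_sym.
  by apply: (teq_re (fun z => match z with inl x => inl x | inr y => inr (i, y) end) Hd) => -[].
have := Hd (fun w => ~ exists x, forall i, psi x (fun z => w (inl (inl z)))
  (fun y => w (inr (t i, y)))).
by apply; [definable|exact: Hk].
Qed.

(** Left transitivity: by [Div_conj] the dividing sequence can be taken over [c], and then it
    witnesses dividing for [d]. *)
Lemma ndiv_join V W X Y (E : X -> M) (c : V -> M) (d : W -> M) (a : Y -> M) :
  sml V -> sml X -> sml Y ->
  ndiv E c a -> ndiv E d (join c a) -> ndiv E (join c d) a.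
Proof.
move=> sV sX sY ca dca psi dpsi Hpsi k Hk.
have [bs [bsE bsk]] := Div_conj sV sX sY dpsi ca Hk.
apply: (dca (fun z E (w : V + Y -> M) => psi (join (fun i => w (inl i)) z) E
    (fun y => w (inr y))) _ _ k).
- by definable.
- exact: Hpsi.
exists (fun i => join c (bs i)); split=> [i|t ti [x Hx]].
  by apply: (teq_re (fun z => match z with inl x => inl (inl x)
    | inr (inl z) => inl (inr z) | inr (inr y) => inr y end) (bsE i)) => -[|[]].
by apply: (bsk t ti); exists (join c x).
Qed.

Lemma Div_re V V' X Y Y' (E : X -> M) (b : Y -> M) (b' : Y' -> M)
    (s : V' -> V) (t : Y' -> Y) (psi : (V' -> M) -> (X -> M) -> (Y' -> M) -> Prop) k :
  sml X -> sml Y -> sml Y' -> (forall y, b' y = b (t y)) -> Div E b' psi k ->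
  Div E b (fun x E w => psi (fun z => x (s z)) E (fun y => w (t y))) k.
Proof.
move=> sX sY sY' bt [bs [bsE bsk]].
have /choice [d Hd] i : exists d, teq (join (join E b') b) (join (join E (bs i)) d).
  by apply: realize_type => //; [exact: sml_sum|exact: teq_sym].
exists d; split=> [i|u ui [x Hx]].
  apply: teq_sym; apply: (teq_re (fun z => match z with inl x => inl (inl x)
    | inr y => inr y end) (Hd i)) => -[] //.
apply: (bsk u ui); exists (fun z => x (s z)) => i.
have := Hx i; congr psi; apply: funext => y.
have := Hd (u i) (fun w => w (inl (inr y)) = w (inr (t y))) (def_eq _ _ _).
by move=> /(_ (bt y)) /= ->.
Qed.

Lemma ndiv_re V V' X Y Y' (s : V' -> V) (t : Y' -> Y) (E : X -> M) (c : V -> M) (b : Y -> M)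
    (c' : V' -> M) (b' : Y' -> M) :
  sml X -> sml Y -> sml Y' -> ndiv E c b ->
  (forall z, c' z = c (s z)) -> (forall y, b' y = b (t y)) -> ndiv E c' b'.
Proof.
move=> sX sY sY' cb cs bt psi dpsi Hpsi k Hk.
apply: (cb _ _ _ k (Div_re s sX sY sY' bt Hk)); first by definable.
move: Hpsi; congr psi; by apply: funext.
Qed.

(** Base monotonicity: [s] and [t] say that [E'] lies between [E] and [E] together with [b]. *)
Lemma ndiv_base V X X' Y Y' (s : X' -> X + Y) (t : X -> X') (r : Y' -> Y)
    (E : X -> M) (E' : X' -> M) (c : V -> M) (b : Y -> M) (b' : Y' -> M) :
  sml X -> sml X' -> sml Y -> sml Y' -> ndiv E c b ->
  (forall x, E' x = join E b (s x)) -> (forall x, E x = E' (t x)) ->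
  (forall y, b' y = b (r y)) -> ndiv E' c b'.
Proof.
move=> sX sX' sY sY' cb Es Et br psi dpsi Hpsi k Hk.
have [bs [bsE bsk]] : Div E' b (fun x E w => psi x E (fun y => w (r y))) k.
  exact: (@Div_re V V X' Y Y' E' b b' id r psi k).
apply: (cb (fun x E w => psi x (fun z => join E w (s z)) (fun y => w (r y))) _ _ k).
- have := def3_selects dpsi.
  rewrite /def3 => H; apply: H; [exact: selects_var| |exact: selects_var].
  exists (fun z => match s z with inl i => inr (inl i) | inr i => inr (inr i) end) => w.
  by apply: funext => z; case: (s z).
- move: Hpsi; rewrite (_ : b' = fun y => b (r y)); last exact: funext.
  by rewrite (_ : E' = fun z => join E b (s z)) //; exact: funext.
exists bs; split=> [i|u ui [x Hx]].
  apply: (teq_re (fun z => match z with inl x => inl (t x) | inr y => inr y end) (bsE i)).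
    by case.
  by case.
apply: (bsk u ui); exists x => i.
have := Hx i; congr psi; apply: funext => z.
case Ez: (s z) => [x0|y0] /=; first by rewrite Es Ez.
(* The terms of the sequence are conjugate over [E'], so the coordinates of [b] lying in [E'] are
   constant along it. *)
have H := teq_sym (bsE (u i)) (def_eq M (inr y0) (inl z)).
by apply: H; rewrite /= Es Ez.
Qed.

Lemma nfork_re V X Y Y' (t : Y' -> Y) (E : X -> M) (c : V -> M) (b : Y -> M) (b' : Y' -> M) :
  sml X -> sml Y -> sml Y' -> nfork E c b -> (forall y, b' y = b (t y)) -> nfork E c b'.
Proof.
move=> sX sY sY' H bt W d sW.
have [c' [cc' c'b]] := H W d sW; exists c'; split.
  by apply: (teq_re (fun z => match z with inl (inl x) => inl (inl x)
    | inl (inr y) => inl (inr (t y)) | inr z => inr z end) cc') => -[[]|] /=.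
apply: (ndiv_re (s := id) (t := fun z => match z with inl y => inl (t y) | inr z => inr z end)
  sX (sml_sum sY sW) (sml_sum sY' sW) c'b) => //.
by case.
Qed.

Lemma nfork_base V X X' Y Y' (s : X' -> X + Y) (t : X -> X') (r : Y' -> Y)
    (E : X -> M) (E' : X' -> M) (c : V -> M) (b : Y -> M) (b' : Y' -> M) :
  sml X -> sml X' -> sml Y -> sml Y' -> nfork E c b ->
  (forall x, E' x = join E b (s x)) -> (forall x, E x = E' (t x)) ->
  (forall y, b' y = b (r y)) -> nfork E' c b'.
Proof.
move=> sX sX' sY sY' H Es Et br W d sW.
have [c' [cc' c'b]] := H W d sW; exists c'; split.
  apply: (teq_re (fun z => match z with inl (inl x) => inl (s x)
    | inl (inr y) => inl (inr (r y)) | inr z => inr z end) cc') => -[[]|] //=.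
apply: (ndiv_base (s := fun x => match s x with inl z => inl z | inr y => inr (inl y) end)
  (t := t) (r := fun z => match z with inl y => inl (r y) | inr z => inr z end)
  sX sX' (sml_sum sY sW) (sml_sum sY' sW) c'b) => //.
  by move=> x; rewrite Es; case: (s x).
by case.
Qed.

Lemma ndiv_teq V X Y (E : X -> M) (c c' : V -> M) (b b' : Y -> M) :
  teq (join (join E c) b) (join (join E c') b') -> ndiv E c b -> ndiv E c' b'.
Proof.
move=> H cb psi dpsi Hpsi k Hk.
apply: (cb psi dpsi _ k).
  have := teq_sym H (P := fun w => psi (fun z => w (inl (inr z))) (fun z => w (inl (inl z)))
    (fun z => w (inr z))).
  by apply=> //; definable.
apply: Div_teq Hk; apply: teq_sym.
by apply: (teq_re (fun z => match z with inl x => inl (inl x) | inr y => inr y end) H) => -[].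
Qed.

End Dividing.

Definition split_last (n : nat) (Y : Type) (p : 'I_n.+1 * Y) : Y + 'I_n * Y :=
  if unlift ord_max p.1 is Some j then inr (j, p.2) else inl p.2.

Lemma restr_succ (T Y : Type) n (c : nat -> Y -> T) p :
  restr (n := n.+1) c p = join (c n) (restr c) (split_last p).
Proof.
case: p => i y; rewrite /split_last /restr /=.
by case: unliftP => [j ->|->] //=; rewrite /bump leqNgt ltn_ord.
Qed.

(** * Coheirs and small models *)

Section Coheirs.
Context {L : language} {M : structure L} {F : framed M}.

(* The range of mu is the universe of an elementary substructure. *)
Definition Mod X (mu : X -> M) : Prop :=
  forall V (P : (V -> M) -> (X -> M) -> Prop), def2 P ->
    (exists v, P v mu) -> exists s : V -> X, P (fun i => mu (s i)) mu.

(* The type of c over (mu, a) is finitely satisfiable in the range of mu. *)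
Definition coh X V W (mu : X -> M) (c : V -> M) (a : W -> M) : Prop :=
  forall P, def3 P -> P c mu a -> exists s : V -> X, P (fun i => mu (s i)) mu a.

Lemma Mod_teq X (mu mu' : X -> M) : teq mu mu' -> Mod mu -> Mod mu'.
Proof.
move=> mm Mmu V P dP Pmu'.
have [s Ps] : exists s : V -> X, P (fun i => mu (s i)) mu.
  by apply: Mmu => //; apply: (teq_sym mm (def_ex dP)).
by exists s; apply: (mm (fun w => P (fun i => w (s i)) w)); first definable.
Qed.

(** If [c] distinguished [b] from [b'], some tuple of [mu] would too, and these are conjugate over
    [mu]. *)
Lemma coh_invariant X V W Y (mu : X -> M) (c : V -> M) (a : W -> M) (t t' : Y -> W)
    (b b' : Y -> M) : coh mu c a ->
  (forall y, b y = a (t y)) -> (forall y, b' y = a (t' y)) ->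
  teq (join mu b) (join mu b') -> teq (join mu (join c b)) (join mu (join c b')).
Proof.
move=> ca /funext -> /funext -> bb P dP Pb; apply: contrapT => nPb.
have [|//|s [Ps nPs]] := ca (fun c mu a => P (join mu (join c (fun y => a (t y)))) /\
  ~ P (join mu (join c (fun y => a (t' y))))); first by definable.
apply: nPs; apply: (bb (fun w => P (join (fun x => w (inl x)) (join (fun i => w (inl (s i)))
  (fun y => w (inr y))))) _ Ps); by definable.
Qed.

Lemma coh_re X V V' W W' (s : V' -> V) (t : W' -> W) (mu : X -> M) (c : V -> M) (a : W -> M)
    (c' : V' -> M) (a' : W' -> M) : coh mu c a ->
  (forall z, c' z = c (s z)) -> (forall y, a' y = a (t y)) -> coh mu c' a'.
Proof.
move=> ca /funext -> /funext -> P dP Pc.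
have [|//|u Pu] := ca (fun c mu a => P (fun z => c (s z)) mu (fun y => a (t y))); first by definable.
by exists (fun z => u (s z)).
Qed.

(** Replace [d] by a tuple of [mu] first, with [c] among its parameters, and then [c]. *)
Lemma coh_join X V V' W (mu : X -> M) (c : V -> M) (d : V' -> M) (a : W -> M) :
  coh mu c a -> coh mu d (join c a) -> coh mu (join c d) a.
Proof.
move=> ca dca P dP Pcd.
have [|//|s Ps] := dca (fun d mu (w : V + W -> M) => P (join (fun i => w (inl i)) d) mu
  (fun j => w (inr j))); first by definable.
have [|//|s' Ps'] := ca (fun c mu a => P (join c (fun i => mu (s i))) mu a); first by definable.
exists (join s' s); move: Ps'; congr P; by apply: funext => -[].
Qed.

Lemma coh_teq X V W (mu : X -> M) (c c' : V -> M) (a a' : W -> M) :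
  teq (join (join mu a) c) (join (join mu a') c') -> coh mu c a -> coh mu c' a'.
Proof.
move=> H ca P dP Pc.
have [//||s Ps] := ca P.
  apply: (teq_sym H (P := fun w => P (fun v => w (inr v)) (fun x => w (inl (inl x)))
    (fun y => w (inl (inr y))))) => //; by definable.
exists s; apply: (H (fun w => P (fun i => w (inl (inl (s i)))) (fun x => w (inl (inl x)))
    (fun y => w (inl (inr y)))) _ Ps); by definable.
Qed.

Lemma coh_extend X V W Z (mu : X -> M) (c : V -> M) (a : W -> M) (d : Z -> M) :
  sml X -> sml V -> sml W -> sml Z -> coh mu c a ->
  exists c', teq (join (join mu a) c') (join (join mu a) c) /\ coh mu c' (join a d).
Proof.
move=> sX sV sW sZ ca.
pose e := join mu (join a d).
(* The type of [c] together with the negations of all conditions over [(a, d)] without solution in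
   [mu]: any tuple of [mu] satisfying [Q] meets the finite requirements. *)
pose G : set ((V + (X + (W + Z)) -> M) -> Prop) := [set P | def P /\ exists Q R,
  [/\ def3 Q, def3 R, Q c mu a, (forall s : V -> X, ~ R (fun i => mu (s i)) mu (join a d)) &
   forall v, Q v mu a -> ~ R v mu (join a d) -> P (join v e)]].
have sE : sml (X + (W + Z)) by do ![apply: sml_sum].
have [||||v Hv] := @realize_directed _ _ F _ _ e G sV sE.
- exists (fun=> True); split; first exact: def_cst.
  exists (fun _ _ _ => True), (fun _ _ _ => False); split; [by definable|by definable|by []|by move=> s []|by move=> v _ _].
- by move=> P [].
- move=> P P' [dP [Q [R [dQ dR Qc nR QRP]]]] [dP' [Q' [R' [dQ' dR' Qc' nR' QRP']]]].
  exists (fun w => P w /\ P' w); split=> //; split; first exact: def_and.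
  exists (fun x y z => Q x y z /\ Q' x y z), (fun x y z => R x y z \/ R' x y z).
  split=> //; [by definable|by definable|by move=> s [/nR|/nR']|].
  by move=> v [H H'] K; split; [apply: QRP|apply: QRP'] => // r; apply: K; [left|right].
- move=> P [dP [Q [R [dQ dR Qc nR QRP]]]].
  by have [//|//|s Qs] := ca Q; exists (fun i => mu (s i)); apply: QRP.
exists v; split.
  apply: teq_sym => P dP Pc.
  apply: (Hv (fun w => P (join (join (fun x => w (inr (inl x))) (fun x => w (inr (inr (inl x)))))
     (fun i => w (inl i))))).
  split; first by definable.
  exists (fun v mu a => P (join (join mu a) v)), (fun _ _ _ => False).
  by split; [definable|definable| |move=> s []|].
move=> P dP Pv; apply: contrapT => nP.
suff : ~ P v mu (join a d) by apply.
apply: (Hv (fun w => ~ P (fun i => w (inl i)) (fun x => w (inr (inl x)))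
  (join (fun x => w (inr (inr (inl x)))) (fun x => w (inr (inr (inr x))))))).
split; first by definable.
exists (fun _ _ _ => True), P; split; [by definable|by []|by []| |].
  by move=> s Ps; apply: nP; exists s.
move=> u _; apply: contra_not; rewrite /e /=; congr P; by apply: funext => -[].
Qed.

Lemma sml_void : sml void.
Proof. by exists (fun v : void => match v with end) => -[]. Qed.

Lemma Mod_coh X V Z (mu : X -> M) (c : V -> M) (d : Z -> M) :
  sml X -> sml V -> sml Z -> Mod mu ->
  exists c', teq (join mu c') (join mu c) /\ coh mu c' d.
Proof.
move=> sX sV sZ Mmu.
have c0 : coh mu c (of_void M).
  move=> P dP Pc; apply: (Mmu V (fun v m => P v m (of_void M))); last by exists c.
  have H := def3E inl inr (of_void (V + X)) dP; rewrite /def2.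
  apply: def_ext H => w.
  by rewrite (_ : (fun i : void => _) = of_void M) //; apply: funext => -[].
have [c' [cc' c'd]] := coh_extend d sX sV sml_void sZ c0.
exists c'; split.
  by apply: (teq_re (fun z => match z with inl x => inl (inl x) | inr y => inr y end) cc') => -[].
by apply: (coh_re (s := id) (t := inr) c'd).
Qed.

(** A solution in [mu] satisfies [psi] at all conjugates of [b] simultaneously. *)
Lemma coh_ndiv X V W (mu : X -> M) (c : V -> M) (b : W -> M) : coh mu c b -> ndiv mu c b.
Proof.
move=> cb psi dpsi Hpsi k [bs [bsE bsk]].
have [s Ps] := cb psi dpsi Hpsi.
apply: (bsk (@nat_of_ord k) (@ord_inj k)); exists (fun i => mu (s i)) => i.
apply: (teq_sym (bsE i) (P := fun w => psi (fun i => w (inl (s i))) (fun x => w (inl x))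
  (fun y => w (inr y)))) => //; by definable.
Qed.

Lemma coh_nfork X V W (mu : X -> M) (c : V -> M) (b : W -> M) :
  sml X -> sml V -> sml W -> coh mu c b -> nfork mu c b.
Proof.
move=> sX sV sW cb Z d sZ; have [c' [H K]] := coh_extend d sX sV sW sZ cb.
by exists c'; split=> //; exact: coh_ndiv.
Qed.

(* Replacing each g_l by a conjugate p_l over the previous stages does not change
   the type, since g_l does not distinguish conjugate earlier tuples. *)
Lemma coh_paths X Y Z (mu : X -> M) (I : nat -> Z -> M) (s0 : Y -> Z) (s : nat -> Y -> Z) n :
  (forall l, l < n -> coh mu (fun y => I l (s0 y)) (restr (n := l) I)) ->
  (forall l, l < n -> teq (join (join mu (restr (n := l) I)) (fun y => I l (s l y)))
     (join (join mu (restr (n := l) I)) (fun y => I l (s0 y)))) ->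
  teq (join mu (restr (n := n) (fun l y => I l (s l y))))
      (join mu (restr (n := n) (fun l y => I l (s0 y)))).
Proof.
elim: n => [|n IH] Hc Ht.
  by rewrite (_ : restr _ = restr (n := 0) (fun l y => I l (s0 y))) //; apply: funext => -[[]].
have {}IH := IH (fun l ln => Hc l (ltnW ln)) (fun l ln => Ht l (ltnW ln)).
have H1 := @coh_invariant _ _ _ _ mu _ _ (fun p : 'I_n * Y => (p.1, s p.1 p.2))
  (fun p => (p.1, s0 p.2)) _ _ (Hc n (ltnSn n)) (fun=> erefl) (fun=> erefl) IH.
have H2 : teq (join mu (join (fun y => I n (s n y)) (restr (n := n) (fun l y => I l (s l y)))))
   (join mu (join (fun y => I n (s0 y)) (restr (n := n) (fun l y => I l (s l y))))).
  by apply: (teq_re (fun z : X + (Y + 'I_n * Y) => match z with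
    | inl x => inl (inl x) | inr (inl y) => inr y
    | inr (inr p) => inl (inr (p.1, s p.1 p.2)) end) (Ht n (ltnSn n))) => -[|[]].
apply: (teq_re (fun z => match z with inl x => inl x | inr p => inr (split_last p) end)
  (teq_trans H2 H1)) => -[] // p.
  exact: restr_succ.
exact: restr_succ.
Qed.

Section Tail.
Variable R : forall V W : Type, (V -> M) -> (W -> M) -> Prop.
Hypothesis R_re : forall V V' W W' (s : V' -> V) (t : W' -> W) (c : V -> M) (a : W -> M)
  (c' : V' -> M) (a' : W' -> M), sml W -> sml W' -> R c a ->
  (forall z, c' z = c (s z)) -> (forall y, a' y = a (t y)) -> R c' a'.
Hypothesis R_join : forall V V' W (c : V -> M) (d : V' -> M) (a : W -> M),
  sml V -> sml W -> R c a -> R d (join c a) -> R (join c d) a.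

(** The block of terms from [m] to [m + n] is stored as a sequence constant from position [n] on, so
    that its index type is independent of [n]. The abstract [R] serves both coheirs and
    nondividing. *)
Lemma tail_gen Y (G : nat -> Y -> M) : sml Y ->
  (forall l, R (G l) (restr (n := l) G)) ->
  forall m n, R (fun p : nat * Y => G (m + minn p.1 n) p.2) (restr (n := m) G).
Proof.
move=> sY RG m.
have sO l : sml ('I_l * Y) by apply: sml_prod => //; exact: sml_ord.
have sN : sml (nat * Y) by apply: sml_prod => //; exact: sml_nat.
elim=> [|n IH].
  apply: (R_re (s := snd) (t := id) (sO _) (sO _) (RG m)) => // z.
  by rewrite minn0 addn0.
pose t (z : nat * Y + 'I_m * Y) : 'I_(m + n).+1 * Y :=
  match z with inl p => (inord (m + minn p.1 n), p.2)
             | inr p => (widen_ord (leqW (leq_addr n m)) p.1, p.2) end.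
have R1 : R (G (m + n).+1) (join (fun p : nat * Y => G (m + minn p.1 n) p.2) (restr (n := m) G)).
  apply: (R_re (s := id) (t := t) (sO _) _ (RG (m + n).+1)) => //.
    exact: sml_sum.
  case=> // p; rewrite /t /restr /= inordK //.
  by rewrite ltnS leq_add2l geq_minr.
apply: (R_re (s := fun p => if p.1 <= n then inl p else inr p.2) (t := id) (sO _) (sO _)
  (R_join sN (sO _) IH R1)) => //.
move=> [i y] /=; case: leqP => ni /=.
  by rewrite (minn_idPl ni) (minn_idPl (leqW ni)).
by rewrite (minn_idPr ni) addnS.
Qed.

End Tail.

Lemma coh_tail X Y (mu : X -> M) (G : nat -> Y -> M) : sml Y ->
  (forall l, coh mu (G l) (restr (n := l) G)) ->
  forall m n, coh mu (fun p : nat * Y => G (m + minn p.1 n) p.2) (restr (n := m) G).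
Proof.
apply: (@tail_gen (fun V W => @coh X V W mu)).
  by move=> *; apply: coh_re; eauto.
by move=> *; exact: coh_join.
Qed.

Lemma ndiv_tail X Y (E : X -> M) (G : nat -> Y -> M) : sml X -> sml Y ->
  (forall l, ndiv E (G l) (restr (n := l) G)) ->
  forall m n, ndiv E (fun p : nat * Y => G (m + minn p.1 n) p.2) (restr (n := m) G).
Proof.
move=> sX; apply: (@tail_gen (fun V W => @ndiv L M V X W E)).
  by move=> V V' W W' s t c a c' a' sW sW' H cs at'; exact: (ndiv_re sX sW sW' H cs at').
by move=> *; exact: ndiv_join.
Qed.

End Coheirs.

(** * The downward Loewenheim-Skolem theorem below the saturation *)

Section SmallModels.
Context {L : language} {M : structure L} {F : framed M}.

Local Notation Th := (@frame_index L M F).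
Local Notation pr x y := (@frame_pair L M F (x, y)).
Local Notation num := (@frame_nat L M F).

Fixpoint code_seq (s : seq Th) : Th := if s is x :: s' then pr x (code_seq s') else num 0.

Lemma code_seq_inj s s' : size s = size s' -> code_seq s = code_seq s' -> s = s'.
Proof.
elim: s s' => [[]//|x s IH] [//|y s'] /= [ss] /frame_pair_inj [-> E].
by rewrite (IH s').
Qed.

Section Codes.
Variables (fn : fun_symbol L -> Th) (rl : rel_symbol L -> Th).
Hypotheses (fn_inj : injective fn) (rl_inj : injective rl).

Fixpoint code_term (V : Type) (nu : V -> Th) (t : term L V) : Th :=
  match t with
  | Var v => pr (num 0) (nu v)
  | App f ts => pr (num 1) (pr (fn f) (code_seq [seq code_term nu (ts i) | i <- enum 'I_(fun_arity f)]))
  end.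

Definition code_opt (V : Type) (nu : V -> Th) (o : option V) : Th :=
  if o is Some v then pr (num 1) (nu v) else pr (num 0) (num 0).

(** Embeds the formulas in [frame_index], which keeps the set of Skolem witnesses small. The codes
    of the variables are an argument because a quantifier changes the type of variables. *)
Fixpoint code (V : Type) (phi : formula L V) {struct phi} : (V -> Th) -> Th :=
  match phi with
  | Bot => fun nu => pr (num 0) (num 0)
  | Equal t u => fun nu => pr (num 1) (pr (code_term nu t) (code_term nu u))
  | Rel r ts => fun nu => pr (num 2) (pr (rl r)
      (code_seq [seq code_term nu (ts i) | i <- enum 'I_(rel_arity r)]))
  | Imp phi psi => fun nu => pr (num 3) (pr (code phi nu) (code psi nu))
  | All phi => fun nu => pr (num 4) (code phi (code_opt nu))
  end.

Lemma code_map_inj n (f g : 'I_n -> Th) :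
  code_seq [seq f i | i <- enum 'I_n] = code_seq [seq g i | i <- enum 'I_n] -> f =1 g.
Proof.
move=> /code_seq_inj E i; move: E; rewrite !size_map => /(_ erefl) /eq_in_map; apply.
by rewrite mem_enum.
Qed.

Lemma code_term_inj V (nu : V -> Th) : injective nu -> injective (code_term nu).
Proof.
move=> nui; elim=> [v|f ts IH] [w|g us] /= /frame_pair_inj [] //.
- by move=> /nui ->.
- by move=> /frame_nat_inj.
- by move=> /frame_nat_inj.
move=> /frame_pair_inj [/fn_inj E]; case: g / E us => us /code_map_inj H.
by congr App; apply: funext => i; apply: IH; exact: H.
Qed.

Lemma code_inj V (nu : V -> Th) (phi psi : formula L V) : injective nu ->
  code phi nu = code psi nu -> phi = psi.
Proof.
elim: phi nu psi => {V} [V|V t u|V r ts|V phi IH psi IH'|V phi IH] nu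
  [|t' u'|r' ts'|phi' psi'|phi'] nui //= /frame_pair_inj [] //; try by move=> /frame_nat_inj.
- by move=> /frame_pair_inj [/(code_term_inj nui) -> /(code_term_inj nui) ->].
- move=> /frame_pair_inj [/rl_inj E]; case: r' / E ts' => ts' /code_map_inj H.
  by congr Rel; apply: funext => i; apply: (code_term_inj nui); exact: H.
- by move=> /frame_pair_inj [/(IH _ _ nui) -> /(IH' _ _ nui) ->].
- move=> /IH -> // [v|] [w|] //= /frame_pair_inj [] //; by [move=> /nui -> | move=> /frame_nat_inj].
Qed.

End Codes.

(* Loewenheim-Skolem: level n.+1 adds witnesses for formulas over level n. *)
Theorem small_model X (E : X -> M) : sml X ->
  exists (X' : Type) (mu : X' -> M) (i : X -> X'),
    [/\ sml X', Mod mu & forall x, E x = mu (i x)].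
Proof.
move=> [eX eXi]; have [u0] := carrier_inhabited M.
have [fn fni] := @frame_fun L M F; have [rl rli] := @frame_rel L M F.
have [cf [df cfK]] : exists (f : formula L nat -> Th) g, cancel f g.
  have [|cf cfK] := @embeds_left_inverse _ _ Bot (fun phi => code fn rl phi num).
    by move=> phi psi; exact: code_inj fni rli _ _ _ _ (@frame_nat_inj L M F).
  by exists (fun phi => code fn rl phi num), cf.
have [pr [un prK]] : exists (f : Th * Th -> Th) g, cancel f g.
  have [un unK] := embeds_left_inverse (num 0, num 0) (@frame_pair_inj L M F).
  by exists (@frame_pair L M F), un.
(* Nested pairs let one index code a list of parameters of any finite length. *)
pose us := fix us (c : Th) i := if i is j.+1 then us (un c).2 j else (un c).1.
have us_ex N (th : nat -> Th) : exists c, forall i, i < N -> us c i = th i.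
  elim: N th => [|N IH] th; first by exists (num 0).
  have [c Hc] := IH (fun i => th i.+1); exists (pr (th 0, c)) => -[|i] iN /=; rewrite prK //=.
  exact: Hc.
have /choice [wit Hwit] : forall q : formula L nat * (nat -> M), exists u,
    (exists u', sat (fun n => if n is m.+1 then q.2 m else u') q.1) ->
    sat (fun n => if n is m.+1 then q.2 m else u) q.1.
  move=> q; have [[u Hu]|H] := pselect (exists u', sat (fun n => if n is m.+1 then q.2 m else u') q.1).
    by exists u.
  by exists u0.
have /choice [E0 HE0] : forall th, exists u, forall x, eX x = th -> E x = u.
  move=> th; have [[x Ex]|H] := pselect (exists x, eX x = th).
    by exists (E x) => x' Ex'; congr E; apply: eXi; rewrite Ex.
  by exists u0 => x Ex; exfalso; apply: H; exists x.
have num01 : num 1 <> num 0 by move=> /frame_nat_inj.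
(* An index tagged 0 repeats an element of the level below; any other one names the witness of a
   coded formula at coded parameters. *)
pose lev := fix lev n th := if n is m.+1 then
    (if `[< (un th).1 = num 0 >] then lev m (un th).2
     else wit (df (un (un th).2).1, fun i => lev m (us (un (un th).2).2 i)))
  else E0 th.
have raise n m th : n <= m -> exists th', lev m th' = lev n th.
  move=> /subnKC <-; elim: (m - n) => [|d [th' IH]]; first by exists th; rewrite addn0.
  by exists (pr (num 0, th')); rewrite addnS /= prK /= asboolT.
pose mu (p : nat * Th) := lev p.1 p.2.
exists (nat * Th)%type, mu, (fun x => (0, eX x)); split.
- by apply: sml_prod sml_nat _; exists id.
(* The tuple [v] may be infinite: finite support reduces it to [n] coordinates, which are then
   chosen one by one. *)
- suff H n (Q : ('I_n -> M) -> (nat * Th -> M) -> Prop) : def2 Q ->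
      (exists u, Q u mu) -> exists s : 'I_n -> nat * Th, Q (fun i => mu (s i)) mu.
    move=> V P dP [v Pv].
    have dP' : def2 (fun m v => P v m) by definable.
    have [n [g [h Hgh]]] := def_finite dP'.
    have [||s Hs] := H n (fun u m => P (fun x => u (h x)) m); first by definable.
      by exists (fun i => v (g i)); exact: (Hgh mu v).1 Pv.
    by exists (fun x => s (h x)).
  elim: n Q => [|n IH] Q dQ [u Qu].
    have s : 'I_0 -> nat * Th by case.
    by exists s; rewrite (_ : (fun i => mu (s i)) = u) //; apply: funext => -[].
  pose ins (v : 'I_n -> M) (z : unit -> M) i := if unlift ord_max i is Some j then v j else z tt.
  have sins W (a : (W -> M) -> 'I_n -> M) (b : (W -> M) -> unit -> M) :
      selects a -> selects b -> selects (fun w => ins (a w) (b w)).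
    move=> [s Hs] [t Ht].
    exists (fun i => if unlift ord_max i is Some j then s j else t tt) => w.
    by rewrite Hs Ht; apply: funext => i; rewrite /ins; case: unlift.
  have one (R : (unit -> M) -> (nat * Th -> M) -> Prop) : def2 R -> (exists z, R z mu) ->
      exists x, R (fun=> mu x) mu.
    move=> dR [z Rz]; have [m [g [h Hgh]]] := def_finite dR.
    have [phi Hphi] := dR.
    pose x0 : nat * Th := (0, num 0).
    pose N := \max_(i < m) (g i).1.
    have /choice [th Hth] : forall i, exists t, forall j : 'I_m, j = i :> nat -> lev N t = mu (g j).
      move=> i; case: (ltnP i m) => im; last first.
        by exists (num 0) => j E'; move: (ltn_ord j); rewrite E' ltnNge im.
      have [t Ht] := raise (g (Ordinal im)).1 N (g (Ordinal im)).2 (leq_bigmax (Ordinal im)).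
      by exists t => j E'; rewrite Ht; congr mu; congr g; apply: val_inj; rewrite /= E'.
    have [c Hc] := us_ex m th.
    pose psi : formula L nat := rename (fun y => if y is inr x then (nat_of_ord (h x)).+1 else 0) phi.
    have Hpsi u' : sat (fun n => if n is j.+1 then lev N (us c j) else u') psi <-> R (fun=> u') mu.
      rewrite sat_rename Hgh.
      have [H1 H2] := Hphi (join (fun=> u') (fun x => mu (g (h x)))).
      have E1 : join (fun=> u') (fun x => mu (g (h x))) = fun v : unit + nat * Th =>
          match match v with inl _ => 0 | inr x => (nat_of_ord (h x)).+1 end with
          | 0 => u' | j.+1 => lev N (us c j) end.
        by apply: funext => -[//|x] /=; rewrite Hc // (Hth _ (h x) erefl).
      by split=> [K|/H1]; [apply: H2|]; rewrite E1.
    exists (N.+1, pr (num 1, pr (cf psi, c))); apply/Hpsi.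
    rewrite /mu /= prK /= asboolF // prK /= cfK.
    apply: (Hwit (psi, fun j => lev N (us c j))); exists (z tt); apply/Hpsi.
    by rewrite (_ : (fun=> z tt) = z) //; apply: funext => -[].
  have [||s Hs] := IH (fun v m => exists z, Q (ins v z) m).
  - apply: def_ex; apply: (def2_selects dQ); last exact: selects_var.
    by apply: sins; exact: selects_var.
  - exists (fun j => u (lift ord_max j)), (fun=> u ord_max).
    rewrite (_ : ins _ _ = u) //; apply: funext => i; rewrite /ins.
    by case: unliftP => [j ->|->].
  have [||x Hx] := one (fun z m => Q (ins (fun j => m (s j)) z) m).
  - apply: (def2_selects dQ); last exact: selects_var.
    by apply: sins; exact: selects_var.
  - by have [z Hz] := Hs; exists z.
  exists (fun i => if unlift ord_max i is Some j then s j else x).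
  rewrite (_ : (fun i => _) = ins (fun j => mu (s j)) (fun=> mu x)) //.
  by apply: funext => i; rewrite /ins; case: unlift.
- by move=> x; rewrite /mu /= -(HE0 (eX x) x).
Qed.

End SmallModels.

Lemma dependent_choice (T : Type) (t0 : T) (Phi : nat -> (nat -> T) -> T -> Prop) :
  (forall n f g t, (forall i, i < n -> f i = g i) -> Phi n f t -> Phi n g t) ->
  (forall n f, (forall i, i < n -> Phi i f (f i)) -> exists t, Phi n f t) ->
  exists f, forall n, Phi n f (f n).
Proof.
move=> ext ex.
have /choice [next Hnext] : forall p : nat * (nat -> T), exists t,
    (forall i, i < p.1 -> Phi i p.2 (p.2 i)) -> Phi p.1 p.2 t.
  move=> [n f]; have [H|H] := pselect (forall i, i < n -> Phi i f (f i)).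
    by have [t Ht] := ex n f H; exists t.
  by exists t0.
pose st := fix st n := if n is m.+1 then rcons (st m) (next (m, nth t0 (st m))) else [::].
have sz n : size (st n) = n by elim: n => //= n IH; rewrite size_rcons IH.
have stS n i : i < n -> nth t0 (st n.+1) i = nth t0 (st n) i.
  by move=> ni /=; rewrite nth_rcons sz ni.
pose f n := nth t0 (st n.+1) n.
have fst n i : i < n -> nth t0 (st n) i = f i.
  elim: n => [//|n IH]; rewrite ltnS leq_eqVlt => /orP [/eqP -> //|ni].
  by rewrite stS // IH.
exists f; elim/ltn_ind => n IH.
have -> : f n = next (n, nth t0 (st n)) by rewrite /f /= nth_rcons sz ltnn eqxx.
apply: (ext _ (nth t0 (st n))); first by move=> i ni; rewrite fst.
apply: (Hnext (n, nth t0 (st n))) => i ni /=; rewrite fst //.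
apply: (ext _ f) (IH i ni) => j ji; rewrite fst //; exact: ltn_trans ni.
Qed.

(** * Forking equals dividing over extension bases *)

Section Forking.
Context {L : language} {M : structure L} {F : framed M}.
Hypothesis ntp2 : NTP2 M.

(** [E] is made part of every parameter, so the bound [n] is uniform in [E]. *)
Lemma no_arrays_over V X Y (psi : (V -> M) -> (X -> M) -> (Y -> M) -> Prop) k :
  sml X -> sml Y -> def3 psi ->
  exists n, forall (E : X -> M) A, ~ is_array (fun x w => psi x E w) k n A.
Proof.
move=> sX sY dpsi.
pose psi' x (w : X + Y -> M) := psi x (fun i => w (inl i)) (fun i => w (inr i)).
have dpsi' : def2 psi' by rewrite /psi'; definable.
have [n Hn] := no_arrays k ntp2 (sml_sum sX sY) dpsi'.
by exists n => E A HA; apply: (Hn (fun l j => join E (A l j))).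
Qed.

Lemma teq_row X W Y (mu : X -> M) (B : W -> M) (R : nat -> Y -> M) :
  (forall h, incr h -> teq (join (join mu B) (flat (fun i => R (h i))))
                            (join (join mu B) (flat R))) ->
  forall j, teq (join (join mu B) (R j)) (join (join mu B) (R 0)).
Proof.
move=> H j; have hi : incr (addn j) by move=> a b; rewrite ltn_add2l.
apply: (teq_re (fun z => match z with inl x => inl x | inr y => inr (0, y) end) (H _ hi)).
  by case=> // y; rewrite /flat /= addn0.
by case.
Qed.

(** A dividing sequence is replaced as a whole by a coheir over [B] and then made indiscernible over
    [mu] and [B]; the second step preserves the first, as subsequences of a coheir sequence over [B]
    are coheirs over [B]. *)
Lemma coheir_row V X W Y (mu : X -> M) (g : Y -> M) (B : W -> M)
    (psi : (V -> M) -> (X -> M) -> (Y -> M) -> Prop) k :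
  sml X -> sml W -> sml Y -> Mod mu -> def3 psi -> Div mu g psi k ->
  exists R : nat -> Y -> M,
    [/\ forall j, teq (join (join mu B) (R j)) (join (join mu B) (R 0)),
        forall j, teq (join mu (R j)) (join mu g),
        kinc k (fun j x => psi x mu (R j)) & coh mu (flat R) B].
Proof.
move=> sX sW sY Mmu dpsi [bs [bsE bsk]].
have sN : sml (nat * Y) by apply: sml_prod => //; exact: sml_nat.
have [r [rbs rB]] := Mod_coh (flat bs) B sX sN sW Mmu.
pose r' i y := r (i, y).
have Er : r = flat r' by apply: funext => -[].
have [e [eE eI]] := indiscernible r' (join mu B) sY (sml_sum sX sW).
have r'g j : teq (join mu (r' j)) (join mu g).
  apply: teq_trans (bsE j).
  by apply: (teq_re (fun z => match z with inl x => inl x | inr y => inr (j, y) end) rbs) => -[].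
have r'k : kinc k (fun j x => psi x mu (r' j)).
  move=> t ti.
  apply: (teq_sym rbs (P := fun w => ~ exists x, forall i, psi x (fun z => w (inl z))
    (fun y => w (inr (t i, y))))); first by definable.
  exact: bsk.
exists e; split.
- exact: teq_row.
- move=> j; apply: teq_sym => P dP Pg.
  apply: (eE (fun w => P (join (fun x => w (inr (inl x))) (fun y => w (inl (j, y)))))).
    by definable.
  by move=> h hi; apply: (teq_sym (r'g (h j)) dP).
- move=> t ti.
  apply: (eE (fun w => ~ exists x, forall i, psi x (fun z => w (inr (inl z)))
    (fun y => w (inl (t i, y))))); first by definable.
  move=> h hi; exact: (kinc_sub (incr_inj hi) r'k).
- move=> P dP Pe; apply: contrapT => nP; move: Pe.
  apply: (eE (fun w => ~ P (fun p => w (inl p)) (fun z => w (inr (inl z)))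
    (fun z => w (inr (inr z))))); first by definable.
  move=> h hi Ph; apply: nP.
  have [||s Ps] := rB (fun r mu B => P (fun p => r (h p.1, p.2)) mu B); first by definable.
    by rewrite Er.
  by exists (fun p => s (h p.1, p.2)).
Qed.

(* In NTP2 dividing over a model is witnessed by a coheir sequence: otherwise all
   paths through an array of rows as in [coheir_row] would be consistent. *)
Lemma coheir_sequence_inconsistent V X Y (mu : X -> M) (g : Y -> M)
    (psi : (V -> M) -> (X -> M) -> (Y -> M) -> Prop) k :
  sml X -> sml Y -> Mod mu -> def3 psi -> Div mu g psi k ->
  exists (G : nat -> Y -> M) (N : nat),
    [/\ forall l, teq (join mu (G l)) (join mu g),
        forall l, coh mu (G l) (restr (n := l) G) &
        ~ exists x, forall l, l < N -> psi x mu (G l)].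
Proof.
move=> sX sY Mmu dpsi Hdiv.
have [n Hn] := no_arrays_over k sX sY dpsi.
have sN : sml (nat * Y) by apply: sml_prod => //; exact: sml_nat.
pose B l (f : nat -> nat -> Y -> M) := restr (n := l) (fun i => flat (f i)).
pose Phi l f (R : nat -> Y -> M) :=
  [/\ forall j, teq (join (join mu (B l f)) (R j)) (join (join mu (B l f)) (R 0)),
      forall j, teq (join mu (R j)) (join mu g),
      kinc k (fun j x => psi x mu (R j)) & coh mu (flat R) (B l f)].
have [||R HR] := @dependent_choice _ (fun=> g) Phi.
- move=> l f f' R ff'; rewrite /Phi; suff -> : B l f = B l f' by [].
  by apply: funext => -[i p]; rewrite /B /restr /= ff'.
- move=> l f _; apply: coheir_row => //.
  by apply: sml_prod => //; exact: sml_ord.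
exists (fun l => R l 0), n; split.
- by move=> l; have [_ + _ _] := HR l; apply.
- move=> l; have [_ _ _ H] := HR l.
  exact: (coh_re (s := fun y => (0, y)) (t := fun p => (p.1, (0, p.2))) H).
move=> [x Hx]; apply: (Hn mu R); split; first by move=> l _; have [] := HR l.
move=> f.
have H := coh_paths (mu := mu) (I := fun l => flat (R l)) (s0 := fun y => (0, y))
  (s := fun l y => (f l, y)) (n := n).
have {}H := teq_sym (H _ _) (P := fun w => exists x, forall l : 'I_n, psi x (fun z => w (inl z))
  (fun y => w (inr (l, y)))).
case: H => [l _|l _|||x' Hx'].
- have [_ _ _ H] := HR l.
  exact: (coh_re (s := fun y => (0, y)) (t := id) H).
- by have [H _ _ _] := HR l; exact: H.
- by definable.
- by exists x => l; exact: (Hx l (ltn_ord l)).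
- by exists x' => l ln; exact: (Hx' (Ordinal ln)).
Qed.

(** The preorder of the broom lemma: finitely many conjugates of [phi(x, e)] over [mu] jointly imply
    [psi(x, c)]. It depends only on the types of [e] and [c] over [mu], and with [psi] false it is a
    weak form of dividing. *)
Definition conj_entails V X Y Z (mu : X -> M) (phi : (V -> M) -> (X -> M) -> (Y -> M) -> Prop)
    (e : Y -> M) (psi : (V -> M) -> (X -> M) -> (Z -> M) -> Prop) (c : Z -> M) : Prop :=
  exists m (es : nat -> Y -> M), (forall i, teq (join mu (es i)) (join mu e)) /\
    forall x, (forall i, i < m -> phi x mu (es i)) -> psi x mu c.

Section ConjEntails.
Context {V X : Type}.
Variable mu : X -> M.
Hypothesis sX : sml X.

Lemma conj_entails_imp Y Z (phi : (V -> M) -> (X -> M) -> (Y -> M) -> Prop) (e : Y -> M)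
    (psi : (V -> M) -> (X -> M) -> (Z -> M) -> Prop) (c : Z -> M) :
  (forall x, phi x mu e -> psi x mu c) -> conj_entails mu phi e psi c.
Proof.
move=> H; exists 1, (fun=> e); split=> [i|x Hx]; first exact: teq_refl.
by apply: H; exact: Hx 0 isT.
Qed.

Lemma conj_entails_source Y Z (phi : (V -> M) -> (X -> M) -> (Y -> M) -> Prop) (e e' : Y -> M)
    (psi : (V -> M) -> (X -> M) -> (Z -> M) -> Prop) (c : Z -> M) :
  teq (join mu e) (join mu e') -> conj_entails mu phi e psi c -> conj_entails mu phi e' psi c.
Proof.
move=> ee' [m [es [H K]]]; exists m, es; split=> // i; exact: teq_trans (H i) ee'.
Qed.

Lemma conj_entails_at Y Z (phi : (V -> M) -> (X -> M) -> (Y -> M) -> Prop) (e : Y -> M)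
    (psi : (V -> M) -> (X -> M) -> (Z -> M) -> Prop) (c c' : Z -> M) m (es : nat -> Y -> M) :
  sml Y -> sml Z -> def3 phi -> def3 psi -> teq (join mu c) (join mu c') ->
  (forall i, teq (join mu (es i)) (join mu e)) ->
  (forall x, (forall i, i < m -> phi x mu (es i)) -> psi x mu c) ->
  exists es' : nat -> Y -> M, (forall i, teq (join mu (es' i)) (join mu e)) /\
    (forall x, (forall i, i < m -> phi x mu (es' i)) -> psi x mu c').
Proof.
move=> sY sZ dphi dpsi cc' ese H.
have [d Hd] := realize_type (flat es) (sml_prod sml_nat sY) (sml_sum sX sZ) cc'.
exists (fun i y => d (i, y)); split=> [i|].
  apply: teq_trans (ese i); apply: teq_sym.
  by apply: (teq_re (fun z => match z with inl x => inl (inl x) | inr y => inr (i, y) end) Hd)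
    => -[].
have := Hd (fun w => forall x : V -> M, (forall i, i < m -> phi x (fun z => w (inl (inl z)))
  (fun y => w (inr (i, y)))) -> psi x (fun z => w (inl (inl z))) (fun z => w (inl (inr z)))).
by apply; [definable|exact: H].
Qed.

Lemma conj_entails_target Y Z (phi : (V -> M) -> (X -> M) -> (Y -> M) -> Prop) (e : Y -> M)
    (psi : (V -> M) -> (X -> M) -> (Z -> M) -> Prop) (c c' : Z -> M) :
  sml Y -> sml Z -> def3 phi -> def3 psi ->
  teq (join mu c) (join mu c') -> conj_entails mu phi e psi c -> conj_entails mu phi e psi c'.
Proof.
move=> sY sZ dphi dpsi cc' [m [es [H K]]].
by have := conj_entails_at sY sZ dphi dpsi cc' H K; exists m.
Qed.

Lemma conj_entails_trans Y Z U (phi : (V -> M) -> (X -> M) -> (Y -> M) -> Prop) (e : Y -> M)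
    (psi : (V -> M) -> (X -> M) -> (Z -> M) -> Prop) (c : Z -> M)
    (chi : (V -> M) -> (X -> M) -> (U -> M) -> Prop) (d : U -> M) :
  sml Y -> sml Z -> def3 phi -> def3 psi ->
  conj_entails mu phi e psi c -> conj_entails mu psi c chi d -> conj_entails mu phi e chi d.
Proof.
move=> sY sZ dphi dpsi [m [es [H K]]] [m' [cs [H' K']]].
have /choice [ess Hess] i := conj_entails_at sY sZ dphi dpsi (teq_sym (H' i)) H K.
exists (m' * m), (fun l => ess (l %/ m) (l %% m)); split=> [l|x Hx].
  by have [+ _] := Hess (l %/ m); apply.
apply: K' => i im'; have [_] := Hess i; apply => j jm.
have lt : i * m + j < m' * m.
  by rewrite (leq_trans (n := i.+1 * m)) ?leq_mul2r ?im' ?orbT // mulSn addnC ltn_add2r.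
have := Hx _ lt.
rewrite divnMDl ?(leq_trans _ jm) // divn_small // addn0.
by rewrite modnMDl modn_small.
Qed.

End ConjEntails.

(* Disjoining theta(x, g) to a condition on a coheir over g does not weaken it
   up to finitely many conjugates. *)
Definition negligible V X Y (mu : X -> M) (g : Y -> M)
    (theta : (V -> M) -> (X -> M) -> (Y -> M) -> Prop) : Prop :=
  forall Z (c : Z -> M) psi, sml Z -> def3 psi -> coh mu c g ->
    conj_entails mu (fun x m w => psi x m (fun i => w (inl i)) \/ theta x m (fun i => w (inr i)))
      (join c g) psi c.

Lemma coh_invariant_conj X Y Z (mu : X -> M) (c : Z -> M) (g : Y -> M) (G : nat -> Y -> M) :
  sml X -> sml Y -> sml Z -> coh mu c g -> (forall l, teq (join mu (G l)) (join mu g)) ->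
  exists c', coh mu c' (flat G) /\
    forall l, teq (join mu (join c' (G l))) (join mu (join c g)).
Proof.
move=> sX sY sZ cg Gg.
have sN : sml (nat * Y) by apply: sml_prod => //; exact: sml_nat.
have [c0 H0] := realize_type c sZ (sml_sum sX sY) (teq_sym (Gg 0)).
have c0G := coh_teq H0 cg.
have [c' [H1 c'G]] := coh_extend (flat G) sX sZ sY sN c0G.
exists c'; split; first exact: (coh_re (s := id) (t := inr) c'G).
move=> l.
have E0 : teq (join mu (join c' (G 0))) (join mu (join c g)).
  apply: (teq_re (fun z => match z with inl x => inl (inl x) | inr (inl z) => inr z
    | inr (inr y) => inl (inr y) end) (teq_trans H1 (teq_sym H0))) => -[|[]] //.
apply: teq_trans E0.
apply: (coh_invariant (t := fun y => inr (l, y)) (t' := fun y => inr (0, y)) c'G) => //.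
exact: teq_trans (Gg l) (teq_sym (Gg 0)).
Qed.

(** Along a coheir sequence [G] in the type of [g], the [phi(x, G l)] are jointly inconsistent.
    Taking the condition at every [G l] thus eliminates [phi] at the price of a disjunction of the
    [theta(x, G l)], and these are absorbed one by one. *)
Lemma negligible_or V X Y (mu : X -> M) (g : Y -> M)
    (theta phi : (V -> M) -> (X -> M) -> (Y -> M) -> Prop) k :
  sml X -> sml Y -> Mod mu -> def3 theta -> def3 phi -> Div mu g phi k ->
  negligible mu g theta -> negligible mu g (fun x m w => theta x m w \/ phi x m w).
Proof.
move=> sX sY Mmu dtheta dphi Hphi neg Z c psi sZ dpsi cg.
have sN : sml (nat * Y) by apply: sml_prod => //; exact: sml_nat.
have [G [N [Gg Gcoh GN]]] := coheir_sequence_inconsistent sX sY Mmu dphi Hphi.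
have [c' [c'G c'l]] := coh_invariant_conj sX sY sZ cg Gg.
pose Psi m x mu (w : Z + nat * Y -> M) := psi x mu (fun z => w (inl z)) \/
  exists l, l < N /\ (m <= l /\ theta x mu (fun y => w (inr (l, y)))).
have dPsi m : def3 (Psi m) by rewrite /Psi; definable.
have sZN : sml (Z + nat * Y) by exact: sml_sum.
suff H : conj_entails mu (Psi 0) (join c' (flat G)) psi c'.
  have sZY : sml (Z + Y) by exact: sml_sum.
  have cc' : teq (join mu c') (join mu c).
    by apply: (teq_re (fun z => match z with inl x => inl x | inr y => inr (inl y) end) (c'l 0))
      => -[].
  apply: (conj_entails_trans sX sZY sZN _ (dPsi 0) _
    (conj_entails_target sX sZN sZ (dPsi 0) dpsi cc' H)); first by definable.
  (* No [x] satisfies [phi] at all [G l], so either [psi] or some [theta] must hold. *)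
  exists N, (fun l => join c' (G l)); split=> // x Hx.
  have [px|npx] := pselect (psi x mu c'); [by left|right].
  apply: contrapT => nth; apply: GN; exists x => l lN.
  have [//|[Ht|//]] := Hx l lN.
  by case: nth; exists l.
suff H m : m <= N -> conj_entails mu (Psi (N - m)) (join c' (flat G)) psi c'.
  by have := H N (leqnn N); rewrite subnn.
elim: m => [_|m IH mN].
  apply: conj_entails_imp => x; rewrite /Psi /= subn0.
  by move=> [//|[l [lN [Nl]]]]; move: lN; rewrite ltnNge Nl.
have {}IH := IH (ltnW mN).
apply: (conj_entails_trans sX sZN sZN (dPsi _) (dPsi _) _ IH).
pose m' := N - m.+1; have Em : N - m = m'.+1 by rewrite /m' subnSK.
have m'N : m' < N by rewrite /m' ltn_subrL (leq_trans _ mN).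
rewrite Em -/m'.
(* All that remains besides [G m']: the tuple [c'] and the later terms. It is a coheir over [G m'],
   so the negligibility of [theta] applies to it. *)
pose C := join c' (fun p : nat * Y => G (m'.+1 + minn p.1 N) p.2).
have Ccoh : coh mu C (G m').
  have H1 : coh mu (fun p : nat * Y => G (m'.+1 + minn p.1 N) p.2) (restr (n := m'.+1) G).
    exact: coh_tail.
  have H2 : coh mu (fun p : nat * Y => G (m'.+1 + minn p.1 N) p.2) (G m').
    exact: (coh_re (s := id) (t := fun y => (ord_max, y)) H1).
  have H3 : coh mu c' (join (fun p : nat * Y => G (m'.+1 + minn p.1 N) p.2) (G m')).
    apply: (coh_re (s := id) (t := fun z => match z with
      | inl p => (m'.+1 + minn p.1 N, p.2) | inr y => (m', y) end) c'G) => //.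
    by case.
  apply: (coh_re (s := fun z => match z with inl z => inr z | inr p => inl p end) (t := id)
    (coh_join H2 H3)) => //.
  by case.
(* [Psi m'.+1] in the coordinates of [C]. *)
pose PsiC x mu (w : Z + nat * Y -> M) := psi x mu (fun z => w (inl z)) \/
  exists l, l < N /\ (m'.+1 + l < N /\ theta x mu (fun y => w (inr (l, y)))).
have dPsiC : def3 PsiC by rewrite /PsiC; definable.
have [C' HC'] := realize_type C sZN (sml_sum sX sY) (Gg m').
have E1 : conj_entails mu (fun x m w => PsiC x m (fun i => w (inl i)) \/
    theta x m (fun i => w (inr i))) (join C (G m')) PsiC C.
  have H := neg _ C' PsiC sZN dPsiC (coh_teq HC' Ccoh).
  have sCg : sml ((Z + nat * Y) + Y) by exact: sml_sum.
  have CC : teq (join mu C') (join mu C).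
    by apply: (teq_re (fun z => match z with inl x => inl (inl x) | inr z => inr z end)
      (teq_sym HC')) => -[].
  apply: (conj_entails_target sX sCg sZN _ dPsiC CC); first by definable.
  apply: conj_entails_source H.
  by apply: (teq_re (fun z => match z with inl x => inl (inl x) | inr (inl z) => inr z
    | inr (inr y) => inl (inr y) end) (teq_sym HC')) => -[|[]].
have sCg : sml ((Z + nat * Y) + Y) by exact: sml_sum.
apply: (conj_entails_trans sX sZN sCg (dPsi _) _ _ (conj_entails_trans sX sCg sZN _ dPsiC E1 _)).
- by definable.
- apply: conj_entails_imp => x [px|[l [lN [ml tl]]]]; first by left; left.
  move: ml; rewrite leq_eqVlt => /orP [/eqP E|ml]; first by right; rewrite /= E.
  left; right; exists (l - m'.+1); rewrite subnKC //; split.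
    exact: leq_ltn_trans (leq_subr _ _) lN.
  split=> //=; rewrite (minn_idPl _) ?subnKC //.
  exact: leq_trans (leq_subr _ _) (ltnW lN).
- by definable.
- apply: conj_entails_imp => x [px|[l [lN [ml tl]]]]; first by left.
  right; exists (m'.+1 + l); split=> //; split; first exact: leq_addr.
  by move: tl; rewrite /= (minn_idPl (ltnW lN)).
Qed.

Lemma negligible_disj V X Y (mu : X -> M) (g : Y -> M)
    (phi : nat -> (V -> M) -> (X -> M) -> (Y -> M) -> Prop) (k : nat -> nat) n :
  sml X -> sml Y -> Mod mu -> (forall i, def3 (phi i)) ->
  (forall i, i < n -> Div mu g (phi i) (k i)) ->
  negligible mu g (fun x m w => exists i, i < n /\ phi i x m w).
Proof.
move=> sX sY Mmu dphi; elim: n => [|n IH] H Z c psi sZ dpsi cg.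
  by apply: conj_entails_imp => x [//|[i []]].
have dth : def3 (fun x m w => exists i, i < n /\ phi i x m w) by definable.
have neg := negligible_or sX sY Mmu dth (dphi n) (H n (ltnSn n))
  (IH (fun i ni => H i (ltnW ni))).
have sZY : sml (Z + Y) by exact: sml_sum.
apply: (conj_entails_trans sX sZY sZY _ _ _ (neg Z c psi sZ dpsi cg)); [by definable|by definable|].
apply: conj_entails_imp => x [px|[i [ni Hi]]]; [by left|right].
by move: ni; rewrite ltnS leq_eqVlt => /orP [/eqP <-|ni]; [right|left; exists i].
Qed.

(** Negligibility for the false formula and the empty coheir. The conjugates form a finite family
    only, so this is weaker than dividing. *)
Lemma quasi_divides V X Y (mu : X -> M) (g : Y -> M)
    (phi : nat -> (V -> M) -> (X -> M) -> (Y -> M) -> Prop) (k : nat -> nat) n :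
  sml X -> sml Y -> Mod mu -> (forall i, def3 (phi i)) ->
  (forall i, i < n -> Div mu g (phi i) (k i)) ->
  exists m (gs : nat -> Y -> M), (forall i, teq (join mu (gs i)) (join mu g)) /\
    ~ exists x, forall i, i < m -> exists j, j < n /\ phi j x mu (gs i).
Proof.
move=> sX sY Mmu dphi H.
have c0 : coh mu (of_void M) g.
  move=> P dP Pg; exists (fun v : void => match v with end).
  by rewrite (_ : (fun i : void => _) = of_void M) //; apply: funext => -[].
have dF : def3 (fun (_ : V -> M) (_ : X -> M) (_ : void -> M) => False) by definable.
have [m [es [He K]]] := negligible_disj sX sY Mmu dphi H sml_void dF c0.
exists m, (fun i y => es i (inr y)); split=> [i|[x Hx]].
  by apply: (teq_re (fun z => match z with inl x => inl x | inr y => inr (inr y) end) (He i))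
    => -[].
by apply: (K x) => i im; right; exact: Hx.
Qed.

(** The two requirements on [g'] are compatible: one must satisfy in [mu] a condition true of [g]
    while avoiding finitely many dividing formulas at [B], and [quasi_divides] provides such a
    point. *)
Lemma strict_coheir X Y W (mu : X -> M) (g : Y -> M) (B : W -> M) :
  sml X -> sml Y -> sml W -> Mod mu ->
  exists g', [/\ teq (join mu g') (join mu g), coh mu g' B & ndiv mu B g'].
Proof.
move=> sX sY sW Mmu.
pose e := join mu B.
pose cond Q R (psi : nat -> (W -> M) -> (X -> M) -> (Y -> M) -> Prop) n (v : Y -> M) :=
  [/\ Q v mu, ~ R v mu B & forall i, i < n -> ~ psi i B mu v].
pose ok Q R psi n k := [/\ def2 Q, def3 R, (forall i, def3 (psi i)) &
  [/\ Q g mu, (forall s : Y -> X, ~ R (fun i => mu (s i)) mu B) &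
      forall i, i < n -> Div mu g (psi i : (W -> M) -> (X -> M) -> (Y -> M) -> Prop) (k i)]].
pose G : set ((Y + (X + W) -> M) -> Prop) := [set P | def P /\ exists Q R psi n k,
  ok Q R psi n k /\ forall v, cond Q R psi n v -> P (join v e)].
have G_intro Q R psi n k P : def P -> ok Q R psi n k ->
    (forall v, cond Q R psi n v -> P (join v e)) -> G P.
  by move=> dP H K; split=> //; exists Q, R, psi, n, k.
have dF2 : def2 (fun (_ : Y -> M) (_ : X -> M) => True) by definable.
have dF3 V1 V2 V3 : def3 (fun (_ : V1 -> M) (_ : V2 -> M) (_ : V3 -> M) => False) by definable.
have [||||v Hv] := @realize_directed _ _ F _ _ e G sY (sml_sum sX sW).
- exists (fun=> True); apply: (@G_intro (fun _ _ => True) (fun _ _ _ => False)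
    (fun _ _ _ _ => False) 0 (fun=> 0)) => //; first exact: def_cst.
  by split=> //; split=> // s [].
- by move=> P [].
- move=> P P' [dP [Q [R [psi [n [k [[dQ dR dpsi [Qg nR Hd]] HP]]]]]]].
  move=> [dP' [Q' [R' [psi' [n' [k' [[dQ' dR' dpsi' [Qg' nR' Hd']] HP']]]]]]].
  exists (fun w => P w /\ P' w); split=> //.
  pose psi2 i := if i < n then psi i else psi' (i - n).
  pose k2 i := if i < n then k i else k' (i - n).
  apply: (@G_intro (fun x y => Q x y /\ Q' x y) (fun x y z => R x y z \/ R' x y z)
    psi2 (n + n') k2); first exact: def_and.
    split; [by definable|by definable|by move=> i; rewrite /psi2; case: ifP|].
    split=> // [s [/nR|/nR'] //|i ni]; rewrite /psi2 /k2; case: ltnP => [|ni']; first exact: Hd.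
    by apply: Hd'; rewrite ltn_subLR.
  move=> v [[Qv Qv'] nRv nv]; split.
    apply: HP; split=> //; first by move=> r; apply: nRv; left.
    by move=> i ni; have := nv i _; rewrite /psi2 ni; apply; exact: ltn_addr.
  apply: HP'; split=> //; first by move=> r; apply: nRv; right.
  move=> i ni; have E : psi2 (n + i) = psi' i by rewrite /psi2 ltnNge leq_addr addKn.
  by rewrite -E; apply: nv; rewrite ltn_add2l.
- move=> P [dP [Q [R [psi [n [k [[dQ dR dpsi [Qg nR Hd]] HP]]]]]]].
  have [m [gs [gsE gsN]]] := quasi_divides sX sY Mmu dpsi Hd.
  (* The finite inconsistent family is pulled into [mu]; as no tuple satisfies the disjunction at
     all its members, [B] misses it at one of them. *)
  have [||s [Hs1 Hs2]] := Mmu (nat * Y)%type (fun w mu =>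
    (forall i, i < m -> Q (fun y => w (i, y)) mu) /\
    ~ exists z, forall i, i < m -> exists j, j < n /\ psi j z mu (fun y => w (i, y))).
  + by definable.
  + exists (flat gs); split=> // i _.
    apply: (teq_sym (gsE i) (P := fun w => Q (fun y => w (inr y)) (fun x => w (inl x)))) => //.
    by definable.
  apply: contrapT => nP; apply: Hs2; exists B => i im.
  apply: contrapT => nj; apply: nP; exists (fun y => mu (s (i, y))); apply: HP; split.
  + exact: Hs1.
  + exact: nR.
  + by move=> j jn pj; apply: nj; exists j.
have vg : teq (join mu v) (join mu g).
  apply: teq_sym => P dP Pg.
  apply: (Hv (fun w => P (join (fun x => w (inr (inl x))) (fun y => w (inl y))))).
  apply: (@G_intro (fun v mu => P (join mu v)) (fun _ _ _ => False)
    (fun _ _ _ _ => False) 0 (fun=> 0)); first by definable.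
    by split=> //; [definable|split=> // s []].
  by move=> u [].
exists v; split=> //.
- move=> P dP Pv; apply: contrapT => nP.
  suff : ~ P v mu B by apply.
  apply: (Hv (fun w => ~ P (fun i => w (inl i)) (fun x => w (inr (inl x)))
    (fun x => w (inr (inr x))))).
  apply: (@G_intro (fun _ _ => True) P (fun _ _ _ _ => False) 0 (fun=> 0)) => //; first by definable.
    by split=> //; split=> // s Ps; apply: nP; exists s.
  by move=> u [].
- move=> psi dpsi HB k Hk; move: HB.
  apply: (Hv (fun w => ~ psi (fun x => w (inr (inr x))) (fun x => w (inr (inl x)))
    (fun y => w (inl y)))).
  apply: (@G_intro (fun _ _ => True) (fun _ _ _ => False) (fun _ => psi) 1 (fun=> k)).
  + by definable.
  + by split=> //; split=> // [s []|_ _]; exact: Div_teq Hk.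
  + by move=> u [_ _ /(_ 0 isT)].
Qed.

Definition forks_divides X (E : X -> M) : Prop :=
  forall V Y (g : Y -> M) (phi : (V -> M) -> (X -> M) -> (Y -> M) -> Prop) psi n k,
    sml Y -> def3 phi -> (forall i : nat, def3 (psi i)) ->
    (forall i, i < n -> Div E g (psi i) (k i)) ->
    (forall x, phi x E g -> exists i, i < n /\ psi i x E g) ->
    exists k', Div E g phi k'.

Lemma pigeonhole_color (n m K : nat) (col : 'I_K -> 'I_n) : n * m < K ->
  exists c, m < #|[pred i | col i == c]|.
Proof.
move=> H; apply: contrapT => K0.
have le c : #|[pred i | col i == c]| <= m.
  by rewrite leqNgt; apply/negP => lt; apply: K0; exists c.
suff : K <= n * m by rewrite leqNgt H.
rewrite -[leqLHS]card_ord -sum1_card (partition_big col predT) //=.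
apply: (@leq_trans (\sum_(c < n) m)); last by rewrite sum_nat_const card_ord.
apply: leq_sum => c _; apply: leq_trans (le c); rewrite -sum1_card.
by apply: eq_leq; apply: eq_bigl => i; rewrite inE.
Qed.

(** Each [g_l] is a strict coheir over the earlier data and carries, for every [i], a row of
    conjugates over these data dividing for [psi i]. A common solution of many [phi(x, g_l)] selects
    some [psi c] often, and exchanging the selected terms for their rows gives too large an
    array. *)
Theorem forks_divides_model X (mu : X -> M) : sml X -> Mod mu -> forks_divides mu.
Proof.
move=> sX Mmu V Y g phi psi n k sY dphi dpsi Hdiv Himp.
have /choice [n0 Hn0] i := no_arrays_over (k i) sX sY (dpsi i).
(* [m] bounds the arrays for every [psi i]; among [K] terms some color occurs more than [m]
   times. *)
pose m := \max_(i < n) n0 i; pose K := (n * m).+1.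
apply: contrapT => nK.
pose I (t : (Y -> M) * (nat -> nat -> Y -> M)) : Y + nat * (nat * Y) -> M :=
  join t.1 (array_tuple t.2).
have sZ : sml (Y + nat * (nat * Y)).
  exact: sml_sum sY (sml_prod sml_nat (sml_prod sml_nat sY)).
pose B l (f : nat -> (Y -> M) * (nat -> nat -> Y -> M)) := restr (n := l) (fun i => I (f i)).
pose Phi l f (t : (Y -> M) * (nat -> nat -> Y -> M)) :=
  [/\ teq (join mu t.1) (join mu g), coh mu t.1 (B l f) & forall i, i < n ->
    (forall j, teq (join (join mu (B l f)) (t.2 i j)) (join (join mu (B l f)) t.1)) /\
    kinc (k i) (fun j x => psi i x mu (t.2 i j))].
have [||f Hf] := @dependent_choice _ (g, fun _ _ => g) Phi.
- move=> l f f' t ff'; rewrite /Phi; suff -> : B l f = B l f' by [].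
  by apply: funext => -[i p]; rewrite /B /restr /= ff'.
- move=> l f _.
  have sB : sml ('I_l * (Y + nat * (nat * Y))) by apply: sml_prod => //; exact: sml_ord.
  have [g' [g'g g'c g'B]] := strict_coheir g (B l f) sX sY sB Mmu.
  have /choice [R HR] i : exists R : nat -> Y -> M, i < n ->
      (forall j, teq (join (join mu (B l f)) (R j)) (join (join mu (B l f)) g')) /\
      kinc (k i) (fun j x => psi i x mu (R j)).
    have [ni|] := boolP (i < n); last by exists (fun=> g).
    have [R [HR HR']] := Div_conj sB sX sY (dpsi i) g'B (Div_teq (teq_sym g'g) (Hdiv i ni)).
    by exists R.
  by exists (g', R).
have : ~ kinc K (fun l x => phi x mu (f l).1).
  move=> HK; apply: nK; exists K, (fun l => (f l).1); split=> // l.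
  by have [] := Hf l.
move=> /existsNP [t /not_implyP [ti /contrapT [x Hx]]].
have /choice [col Hcol] i : exists c : 'I_n, psi c x mu (f (t i)).1.
  have [E _ _] := Hf (t i).
  have T : forall x, phi x mu (f (t i)).1 -> exists j, j < n /\ psi j x mu (f (t i)).1.
    apply: (teq_sym E (P := fun w => forall x : V -> M, phi x (fun z => w (inl z))
      (fun y => w (inr y)) -> exists i, i < n /\ psi i x (fun z => w (inl z))
      (fun y => w (inr y)))) => //; by definable.
  by have [c [cn Hc]] := T x (Hx i); exists (Ordinal cn).
have [c Hc] := pigeonhole_color col (ltnSn (n * m)).
pose s := [seq t i | i <- enum [pred i | col i == c]].
have us : uniq s by rewrite map_inj_uniq ?enum_uniq.
have ss r : r < n0 c -> r < size s.
  rewrite size_map -cardE => rn; apply: leq_trans Hc; apply: leqW.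
  by apply: leq_trans rn _; exact: leq_bigmax.
have psi_s r : r < n0 c -> psi c x mu (f (nth 0 s r)).1.
  move=> /ss /(mem_nth 0) /mapP [i]; rewrite mem_enum inE => /eqP <- ->.
  exact: Hcol.
pose N := (\max_(l <- s) l).+1.
have sN r : r < n0 c -> nth 0 s r < N.
  by move=> /ss /(mem_nth 0) H; rewrite ltnS; exact: (@leq_bigmax_seq _ s xpredT id).
apply: (Hn0 c mu (fun r => (f (nth 0 s r)).2 c)); split=> [r _|h].
  by have [_ _ /(_ c (ltn_ord c)) []] := Hf (nth 0 s r).
(* Transfers the choice made in the r-th selected row to its position in the whole sequence. *)
pose p l := h (index l s).
have H := coh_paths (mu := mu) (I := fun l => I (f l)) (s0 := inl)
  (s := fun l y => inr (c : nat, (p l, y))) (n := N).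
have {}H := teq_sym (H _ _) (P := fun w => exists x, forall r, r < n0 c ->
  psi c x (fun z => w (inl z)) (fun y => w (inr (inord (nth 0 s r), y)))).
case: H => [l _|l _|||x' Hx'].
- by have [] := Hf l.
- by have [_ _ /(_ c (ltn_ord c)) [+ _]] := Hf l; apply.
- by definable.
- by exists x => r rn; have := psi_s r rn; rewrite /restr /= inordK ?sN.
exists x' => r rn; have := Hx' r rn.
by rewrite /restr /= /array_tuple /flat inordK ?sN //= /p index_uniq // ss.
Qed.

Definition ext_base X (E : X -> M) : Prop :=
  forall V W (c : V -> M) (d : W -> M), sml V -> sml W ->
    exists c', teq (join E c') (join E c) /\ ndiv E c' d.

Lemma Div_base X X' V Y (i : X -> X') (E : X -> M) (E' : X' -> M) (b : Y -> M)
    (psi : (V -> M) -> (X -> M) -> (Y -> M) -> Prop) k :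
  (forall x, E x = E' (i x)) -> Div E' b (fun x m w => psi x (fun z => m (i z)) w) k ->
  Div E b psi k.
Proof.
move=> /funext -> [bs [H K]]; exists bs; split=> // j.
by apply: (teq_re (fun z => match z with inl x => inl (i x) | inr y => inr y end) (H j)) => -[].
Qed.

(** Compactness: one condition from the type of [c] and finitely many dividing formulas are tested
    at a time. *)
Lemma nfork_criterion X V Y (E : X -> M) (c : V -> M) (b : Y -> M) :
  sml X -> sml V -> sml Y ->
  (forall W (d : W -> M) Q (psi : nat -> (V -> M) -> (X -> M) -> (Y + W -> M) -> Prop) n k,
     sml W -> def3 Q -> (forall i, def3 (psi i)) -> Q c E b ->
     (forall i, i < n -> Div E (join b d) (psi i) (k i)) ->
     exists x, Q x E b /\ forall i, i < n -> ~ psi i x E (join b d)) ->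
  nfork E c b.
Proof.
move=> sX sV sY crit W d sW.
have sYW : sml (Y + W) by exact: sml_sum.
pose e := join E (join b d).
pose ok Q psi n k := [/\ def3 Q, (forall i, def3 (psi i)), Q c E b &
   forall i, i < n -> Div E (join b d) (psi i : (V -> M) -> _ -> _ -> Prop) (k i)].
pose cond Q (psi : nat -> (V -> M) -> (X -> M) -> (Y + W -> M) -> Prop) n v :=
  Q v E b /\ forall i, i < n -> ~ psi i v E (join b d).
pose G : set ((V + (X + (Y + W)) -> M) -> Prop) := [set P | def P /\ exists Q psi n k,
  ok Q psi n k /\ forall v, cond Q psi n v -> P (join v e)].
have G_intro Q psi n k P : def P -> ok Q psi n k ->
    (forall v, cond Q psi n v -> P (join v e)) -> G P.
  by move=> dP H K; split=> //; exists Q, psi, n, k.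
have dT : def3 (fun (_ : V -> M) (_ : X -> M) (_ : Y -> M) => True) by definable.
have dF : def3 (fun (_ : V -> M) (_ : X -> M) (_ : Y + W -> M) => False) by definable.
have [||||v Hv] := @realize_directed _ _ F _ _ e G sV (sml_sum sX sYW).
- exists (fun=> True).
  by apply: (@G_intro (fun _ _ _ => True) (fun _ _ _ _ => False) 0 (fun=> 0)); first exact: def_cst.
- by move=> P [].
- move=> P P' [dP [Q [psi [n [k [[dQ dpsi Qc Hd] HP]]]]]].
  move=> [dP' [Q' [psi' [n' [k' [[dQ' dpsi' Qc' Hd'] HP']]]]]].
  exists (fun w => P w /\ P' w); split=> //.
  pose psi2 i := if i < n then psi i else psi' (i - n).
  pose k2 i := if i < n then k i else k' (i - n).
  apply: (@G_intro (fun x y z => Q x y z /\ Q' x y z) psi2 (n + n') k2); first exact: def_and.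
    split; [by definable|by move=> i; rewrite /psi2; case: ifP|by []|].
    move=> i ni; rewrite /psi2 /k2; case: ltnP => [|ni']; first exact: Hd.
    by apply: Hd'; rewrite ltn_subLR.
  move=> v [[Qv Qv'] nv]; split.
    apply: HP; split=> // i ni; have := nv i _; rewrite /psi2 ni; apply; exact: ltn_addr.
  apply: HP'; split=> // i ni; have E' : psi2 (n + i) = psi' i.
    by rewrite /psi2 ltnNge leq_addr addKn.
  by rewrite -E'; apply: nv; rewrite ltn_add2l.
- move=> P [dP [Q [psi [n [k [[dQ dpsi Qc Hd] HP]]]]]].
  have [x [Qx nx]] := crit W d Q psi n k sW dQ dpsi Qc Hd.
  by exists x; apply: HP.
exists v; split.
- apply: teq_sym => P dP Pg.
  apply: (Hv (fun w => P (join (join (fun x => w (inr (inl x))) (fun x => w (inr (inr (inl x)))))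
     (fun i => w (inl i))))).
  apply: (@G_intro (fun v E b => P (join (join E b) v)) (fun _ _ _ _ => False) 0 (fun=> 0)).
  + by definable.
  + by split=> //; definable.
  + by move=> u [].
- move=> psi dpsi HB k Hk; move: HB.
  apply: (Hv (fun w => ~ psi (fun y => w (inl y)) (fun x => w (inr (inl x)))
    (fun x => w (inr (inr x))))).
  apply: (@G_intro (fun _ _ _ => True) (fun _ => psi) 1 (fun=> k)) => //; first by definable.
  by move=> u [_ /(_ 0 isT)].
Qed.

Lemma nfork_of_ndiv X V Y (E : X -> M) (c : V -> M) (b : Y -> M) :
  sml X -> sml V -> sml Y -> forks_divides E -> ndiv E c b -> nfork E c b.
Proof.
move=> sX sV sY fd cb; apply: nfork_criterion => // W d Q psi n k sW dQ dpsi Qc Hd.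
apply: contrapT => nv.
have [|||k' Hk'] := fd V _ (join b d) (fun x E w => Q x E (fun y => w (inl y))) psi n k _
  _ dpsi Hd.
- exact: sml_sum.
- by definable.
- move=> x Qx; apply: contrapT => ni; apply: nv; exists x; split=> // i lt pi.
  by apply: ni; exists i.
apply: (cb Q dQ Qc k'); have [bs [bsE bsk]] := Hk'.
exists (fun i y => bs i (inl y)); split=> // i.
by apply: (teq_re (fun z => match z with inl x => inl x | inr y => inr (inl y) end) (bsE i))
  => -[].
Qed.

(** Any small model containing [E] can be moved over [E] away from [g]. *)
Lemma independent_model X V (E : X -> M) (g : V -> M) : sml X -> sml V -> ext_base E ->
  exists (X' : Type) (mu : X' -> M) (i : X -> X'),
    [/\ sml X', Mod mu, forall x, E x = mu (i x) & ndiv E mu g].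
Proof.
move=> sX sV eE; have [X' [mu0 [i [sX' M0 E0]]]] := small_model E sX.
have [mu [mm0 mug]] := eE _ _ mu0 g sX' sV.
exists X', mu, i; split=> //.
  by apply: Mod_teq M0; apply: teq_sym; apply: (teq_re inr mm0).
move=> x; have := teq_sym mm0 (P := fun w => w (inl x) = w (inr (i x))).
by apply; [exact: def_eq|exact: E0].
Qed.

Lemma Div_over_model X X' V Y (E : X -> M) (mu : X' -> M) (i : X -> X') (g : Y -> M)
    (psi : (V -> M) -> (X -> M) -> (Y -> M) -> Prop) k :
  sml X -> sml X' -> sml Y -> def3 psi -> (forall x, E x = mu (i x)) -> ndiv E mu g ->
  Div E g psi k -> Div mu g (fun x m w => psi x (fun z => m (i z)) w) k.
Proof.
move=> sX sX' sY dpsi Ei mug Hk.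
have [bs [bsE bsk]] := Div_conj sX' sX sY dpsi mug Hk.
exists bs; split=> [j|].
  apply: (teq_re (fun z => match z with inl x => inl (inr x) | inr y => inr y end) (bsE j))
    => -[] //.
by rewrite -(funext Ei).
Qed.

(** Dividing ascends from [E] to the model because the model is independent from [g]; it descends
    because conjugates over the model are conjugates over [E]. *)
Theorem forks_divides_ext X (E : X -> M) : sml X -> ext_base E -> forks_divides E.
Proof.
move=> sX eE V Y g phi psi n k sY dphi dpsi Hdiv Himp.
have [X' [mu [i [sX' Mmu Ei mug]]]] := independent_model g sX sY eE.
suff [k' Hk'] : exists k', Div mu g (fun x m w => phi x (fun z => m (i z)) w) k'.
  by exists k'; exact: Div_base Hk'.
apply: (@forks_divides_model _ _ sX' Mmu _ _ _ _
  (fun j x m w => psi j x (fun z => m (i z)) w) n k sY).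
- by definable.
- by move=> j; definable.
- by move=> j jn; exact: Div_over_model (Hdiv j jn).
- by move=> x; rewrite -(funext Ei); exact: Himp.
Qed.

End Forking.

(** * Simple types *)

Section SimpleTypes.
Context {L : language} {M : structure L} {F : framed M}.

Definition simp V X (E : X -> M) (a : V -> M) : Prop :=
  forall Y (psi : (V -> M) -> (X -> M) -> (Y -> M) -> Prop) k (t : seq nat -> Y -> M),
    def3 psi ->
    (forall eta, kinc k (fun j x => psi x E (t (rcons eta j)))) ->
    (forall eta : nat -> nat, exists x, teq (join E x) (join E a) /\
       forall i, psi x E (t (mkseq eta i))) -> False.

(** The new base is moved into the parameters at the nodes of the tree. *)
Lemma simp_base V X X' (i : X -> X') (E : X -> M) (E' : X' -> M) (a a' : V -> M) :
  (forall x, E x = E' (i x)) -> teq (join E a') (join E a) -> simp E a -> simp E' a'.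
Proof.
move=> Ei aa' sa Y psi k t dpsi sib br.
apply: (sa (X' + Y)%type (fun x _ w => psi x (fun z => w (inl z)) (fun z => w (inr z))) k
  (fun eta => join E' (t eta))); [by definable|exact: sib|].
move=> eta; have [x [xa' Hx]] := br eta; exists x; split=> //.
apply: teq_trans aa'.
by apply: (teq_re (fun z => match z with inl x => inl (i x) | inr v => inr v end) xa') => -[].
Qed.

Lemma teq_flat X Y (E : X -> M) (p c : nat -> Y -> M) :
  (forall n, teq (join E (restr (n := n) p)) (join E (restr (n := n) c))) ->
  teq (join E (flat p)) (join E (flat c)).
Proof.
move=> H P dP; have [A [fA HA]] := def_support dP.
have [n An] := finite_set_bound (fun z : X + nat * Y => if z is inr q then q.1 else 0) fA.
pose cl (q : nat -> Y -> M) := flat (fun i => q (minn i n)).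
have E1 q : P (join E (flat q)) <-> P (join E (cl q)).
  apply: HA => -[//|[i y]] /An /= ni.
  by rewrite /cl /flat /= (minn_idPl (ltnW ni)).
move=> /E1 Pp; apply/E1; move: P dP Pp {fA HA An E1}; rewrite -/(teq _ _).
apply: (teq_re (fun z : X + nat * Y => match z with inl x => inl x
  | inr q => inr (inord (minn q.1 n), q.2) end) (H n.+1)) => -[//|q];
  by rewrite /cl /restr /flat /= inordK // ltnS geq_minr.
Qed.

(* Reversing a long Morley sequence turns dividing over E into dividing over E and all
   earlier terms, which compactness extends to an infinite sequence. *)
Lemma reversed_sequence V X Y (E : X -> M) (a : V -> M) (b : Y -> M)
    (psi : (V -> M) -> (X -> M) -> (Y -> M) -> Prop) k (bs : nat -> Y -> M) :
  sml X -> sml V -> sml Y -> def3 psi ->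
  (forall i, teq (join E (bs i)) (join E b)) -> (forall i, psi a E (bs i)) ->
  (forall i, ndiv E (bs i) (restr (n := i) bs)) -> Div E b psi k ->
  exists (c : nat -> Y -> M) (d : nat -> nat -> Y -> M),
    [/\ forall m, psi a E (c m),
        forall m j, teq (join (join E (restr (n := m) c)) (d m j))
                        (join (join E (restr (n := m) c)) (c m)) &
        forall m, kinc k (fun j x => psi x E (d m j))].
Proof.
move=> sX sV sY dpsi bsb psib bsI Hdiv.
pose W := (nat * Y + nat * (nat * Y))%type.
pose cc (w : W + (X + V) -> M) i y := w (inl (inl (i, y))).
pose dd' (w : W + (X + V) -> M) m j y := w (inl (inr (m, (j, y)))).
pose EE (w : W + (X + V) -> M) x := w (inr (inl x)).
pose aa (w : W + (X + V) -> M) x := w (inr (inr x)).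
pose G m : set ((W + (X + V) -> M) -> Prop) := [set P |
  [\/ P = (fun w => psi (aa w) (EE w) (cc w m)),
      exists2 t : 'I_k -> nat, injective t &
        P = (fun w => ~ exists x, forall i, psi x (EE w) (dd' w m (t i))) |
      exists j Q, def Q /\ P = (fun w =>
        Q (join (join (EE w) (restr (n := m) (cc w))) (dd' w m j)) <->
        Q (join (join (EE w) (restr (n := m) (cc w))) (cc w m)))]].
have sN : sml (nat * Y) by apply: sml_prod => //; exact: sml_nat.
have sW : sml W by apply: sml_sum => //; apply: sml_prod => //; exact: sml_nat.
have [||v Hv] := @realize_chain _ _ F _ _ (join E a) G sW (sml_sum sX sV).
- move=> m P [->|[t ti ->]|[j [Q [dQ ->]]]]; rewrite /cc /dd' /EE /aa; by definable.
(* Up to [N], the terms of [c] before position [m] come after [c m] in [bs]. They are independent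
   from [c m], so [Div_conj] yields dividing over them. *)
- move=> N; pose c i := bs (N - i).
  have /choice [d Hd] m : exists d : nat -> Y -> M, m <= N ->
      (forall j, teq (join (join E (restr (n := m) c)) (d j))
                     (join (join E (restr (n := m) c)) (c m))) /\
      kinc k (fun j x => psi x E (d j)).
    have [mN|] := boolP (m <= N); last by exists (fun=> b).
    have sO i : sml ('I_i * Y) by apply: sml_prod => //; exact: sml_ord.
    have H : ndiv E (fun p : nat * Y => bs ((N - m).+1 + minn p.1 m) p.2)
      (restr (n := (N - m).+1) bs) by exact: ndiv_tail.
    have cm : ndiv E (restr (n := m) c) (c m).
      apply: (ndiv_re (s := fun p : 'I_m * Y => (m - p.1.+1, p.2))
        (t := fun y => (ord_max, y)) sX (sO _) sY H) => // -[[q qm] y].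
      rewrite /restr /c /= (minn_idPl (leq_subr _ _)).
      congr (bs _ _); rewrite addSn addnBA // subnK // -subSn; last exact: leq_trans qm mN.
      by rewrite subSS.
    have [d [d1 d2]] := Div_conj (sO m) sX sY dpsi cm (Div_teq (teq_sym (bsb _)) Hdiv).
    by exists d.
  exists (join (flat c) (flat (fun m => flat (d m)))) => m P mN.
  have [H1 H2] := Hd m mN.
  case=> [->|[t ti ->]|[j [Q [dQ ->]]]]; rewrite /cc /dd' /EE /aa /=.
  + exact: (psib (N - m)).
  + exact: H2.
  + exact: teqE (H1 j) dQ.
exists (cc (join v (join E a))), (dd' (join v (join E a))); split=> [m|m j|m].
- by apply: (Hv m (fun w => psi (aa w) (EE w) (cc w m))); exact: Or31.
- move=> Q dQ.
  have := Hv m (fun w => Q (join (join (EE w) (restr (n := m) (cc w))) (dd' w m j)) <->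
        Q (join (join (EE w) (restr (n := m) (cc w))) (cc w m))).
  by case=> //; apply: Or33; exists j, Q.
- move=> t ti.
  have := Hv m (fun w => ~ exists x, forall i, psi x (EE w) (dd' w m (t i))).
  by apply; apply: Or32; exists t.
Qed.

(** The reversed sequence spreads out into a tree: siblings form a copy of a dividing sequence over
    their predecessors, and every branch is conjugate to [c], so a copy of [a] satisfies [psi] along
    it. This is the tree forbidden by simplicity. *)
Lemma simple_kim V X Y (E : X -> M) (a : V -> M) (b : Y -> M)
    (psi : (V -> M) -> (X -> M) -> (Y -> M) -> Prop) k (bs : nat -> Y -> M) :
  sml X -> sml V -> sml Y -> def3 psi -> simp E a ->
  (forall i, teq (join E (bs i)) (join E b)) -> (forall i, psi a E (bs i)) ->
  (forall i, ndiv E (bs i) (restr (n := i) bs)) -> ~ Div E b psi k.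
Proof.
move=> sX sV sY dpsi sa bsb psib bsI Hdiv.
have [c [d [psic cd dk]]] := reversed_sequence sX sV sY dpsi bsb psib bsI Hdiv.
have sN : sml (nat * Y) by apply: sml_prod => //; exact: sml_nat.
have sO i : sml ('I_i * Y) by apply: sml_prod => //; exact: sml_ord.
(* [ch] transports the dividing sequence [d m] from [c] to a conjugate initial segment. *)
have /choice [ch Hch] : forall q : nat * (nat -> Y -> M), exists ch : nat -> Y -> M,
    teq (join E (restr (n := q.1) c)) (join E (restr (n := q.1) q.2)) ->
    teq (join (join E (restr (n := q.1) c)) (flat (d q.1)))
        (join (join E (restr (n := q.1) q.2)) (flat ch)).
  move=> [m p] /=.
  have [H|] := pselect (teq (join E (restr (n := m) c)) (join E (restr (n := m) p))).
    have [e He] := realize_type (flat (d m)) sN (sml_sum sX (sO m)) H.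
    exists (fun i y => e (i, y)) => _.
    by rewrite (_ : flat (fun i y => e (i, y)) = e) //; apply: funext => -[].
  by exists (fun=> b).
(* The state at a node is its depth plus one and the branch leading to it; the root carries
   [c 0]. *)
pose step (s : nat * (nat -> Y -> M)) j :=
  (s.1.+1, fun i => if i < s.1 then s.2 i else ch s j).
pose st := foldl step (1, fun=> c 0).
pose t eta := (st eta).2 (size eta).
have st1 eta : (st eta).1 = (size eta).+1.
  by elim/last_ind: eta => // eta j IH; rewrite /st foldl_rcons -/(st eta) /= IH size_rcons.
have st_rcons eta j : st (rcons eta j) = step (st eta) j by rewrite /st foldl_rcons.
have st_eq eta : teq (join E (restr (n := (size eta).+1) c))
    (join E (restr (n := (size eta).+1) (st eta).2)).
  elim/last_ind: eta => [|eta j IH].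
    apply: (teq_re id (teq_refl (join E (restr (n := 1) c)))) => // -[//|[[[|//] i1] y]] //.
  rewrite size_rcons st_rcons /=.
  have := Hch (st eta); rewrite st1 => /(_ IH) H.
  have H1 : teq (join (join E (restr (n := (size eta).+1) c)) (d (size eta).+1 j))
      (join (join E (restr (n := (size eta).+1) (st eta).2)) (ch (st eta) j)).
    by apply: (teq_re (fun z => match z with inl x => inl x | inr y => inr (j, y) end) H) => -[].
  have H2 := teq_trans (teq_sym (cd (size eta).+1 j)) H1.
  apply: (teq_re (fun z => match z with inl x => inl (inl x) | inr p =>
    match split_last p with inl y => inr y | inr q => inl (inr q) end end) H2) => -[//|p] /=;
    rewrite restr_succ; case: (split_last p) => [y|[i y]] //=.
    by rewrite ltnn.
  by rewrite /restr /= ltn_ord.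
apply: (sa Y psi k t dpsi) => [eta|eta].
  have tE j : t (rcons eta j) = ch (st eta) j.
    by rewrite /t st_rcons size_rcons /= st1 ltnn.
  have := Hch (st eta); rewrite st1 => /(_ (st_eq eta)) H.
  move=> u ui [x Hx].
  apply: (H (fun w => ~ exists x, forall i, psi x (fun z => w (inl (inl z)))
    (fun y => w (inr (u i, y))))); [by definable|exact: dk|].
  by exists x => i; have := Hx i; rewrite tE.
pose tau i := t (mkseq eta i).
have st_tau n i : i <= n -> (st (mkseq eta n)).2 i = tau i.
  elim: n => [|n IH] in_; first by move: in_; rewrite leqn0 => /eqP ->.
  move: in_; rewrite leq_eqVlt => /orP [/eqP ->|]; first by rewrite /tau /t size_mkseq.
  by rewrite ltnS => in_; rewrite mkseqS st_rcons /= st1 size_mkseq ltnS in_ IH.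
have c_tau n : teq (join E (restr (n := n) c)) (join E (restr (n := n) tau)).
  have := st_eq (mkseq eta n); rewrite size_mkseq => H.
  apply: (teq_re (fun z => match z with inl x => inl x
    | inr p => inr (widen_ord (leqnSn n) p.1, p.2) end) H) => -[//|[i y]] //.
  by rewrite /restr /= st_tau // ltnW.
have [x Hx] := realize_type a sV (sml_sum sX sN) (teq_flat c_tau).
exists x; split.
  apply: teq_sym.
  by apply: (teq_re (fun z => match z with inl x => inl (inl x) | inr v => inr v end) Hx) => -[].
move=> i; have := Hx (fun w => psi (fun v => w (inr v)) (fun z => w (inl (inl z)))
  (fun y => w (inl (inr (i, y))))).
by apply; [definable|exact: psic].
Qed.

(* A non-forking Morley sequence in the type of b over (E, a) is a Morley sequence
   over E whose terms all have the same relation to a. *)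
Theorem simple_symmetry V X Y (E : X -> M) (a : V -> M) (b : Y -> M) :
  sml X -> sml V -> sml Y -> simp E a -> nfork E b a -> ndiv E a b.
Proof.
move=> sX sV sY sa ba psi dpsi Hpsi k.
pose Phi l (f : nat -> Y -> M) (t : Y -> M) :=
  teq (join (join E a) t) (join (join E a) b) /\ ndiv E t (join a (restr (n := l) f)).
have [||bs Hbs] := @dependent_choice _ b Phi.
- move=> l f f' t ff'; rewrite /Phi.
  suff -> : restr (n := l) f = restr (n := l) f' by [].
  by apply: funext => -[i p]; rewrite /restr /= ff'.
- by move=> l f _; apply: ba; apply: sml_prod => //; exact: sml_ord.
apply: (@simple_kim _ _ _ E a b psi k bs) => //.
- move=> i; have [H _] := Hbs i.
  by apply: (teq_re (fun z => match z with inl x => inl (inl x) | inr v => inr v end) H) => -[].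
- move=> i; have [H _] := Hbs i.
  have := teq_sym H (P := fun w => psi (fun v => w (inl (inr v))) (fun z => w (inl (inl z)))
    (fun y => w (inr y))).
  by apply; [definable|].
- move=> i; have [_ H] := Hbs i.
  have sO : sml ('I_i * Y) by apply: sml_prod => //; exact: sml_ord.
  by apply: (ndiv_re (s := id) (t := inr) sX (sml_sum sV sO) sO H).
Qed.

(** Left transitivity in its usual form, since the sequence from [Div_conj] consists of conjugates
    over [E] and [c]. *)
Lemma ndiv_join_base V W X Y (E : X -> M) (c : V -> M) (d : W -> M) (a : Y -> M) :
  sml V -> sml X -> sml Y ->
  ndiv E c a -> ndiv (join E c) d a -> ndiv E (join c d) a.
Proof.
move=> sV sX sY ca dca psi dpsi Hpsi k Hk.
have [bs [bsE bsk]] := Div_conj sV sX sY dpsi ca Hk.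
apply: (dca (fun z (e : X + V -> M) w => psi (join (fun i => e (inr i)) z)
   (fun i => e (inl i)) w) _ _ k).
- by definable.
- exact: Hpsi.
exists bs; split=> // t ti [x Hx].
by apply: (bsk t ti); exists (join c x).
Qed.

(** * Unions of realizations of a simple type *)

Section Full.
Context {V X0 : Type}.
Variables (E0 : X0 -> M) (a0 : V -> M).
Hypothesis a0_simple : simp E0 a0.
Hypothesis sV : sml V.

(* x is a union of realizations of the type of a0 over E0. *)
Definition full Z (x : Z -> M) : Prop :=
  forall z, exists (s : V -> Z) (i : V), s i = z /\
    teq (join E0 (fun v => x (s v))) (join E0 a0).

Lemma full_join Z Z' (x : Z -> M) (x' : Z' -> M) : full x -> full x' -> full (join x x').
Proof.
move=> fx fx' [z|z].
  by have [s [i [<- H]]] := fx z; exists (fun v => inl (s v)), i.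
by have [s [i [<- H]]] := fx' z; exists (fun v => inr (s v)), i.
Qed.

Lemma full_family J Z (x : J -> Z -> M) : (forall j, full (x j)) ->
  full (fun p : J * Z => x p.1 p.2).
Proof.
move=> fx [j z]; have [s [i [<- H]]] := fx j z.
by exists (fun v => (j, s v)), i.
Qed.

Lemma full_single (a : V -> M) : teq (join E0 a) (join E0 a0) -> full a.
Proof. by move=> H z; exists id, z. Qed.

Lemma full_teq X (E : X -> M) (i : X0 -> X) Z (x x' : Z -> M) :
  (forall y, E0 y = E (i y)) -> teq (join E x) (join E x') -> full x -> full x'.
Proof.
move=> Ei xx' fx z; have [s [j [<- H]]] := fx z; exists s, j; split=> //.
apply: teq_trans H; apply: teq_sym.
by apply: (teq_re (fun w => match w with inl y => inl (i y) | inr v => inr (s v) end) xx')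
  => -[].
Qed.

Lemma restr0_ndiv X Y Z (E : X -> M) (x : nat -> Z -> M) (y : Y -> M) :
  ndiv E (restr (n := 0) x) y.
Proof.
move=> psi dpsi Hpsi k [bs [bsE bsk]].
apply: (bsk (@nat_of_ord k) (@ord_inj k)); exists (restr (n := 0) x) => i.
have Hx : forall u : 'I_0 * Z -> M, psi u E y.
  move=> u; suff -> : u = restr (n := 0) x by [].
  by apply: funext => -[[]].
have := teq_sym (bsE i) (P := fun w => forall u : 'I_0 * Z -> M,
  psi u (fun x => w (inl x)) (fun x => w (inr x))).
by apply; [definable|].
Qed.

(** The terms are added one by one: over the base enlarged by the earlier ones, the type of the next
    term is still simple, and left transitivity assembles the results. *)
Lemma family_symmetry X Y (E : X -> M) (i : X0 -> X) (x : nat -> V -> M) (y : Y -> M) n :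
  sml X -> sml Y -> (forall z, E0 z = E (i z)) ->
  (forall j, teq (join E0 (x j)) (join E0 a0)) ->
  nfork E y (restr (n := n) x) -> ndiv E (restr (n := n) x) y.
Proof.
move=> sX sY Ei Hx; elim: n => [_|n IH H]; first exact: restr0_ndiv.
have sO m : sml ('I_m * V) by apply: sml_prod => //; exact: sml_ord.
have {}IH : ndiv E (restr (n := n) x) y.
  apply: IH; apply: (nfork_re (t := fun p => (widen_ord (leqnSn n) p.1, p.2)) sX (sO _) (sO _) H).
  by [].
have H1 : nfork (join E (restr (n := n) x)) y (x n).
  apply: (nfork_base (s := fun z => match z with inl z => inl z
    | inr p => inr (widen_ord (leqnSn n) p.1, p.2) end) (t := inl) (r := fun v => (ord_max, v))
    sX (sml_sum sX (sO _)) (sO _) sV H) => //.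
  by case.
have H2 : ndiv (join E (restr (n := n) x)) (x n) y.
  apply: simple_symmetry H1 => //; first exact: sml_sum.
  by apply: (simp_base (i := fun z => inl (i z)) _ (Hx n) a0_simple) => z; exact: Ei.
apply: (ndiv_re (s := fun p => match split_last p with inl v => inr v | inr q => inl q end)
  (t := id) sX sY sY (ndiv_join_base (sO _) sX sY IH H2)) => // p.
by rewrite restr_succ; case: (split_last p).
Qed.

(** A formula uses finitely many coordinates of [x], and these lie in a finite family of
    realizations of the simple type. *)
Theorem full_symmetry X Y Z (E : X -> M) (i : X0 -> X) (x : Z -> M) (y : Y -> M) :
  sml X -> sml Y -> sml Z -> (forall z, E0 z = E (i z)) -> full x ->
  nfork E y x -> ndiv E x y.
Proof.
move=> sX sY sZ Ei fx H psi dpsi Hpsi k Hk.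
have [S HS] := choice fx; have [iz Hiz] := choice HS.
have dpsi' : def2 (fun (w : X + Y -> M) x => psi x (fun i => w (inl i)) (fun i => w (inr i))).
  by definable.
have [n [g [h Hgh]]] := def_finite dpsi'.
pose fam j : V -> M := if insub j is Some j' then fun v => x (S (g (j' : 'I_n)) v) else a0.
have famE (j : 'I_n) : fam j = fun v => x (S (g j) v) by rewrite /fam valK.
have sO m : sml ('I_m * V) by apply: sml_prod => //; exact: sml_ord.
have Hfam : ndiv E (restr (n := n) fam) y.
  apply: (family_symmetry sX sY Ei).
    move=> j; rewrite /fam; case: insubP => [j' _ _|_]; last exact: teq_refl.
    by have [_] := Hiz (g j').
  apply: (nfork_re (t := fun p => S (g p.1) p.2) sX sZ (sO _) H) => -[j v].
  by rewrite /restr /= famE.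
pose psi' (u : 'I_n * V -> M) E y := psi (fun z => u (h z, iz (g (h z)))) E y.
apply: (Hfam psi' _ _ k).
- by rewrite /psi'; definable.
- rewrite /psi'; have := (Hgh (join E y) x).1 Hpsi.
  congr psi; apply: funext => z; rewrite /restr /= famE.
  by have [-> _] := Hiz (g (h z)).
have [bs [bsE bsk]] := Hk; exists bs; split=> // t ti [u Hu].
by apply: (bsk t ti); eexists; exact: Hu.
Qed.

End Full.

End SimpleTypes.

Section Symmetry.
Context {L : language} {M : structure L} {F : framed M}.
Hypothesis ntp2 : NTP2 M.
Lemma ndiv_sub V V' X Y Y' (E : X -> M) (c : V -> M) (b : Y -> M) (c' : V' -> M) (b' : Y' -> M) :
  sml X -> sml Y -> sml Y' -> ndiv E c b ->
  (forall z, exists w, c' z = c w) -> (forall y, exists w, b' y = b w) -> ndiv E c' b'.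
Proof.
move=> sX sY sY' H /choice [s cs] /choice [t bt].
exact: (ndiv_re sX sY sY' H cs bt).
Qed.

Lemma teq_sub V W (a b : V -> M) (a' b' : W -> M) : teq a b ->
  (forall w, exists v, a' w = a v /\ b' w = b v) -> teq a' b'.
Proof.
move=> ab /choice [s Hs]; apply: (teq_re s ab) => w; by have [] := Hs w.
Qed.

(** * Morley sequences of a global coheir given by an ultrafilter *)

Section CoheirUltrafilter.
Context {X Y : Type}.
Variables (mu : X -> M) (q : set_system (Y -> X)).
Hypothesis q_ultra : UltraFilter q.
Hypothesis sX : sml X.
Hypothesis sY : sml Y.

(* c realizes over (mu, B) the global coheir given by q. *)
Definition realizes_coheir W (B : W -> M) (c : Y -> M) : Prop :=
  forall P, def3 P -> P c mu B <-> q [set s | P (fun y => mu (s y)) mu B].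

Lemma realizes_coheir_re W W' (t : W' -> W) (B : W -> M) (B' : W' -> M) c :
  (forall w, B' w = B (t w)) -> realizes_coheir B c -> realizes_coheir B' c.
Proof.
move=> /funext -> H P dP.
by apply: (H (fun c mu B => P c mu (fun w => B (t w)))); definable.
Qed.

Lemma realizes_coheir_coh W (B : W -> M) c : realizes_coheir B c -> coh mu c B.
Proof. by move=> H P dP /(H P dP)/(@filter_ex _ _ _). Qed.

Lemma realizes_coheir_unique W (B B' : W -> M) c c' :
  realizes_coheir B c -> realizes_coheir B' c' -> teq (join mu B) (join mu B') ->
  teq (join (join mu B) c) (join (join mu B') c').
Proof.
move=> H H' BB' P dP Pc.
have dP3 : def3 (fun c mu (B : W -> M) => P (join (join mu B) c)) by definable.
apply/(H' _ dP3); move/(H _ dP3): Pc; apply: filterS => s /=.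
by apply: (BB' (fun w => P (join (join (fun x => w (inl x)) (fun z => w (inr z)))
  (fun y => w (inl (s y)))))); definable.
Qed.

Lemma realizes_coheir_ex W (B : W -> M) : sml W -> exists c, realizes_coheir B c.
Proof.
move=> sW.
pose G : set ((Y + (X + W) -> M) -> Prop) := [set P | def P /\
  q [set s | P (join (fun y => mu (s y)) (join mu B))]].
have [||||c Hc] := @realize_directed _ _ F _ _ (join mu B) G sY (sml_sum sX sW).
- exists (fun=> True); split; first exact: def_cst.
  by apply: filterS (@filterT _ q _) => s _.
- by move=> P [].
- move=> P P' [dP qP] [dP' qP']; exists (fun w => P w /\ P' w); split=> //.
  split; first exact: def_and.
  exact: filterI.
- by move=> P [_ /(@filter_ex _ _ _) [s Ps]]; exists (fun y => mu (s y)).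
have H P : def3 P -> q [set s | P (fun y => mu (s y)) mu B] -> P c mu B.
  move=> dP qP.
  by apply: (Hc (fun w => P (fun y => w (inl y)) (fun x => w (inr (inl x)))
    (fun z => w (inr (inr z))))); split=> //; definable.
exists c => P dP; split; last exact: H.
move=> Pc; have [//|nP] := in_ultra_setVsetC [set s | P (fun y => mu (s y)) mu B] q_ultra.
have dnP : def3 (fun c mu B => ~ P c mu B) by definable.
by have := H _ dnP nP.
Qed.

Lemma coheir_morley : exists H : nat -> Y -> M,
  forall l, realizes_coheir (restr (n := l) H) (H l).
Proof.
have [s0 _] : exists s, [set: Y -> X] s by apply: (@filter_ex _ q _); exact: filterT.
have [||H HH] := @dependent_choice _ (fun y => mu (s0 y))
  (fun l f t => realizes_coheir (restr (n := l) f) t).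
- move=> l f f' t ff'; suff -> : restr (n := l) f = restr (n := l) f' by [].
  by apply: funext => -[i p]; rewrite /restr /= ff'.
- by move=> l f _; apply: realizes_coheir_ex; apply: sml_prod => //; exact: sml_ord.
by exists H.
Qed.

(** A subsequence again realizes [q] step by step, and [q] determines the type over each conjugate
    base. *)
Lemma morley_incr (H : nat -> Y -> M) (h : nat -> nat) n : incr h ->
  (forall l, realizes_coheir (restr (n := l) H) (H l)) ->
  teq (join mu (restr (n := n) (fun i => H (h i)))) (join mu (restr (n := n) H)).
Proof.
move=> hi HH; elim: n => [|n IH].
  by rewrite (_ : restr _ = restr (n := 0) H) //; apply: funext => -[[]].
have H1 : realizes_coheir (restr (n := n) (fun i => H (h i))) (H (h n)).
  apply: (realizes_coheir_re (t := fun p : 'I_n * Y => (Ordinal (hi _ _ (ltn_ord p.1)), p.2)) _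
    (HH (h n))).
  by [].
apply: (teq_re (fun z => match z with inl x => inl (inl x) | inr p =>
  match split_last p with inl y => inr y | inr q => inl (inr q) end end)
  (realizes_coheir_unique H1 (HH n) IH)) => -[//|p] /=;
  by rewrite restr_succ; case: (split_last p).
Qed.

End CoheirUltrafilter.

Lemma coheir_ultrafilter X Y (mu : X -> M) (g : Y -> M) : Mod mu ->
  exists q : set_system (Y -> X), UltraFilter q /\
    forall P, def2 P -> P g mu -> q [set s | P (fun y => mu (s y)) mu].
Proof.
move=> Mmu.
pose f : set_system (Y -> X) := [set A | exists P, [/\ def2 P, P g mu &
  forall s, P (fun y => mu (s y)) mu -> A s]].
have fF : ProperFilter f.
  apply: Build_ProperFilter_ex.
    by move=> A [P [dP Pg PA]]; have [s /PA] := Mmu _ P dP (ex_intro _ g Pg); exists s.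
  split.
  - by exists (fun _ _ => True); split=> //; definable.
  - move=> A B [P [dP Pg PA]] [Q [dQ Qg QB]].
    exists (fun x y => P x y /\ Q x y); split=> //; first by definable.
    by move=> s [/PA ? /QB].
  - by move=> A B AB [P [dP Pg PA]]; exists P; split=> // s /PA/AB.
have [q [uq fq]] := ultraFilterLemma fF; exists q; split=> // P dP Pg.
by apply: fq; exists P.
Qed.

Section Full.
Context {V X0 : Type}.
Variables (E0 : X0 -> M) (a0 : V -> M).
Hypothesis a0_simple : simp E0 a0.
Hypothesis sV : sml V.
Hypothesis sX0 : sml X0.

Lemma full_ndiv_sym X (E : X -> M) (i : X0 -> X) Y Z (x : Z -> M) (y : Y -> M) :
  sml X -> sml Y -> sml Z -> (forall z, E0 z = E (i z)) -> forks_divides E ->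
  full E0 a0 x -> ndiv E y x -> ndiv E x y.
Proof.
move=> sX sY sZ Ei fd fx yx.
by apply: (full_symmetry a0_simple sV sX sY sZ Ei fx); exact: nfork_of_ndiv.
Qed.

(** * Kim's lemma and independent families over a model *)

Section OverModel.
Context {X : Type}.
Variables (mu : X -> M) (i : X0 -> X).
Hypothesis sX : sml X.
Hypothesis Mmu : Mod mu.
Hypothesis E0_mu : forall z, E0 z = mu (i z).

Let fd_mu : forks_divides mu := forks_divides_model ntp2 sX Mmu.

(* Coheir sequences of realizations of a simple type are strict, so they witness
   dividing for formulas in arbitrary object variables. *)
Lemma full_kim W Y (psi : (W -> M) -> (X -> M) -> (Y -> M) -> Prop) k :
  sml Y -> def3 psi -> exists n, forall G : nat -> Y -> M,
    (forall l, full E0 a0 (G l)) -> (forall l, coh mu (G l) (restr (n := l) G)) ->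
    (forall l, Div mu (G l) psi k) -> ~ exists y, forall l, l < n -> psi y mu (G l).
Proof.
move=> sY dpsi; have [n Hn] := no_arrays_over ntp2 k sX sY dpsi.
exists n => G fG cG dG [y Hy].
have sO (Z : Type) l : sml Z -> sml ('I_l * Z) by apply: sml_prod; exact: sml_ord.
have sN : sml (nat * Y) by apply: sml_prod => //; exact: sml_nat.
pose I (t : (Y -> M) * (nat -> Y -> M)) : Y + nat * Y -> M := join t.1 (flat t.2).
have sZ : sml (Y + nat * Y) by exact: sml_sum.
pose B l (f : nat -> (Y -> M) * (nat -> Y -> M)) := restr (n := l) (fun i => I (f i)).
pose f1 l (f : nat -> (Y -> M) * (nat -> Y -> M)) := restr (n := l) (fun i => (f i).1).
(* The first components are kept conjugate to [G], to which the common solution belongs; the rows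
   stay unions of realizations of the simple type. *)
pose Phi l f (t : (Y -> M) * (nat -> Y -> M)) :=
  [/\ teq (join (join mu (f1 l f)) t.1) (join (join mu (restr (n := l) G)) (G l)),
      coh mu t.1 (B l f),
      forall j, teq (join (join mu (B l f)) (t.2 j)) (join (join mu (B l f)) t.1),
      kinc k (fun j x => psi x mu (t.2 j)) & full E0 a0 (I t)].
have Phi_eq f l : (forall j, j < l -> Phi j f (f j)) ->
    teq (join mu (f1 l f)) (join mu (restr (n := l) G)).
  case: l => [_|l H].
    by rewrite (_ : f1 0 f = restr (n := 0) G) //; apply: funext => -[[]].
  have [H1 _ _ _ _] := H l (ltnSn l).
  apply: (teq_re (fun z => match z with inl x => inl (inl x) | inr p =>
    match split_last p with inl y => inr y | inr q => inl (inr q) end end) H1) => -[//|p] /=;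
    by rewrite /f1 restr_succ; case: (split_last p).
have [||f Hf] := @dependent_choice _ (G 0, G) Phi.
- move=> l f f' t ff'; rewrite /Phi.
  have -> : B l f = B l f' by apply: funext => -[j p]; rewrite /B /restr /= ff'.
  by have -> : f1 l f = f1 l f' by apply: funext => -[j p]; rewrite /f1 /restr /= ff'.
- move=> l f Hf.
  have [g0 Hg0] := realize_type (G l) sY (sml_sum sX (sO _ _ sY)) (teq_sym (Phi_eq f l Hf)).
  have c0 : coh mu g0 (f1 l f) := coh_teq Hg0 (cG l).
  have [g [gg0 gB]] := coh_extend (B l f) sX sY (sO _ _ sY) (sO _ _ sZ) c0.
  have {}gB : coh mu g (B l f) by apply: (coh_re (s := id) (t := inr) gB).
  have Gg : teq (join mu (G l)) (join mu g).
    by apply: (teq_re (fun z => match z with inl x => inl (inl x) | inr y => inr y end)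
      (teq_trans Hg0 (teq_sym gg0))) => -[].
  have fg : full E0 a0 g := full_teq E0_mu Gg (fG l).
  have fB : full E0 a0 (B l f).
    apply: (full_family (x := fun (j : 'I_l) => I (f j))) => j.
    by have [_ _ _ _] := Hf j (ltn_ord j).
  (* Strictness: [g] is a coheir over [B l f], and symmetry applies because [B l f] is full. *)
  have Bg : ndiv mu (B l f) g.
    apply: (full_symmetry a0_simple sV sX sY (sO _ _ sZ) E0_mu fB).
    exact: (coh_nfork sX sY (sO _ _ sZ) gB).
  have [R [HR Rk]] := Div_conj (sO _ _ sZ) sX sY dpsi Bg (Div_teq Gg (dG l)).
  exists (g, R); split=> //; first exact: (teq_trans gg0 (teq_sym Hg0)).
  apply: full_join => //; apply: (full_family (x := R)) => j.
  apply: full_teq E0_mu _ fg.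
  by apply: (teq_re (fun z => match z with inl x => inl (inl x) | inr y => inr y end)
      (teq_sym (HR j))) => -[].
apply: (Hn mu (fun l => (f l).2)); split=> [l _|h]; first by have [] := Hf l.
have H := coh_paths (mu := mu) (I := fun l => I (f l)) (s0 := inl)
  (s := fun l y => inr (h l, y)) (n := n).
have {}H := teq_trans (teq_sym (Phi_eq f n (fun j _ => Hf j))) (teq_sym (H _ _)).
have {}H := H _ _ (fun w => exists x, forall l : 'I_n, psi x (fun z => w (inl z))
  (fun y => w (inr (l, y)))).
case: H => [l _|l _|||x' Hx'].
- by have [] := Hf l.
- by have [_ _ + _ _] := Hf l; apply.
- by definable.
- by exists y => l; exact: (Hy l (ltn_ord l)).
- by exists x' => l ln; exact: (Hx' (Ordinal ln)).
Qed.

Lemma not_kinc_incr (T : Type) N (G : nat -> T -> Prop) : ~ kinc N G ->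
  exists h, incr h /\ exists x, forall j, j < N -> G (h j) x.
Proof.
move=> /existsNP [t /not_implyP [ti /contrapT [x Hx]]].
have [h [hi Hh]] := injective_incr ti; exists h; split=> //; exists x => j jN.
by have [j' ->] := Hh j jN; exact: Hx.
Qed.

(* A Morley sequence of a coheir of g, arranged to be homogeneous over c. *)
Lemma morley_row Y W (g : Y -> M) (c : W -> M) :
  sml Y -> sml W -> full E0 a0 g -> ndiv mu c g ->
  exists R : nat -> Y -> M,
    [/\ forall j, teq (join (join mu c) (R j)) (join (join mu c) g),
        ndiv mu c (flat R) &
        forall V' (phi : (V' -> M) -> (X -> M) -> (Y -> M) -> Prop) k n,
          def3 phi -> Div mu g phi k ->
          (forall G : nat -> Y -> M, (forall l, full E0 a0 (G l)) ->
             (forall l, coh mu (G l) (restr (n := l) G)) ->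
             (forall l, Div mu (G l) phi k) -> ~ exists y, forall l, l < n -> phi y mu (G l)) ->
          kinc n (fun j y => phi y mu (R j))].
Proof.
move=> sY sW fg cg.
have sO (Z : Type) l : sml Z -> sml ('I_l * Z) by apply: sml_prod; exact: sml_ord.
have sN : sml (nat * Y) by apply: sml_prod => //; exact: sml_nat.
have [q [uq qg]] := coheir_ultrafilter g Mmu.
have [H HH] := coheir_morley mu uq sX sY.
have Hg l : teq (join mu (H l)) (join mu g).
  apply: teq_sym => P dP Pg.
  have dP3 : def3 (fun h mu (_ : 'I_l * Y -> M) => P (join mu h)) by definable.
  by apply/(HH l _ dP3); apply: (qg (fun g mu => P (join mu g))) => //; definable.
have fH l : full E0 a0 (H l) := full_teq E0_mu (teq_sym (Hg l)) fg.
have cH l : coh mu (H l) (restr (n := l) H) := realizes_coheir_coh uq (HH l).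
(* As [c] does not divide over [g], some subsequence of [H] has a common solution of [Q]; by
   indiscernibility so have the first [N] terms. *)
have common Q N : def3 Q -> Q c mu g -> exists z, forall l, l < N -> Q z mu (H l).
  move=> dQ Qc.
  have [|h [hi [z Hz]]] := @not_kinc_incr _ N (fun l z => Q z mu (H l)).
    by move=> K; apply: (cg Q dQ Qc N); exists H.
  have T := morley_incr uq (n := N) hi HH.
  have := T (fun w => exists z, forall l : 'I_N, Q z (fun x => w (inl x)) (fun y => w (inr (l, y)))).
  case=> [||z' Hz']; [by definable|by exists z => l; exact: (Hz l (ltn_ord l))|].
  by exists z' => l lN; exact: (Hz' (Ordinal lN)).
(* Otherwise the conjunction of [Q] over the first [N] terms forks, hence divides, over [mu]. Kim's
   lemma then refutes it along consecutive blocks of [H], against [common]. *)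
have avoid Q N n (chi : nat -> (W -> M) -> (X -> M) -> (nat * Y -> M) -> Prop) k :
    def3 Q -> Q c mu g -> (forall j, def3 (chi j)) ->
    (forall j, j < n -> Div mu (flat H) (chi j) (k j)) ->
    exists z, (forall l, l < N -> Q z mu (H l)) /\ forall j, j < n -> ~ chi j z mu (flat H).
  move=> dQ Qc dchi dvchi; apply: contrapT => nz.
  have [||k' [bs [bsE bsk]]] := fd_mu (g := flat H)
    (phi := fun z m w => forall l, l < N -> Q z m (fun y => w (l, y))) sN _ dchi dvchi.
  - by definable.
  - move=> z Hz; apply: contrapT => nj; apply: nz; exists z; split=> // j jn cj.
    by apply: nj; exists j.
  pose Pi (z : W -> M) (m : X -> M) (w : 'I_N * Y -> M) := forall l : 'I_N, Q z m (fun y => w (l, y)).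
  have dPi : def3 Pi by rewrite /Pi; definable.
  pose G m : 'I_N * Y -> M := fun p => H (m * N + p.1) p.2.
  have GH m : teq (join mu (restr (n := N) H)) (join mu (G m)).
    have hi : incr (addn (m * N)) by move=> a b; rewrite ltn_add2l.
    exact: (teq_sym (morley_incr uq (n := N) hi HH)).
  have DivPi m : Div mu (G m) Pi k'.
    apply: Div_teq (GH m) _; exists (fun j => fun p : 'I_N * Y => bs j ((p.1 : nat), p.2)); split.
      move=> j; apply: (teq_re (fun z : X + 'I_N * Y => match z with inl x => inl x
        | inr p => inr ((p.1 : nat), p.2) end) (bsE j)) => -[] //.
    move=> t ti [x Hx]; apply: (bsk t ti); exists x => j l lN.
    exact: (Hx j (Ordinal lN)).
  have fG m : full E0 a0 (G m) := full_family (x := fun l : 'I_N => H (m * N + l)) (fun l => fH _).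
  have cG m : coh mu (G m) (restr (n := m) G).
    have T : coh mu (fun p : nat * Y => H (m * N + minn p.1 N) p.2) (restr (n := m * N) H).
      exact: coh_tail.
    have lt (j : 'I_m) (l : 'I_N) : j * N + l < m * N.
      rewrite (leq_trans (n := j.+1 * N)) ?leq_mul2r ?ltn_ord ?orbT //.
      by rewrite mulSn addnC ltn_add2r.
    apply: (coh_re (s := fun p : 'I_N * Y => ((p.1 : nat), p.2))
      (t := fun p : 'I_m * ('I_N * Y) => (Ordinal (lt p.1 p.2.1), p.2.2)) T) => //.
    by move=> [l y]; rewrite /G /= (minn_idPl (ltnW (ltn_ord l))).
  have [n1 Hn1] := full_kim k' (sO _ N sY) dPi.
  apply: (Hn1 G fG cG DivPi).
  have [z Hz] := common Q (n1 * N) dQ Qc; exists z => m mn1 l; apply: (Hz (m * N + l)).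
  rewrite (leq_trans (n := m.+1 * N)) ?leq_mul2r ?mn1 ?orbT //.
  by rewrite mulSn addnC ltn_add2r.
pose e := join mu (flat H).
pose ok Q N n chi k := [/\ def3 Q, Q c mu g, (forall j, def3 (chi j)) &
  forall j, j < n -> Div mu (flat H)
    (chi j : (W -> M) -> (X -> M) -> (nat * Y -> M) -> Prop) (k j)] /\ N = N :> nat.
pose cond Q N n (chi : nat -> (W -> M) -> (X -> M) -> (nat * Y -> M) -> Prop) z :=
  (forall l, l < N -> Q z mu (H l)) /\ forall j, j < n -> ~ chi j z mu (flat H).
pose GG : set ((W + (X + nat * Y) -> M) -> Prop) := [set P | def P /\ exists Q N n chi k,
  ok Q N n chi k /\ forall z, cond Q N n chi z -> P (join z e)].
have GG_intro Q N n chi k P : def P -> ok Q N n chi k ->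
    (forall z, cond Q N n chi z -> P (join z e)) -> GG P.
  by move=> dP H1 H2; split=> //; exists Q, N, n, chi, k.
have dT : def3 (fun (_ : W -> M) (_ : X -> M) (_ : Y -> M) => True) by definable.
have dF : def3 (fun (_ : W -> M) (_ : X -> M) (_ : nat * Y -> M) => False) by definable.
have [||||c' Hc'] := @realize_directed _ _ F _ _ e GG sW (sml_sum sX sN).
- exists (fun=> True).
  by apply: (@GG_intro (fun _ _ _ => True) 0 0 (fun _ _ _ _ => False) (fun=> 0));
    first exact: def_cst.
- by move=> P [].
- move=> P P' [dP [Q [N [n [chi [k [[[dQ Qc dchi Hd] _] HP]]]]]]].
  move=> [dP' [Q' [N' [n' [chi' [k' [[[dQ' Qc' dchi' Hd'] _] HP']]]]]]].
  exists (fun w => P w /\ P' w); split=> //.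
  pose chi2 i := if i < n then chi i else chi' (i - n).
  pose k2 i := if i < n then k i else k' (i - n).
  apply: (@GG_intro (fun x y z => Q x y z /\ Q' x y z) (maxn N N') (n + n') chi2 k2).
  + exact: def_and.
  + split=> //; split; [by definable|by []|by move=> j; rewrite /chi2; case: ifP|].
    move=> j jn; rewrite /chi2 /k2; case: ltnP => [|nj]; first exact: Hd.
    by apply: Hd'; rewrite ltn_subLR.
  + move=> z [HQ Hchi]; split; [apply: HP|apply: HP']; split.
    * by move=> l lN; have [] := HQ l _ => //; rewrite leq_max lN.
    * by move=> j jn; have := Hchi j; rewrite /chi2 jn; apply; exact: ltn_addr.
    * by move=> l lN; have [] := HQ l _ => //; rewrite leq_max lN orbT.
    * move=> j jn; have E : chi2 (n + j) = chi' j by rewrite /chi2 ltnNge leq_addr addKn.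
      by rewrite -E; apply: Hchi; rewrite ltn_add2l.
- move=> P [dP [Q [N [n [chi [k [[[dQ Qc dchi Hd] _] HP]]]]]]].
  by have [z Hz] := avoid Q N n chi k dQ Qc dchi Hd; exists z; exact: HP.
have c'H l : teq (join (join mu c') (H l)) (join (join mu c) g).
  apply: teq_sym => P dP Pc.
  apply: (Hc' (fun w => P (join (join (fun x => w (inr (inl x))) (fun i => w (inl i)))
    (fun y => w (inr (inr (l, y))))))).
  apply: (@GG_intro (fun z m y => P (join (join m z) y)) l.+1 0 (fun _ _ _ _ => False)
    (fun=> 0)); [by definable|by split=> //; split=> //; definable|].
  by move=> z [Hz _]; exact: (Hz l (ltnSn l)).
have c'nd : ndiv mu c' (flat H).
  move=> chi dchi Hchi k Hk; move: Hchi.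
  apply: (Hc' (fun w => ~ chi (fun z => w (inl z)) (fun x => w (inr (inl x)))
    (fun p => w (inr (inr p))))).
  apply: (@GG_intro (fun _ _ _ => True) 0 1 (fun=> chi) (fun=> k)) => //; first by definable.
  by move=> z [_ /(_ 0 isT)].
have cc' : teq (join mu c') (join mu c).
  by apply: (teq_re inl (c'H 0)) => -[].
have [R' HR'] := realize_type (flat H) sN (sml_sum sX sW) cc'.
pose R j y := R' (j, y).
have R'E : R' = flat R by apply: funext => -[].
rewrite {}R'E in HR'.
exists R; split.
- move=> j; apply: teq_trans (c'H j); apply: teq_sym.
  by apply: (teq_re (fun z => match z with inl x => inl x | inr y => inr (j, y) end) HR') => -[].
- exact: (ndiv_teq HR' c'nd).
- move=> V' phi k n dphi Hk Hn.
  suff K : kinc n (fun j y => phi y mu (H j)).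
    move=> t ti.
    apply: (HR' (fun w => ~ exists x, forall j, phi x (fun z => w (inl (inl z)))
      (fun y => w (inr (t j, y))))); [by definable|exact: K].
  apply: contrapT => /not_kinc_incr [h [hi Hh]].
  apply: (Hn (fun l => H (h l))) Hh => [l|l|l]; first exact: fH.
    apply: (coh_re (s := id) (t := fun p : 'I_l * Y => (Ordinal (hi _ _ (ltn_ord p.1)), p.2))
      (cH (h l))) => //.
  exact: Div_teq (teq_sym (Hg _)) Hk.
Qed.

Lemma full_sym_model Y Z (x : Z -> M) (y : Y -> M) :
  sml Y -> sml Z -> full E0 a0 x -> ndiv mu y x -> ndiv mu x y.
Proof. by move=> sY sZ; exact: (full_ndiv_sym sX sY sZ E0_mu fd_mu). Qed.

Definition others (T Y : Type) n i (x : nat -> Y -> T) (p : {j : nat | j < n /\ j <> i} * Y) : T :=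
  x (sval p.1) p.2.

(** The single term is on the parameter side, as required for replacing it by a row in
    [morley_row]. *)
Definition independent Y n (x : nat -> Y -> M) : Prop :=
  forall i, i < n -> ndiv mu (others (n := n) (i := i) x) (x i).

Lemma sml_others Y n j : sml Y -> sml ({l : nat | l < n /\ l <> j} * Y).
Proof. by move=> sY; apply: sml_prod => //; apply: sml_sig; exact: sml_nat. Qed.

(** Symmetry handles the last term; an earlier one gains the new term among the others by left
    transitivity. *)
Lemma independent_sequence Y n (x : nat -> Y -> M) :
  sml Y -> (forall l, full E0 a0 (x l)) -> (forall l, ndiv mu (x l) (restr (n := l) x)) ->
  independent n x.
Proof.
move=> sY fx Hx.
have sO l : sml ('I_l * Y) by apply: sml_prod => //; exact: sml_ord.
elim: n => [//|n IH] j jn.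
have [->|jn'] := eqVneq j n.
  have H : ndiv mu (restr (n := n) x) (x n).
    apply: full_sym_model => //.
    exact: (full_family (x := fun l : 'I_n => x l)).
  apply: (ndiv_sub sX sY sY H) => [[[l [ln ln']] y]|y]; last by exists y.
  have lt : l < n by rewrite ltn_neqAle -ltnS ln andbT; apply/eqP.
  by exists (Ordinal lt, y).
have {}jn : j < n by rewrite ltn_neqAle jn' -ltnS.
have H : ndiv mu (x n) (join (others (n := n) (i := j) x) (x j)).
  apply: (ndiv_sub sX (sO _) (sml_sum (sml_others _ _ sY) sY) (Hx n)) => [y|[[[l [ln lj]] y]|y]].
  - by exists y.
  - by exists (Ordinal ln, y).
  - by exists (Ordinal jn, y).
apply: (ndiv_sub sX sY sY (ndiv_join (sml_others _ _ sY) sX sY (IH j jn) H)) => [[[l [ln lj]] y]|y];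
  last by exists y.
have [E|ln'] := eqVneq l n; first by exists (inr y); rewrite /others /= E.
have lt : l < n by rewrite ltn_neqAle ln' -ltnS.
by exists (inl (exist _ l (conj lt lj), y)).
Qed.

Lemma independent_replace Y n (x : nat -> Y -> M) m (r : Y -> M) :
  sml Y -> full E0 a0 r -> m < n -> independent n x ->
  ndiv mu (others (n := n) (i := m) x) r ->
  independent n (fun l => if l == m then r else x l).
Proof.
move=> sY fr mn Ix xr j jn.
have [->|/eqP jm] := eqVneq j m.
  rewrite (_ : others _ = others (n := n) (i := m) x) //.
  by apply: funext => -[[l lP] y]; rewrite /others /=; have [_ /eqP/negPf ->] := lP.
have sT : sml ({l : nat | l < n /\ l <> j /\ l <> m} * Y).
  by apply: sml_prod => //; apply: sml_sig; exact: sml_nat.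
pose oth2 (p : {l : nat | l < n /\ l <> j /\ l <> m} * Y) := x (sval p.1) p.2.
have H1 : ndiv mu oth2 (x j).
  apply: (ndiv_sub sX sY sY (Ix j jn)) => [[[l [ln [lj lm]]] y]|y]; last by exists y.
  by exists (exist _ l (conj ln lj), y).
have H2 : ndiv mu r (join oth2 (x j)).
  have H : ndiv mu r (others (n := n) (i := m) x).
    by apply: full_sym_model => //; exact: sml_others.
  apply: (ndiv_sub sX (sml_others _ _ sY) (sml_sum sT sY) H)
    => [y|[[[l [ln [lj lm]]] y]|y]].
  - by exists y.
  - by exists (exist _ l (conj ln lm), y).
  - by exists (exist _ j (conj jn jm), y).
apply: (ndiv_sub sX sY sY (ndiv_join sT sX sY H1 H2)) => [[[l [ln lj]] y]|y]; last first.
  by exists y.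
rewrite /others /=; case: eqP => [_|lm]; first by exists (inr y).
by exists (inl (exist _ l (conj ln (conj lj lm)), y)).
Qed.

(* Replacing the terms of the sequence one after the other by Morley rows gives an
   array whose paths have the type of the sequence. *)
Lemma independent_array (a : nat -> V -> M) :
  (forall l, full E0 a0 (a l)) -> (forall l, ndiv mu (a l) (restr (n := l) a)) ->
  forall W (phi : (W -> M) -> (X -> M) -> (V -> M) -> Prop) k,
    def3 phi -> (forall l, Div mu (a l) phi k) ->
  exists k', forall N, exists A : nat -> nat -> V -> M,
    (forall l, l < N -> kinc k' (fun j y => phi y mu (A l j))) /\
    forall f : nat -> nat, teq (join mu (restr (n := N) (fun l => A l (f l))))
                               (join mu (restr (n := N) a)).
Proof.
move=> fa Ia W phi k dphi Dphi.
have [k' Hk'] := full_kim k sV dphi; exists k' => N.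
have sN : sml (nat * V) by apply: sml_prod => //; exact: sml_nat.
(* Every term is stored as a row, constant until it is replaced, so that independence covers both
   kinds. *)
suff H t : t <= N -> exists x : nat -> nat * V -> M,
    [/\ independent N x, forall l, full E0 a0 (x l),
      forall l, l < t -> kinc k' (fun j y => phi y mu (fun v => x l (j, v))),
      forall l, t <= l -> x l = (fun p => a l p.2) &
      forall f : nat -> nat, teq (join mu (restr (n := N) (fun l v => x l (f l, v))))
                               (join mu (restr (n := N) a))].
  have [x [_ _ H1 _ H2]] := H N (leqnn N).
  by exists (fun l j v => x l (j, v)).
elim: t => [_|t IH tN].
  exists (fun l p => a l p.2); split=> //; last by move=> f; exact: teq_refl.
    apply: independent_sequence => // [l|l].
      by move=> [j v]; have [s [v' [<- E]]] := fa l v; exists (fun v => (j, s v)), v'.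
    apply: (ndiv_sub sX _ _ (Ia l)) => [||[j v]|[j [j' v]]].
    - by apply: sml_prod sV; exact: sml_ord.
    - by apply: sml_prod sN; exact: sml_ord.
    - by exists v.
    - by exists (j, v).
  by move=> l [j v]; have [s [v' [<- E]]] := fa l v; exists (fun v => (j, s v)), v'.
have [x [Ix fx kx xa px]] := IH (ltnW tN).
pose c := others (n := N) (i := t) x.
have sC : sml ({l : nat | l < N /\ l <> t} * (nat * V)) := sml_others _ _ sN.
have ca : ndiv mu c (a t).
  have H := Ix t tN; rewrite (xa t (leqnn t)) in H.
  by apply: (ndiv_sub sX sN sV H) => [z|v]; [exists z|exists (0, v)].
have [R [cR ndR kR]] := morley_row sV sC (fa t) ca.
have Ra j : teq (join mu (R j)) (join mu (a t)).
  by apply: (teq_re (fun z => match z with inl x => inl (inl x) | inr y => inr y end) (cR j))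
    => -[].
have fR : full E0 a0 (flat R).
  by apply: (full_family (x := R)) => j; exact: full_teq E0_mu (teq_sym (Ra j)) (fa t).
exists (fun l => if l == t then flat R else x l); split.
- exact: independent_replace.
- by move=> l; case: ifP.
- move=> l; rewrite ltnS leq_eqVlt; case: eqP => [-> _|_ /=]; last exact: kx.
  exact: kR dphi (Dphi t) Hk'.
- move=> l tl; have /negPf -> : l != t by rewrite gtn_eqF.
  by apply: xa; exact: ltnW.
move=> f; apply: teq_trans (px f).
apply: (teq_sub (cR (f t))) => -[z|[l v]]; first by exists (inl (inl z)).
rewrite /restr /=; case: eqP => [E|lt].
  by exists (inr v); rewrite E (xa t (leqnn t)).
by exists (inl (inr (exist _ (l : nat) (conj (ltn_ord l) lt), (f l, v)))).
Qed.

End OverModel.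

(* Symmetry in the direction which needs NTP2. *)
Theorem simple_symmetry_left Y (b : Y -> M) :
  sml Y -> ext_base E0 -> nfork E0 a0 b -> ndiv E0 b a0.
Proof.
move=> sY eE0 ab phi dphi Hphi k Hk.
have fd0 : forks_divides E0 := forks_divides_ext ntp2 sX0 eE0.
have sO l : sml ('I_l * V) by apply: sml_prod sV; exact: sml_ord.
have sN : sml (nat * V) by apply: sml_prod sV; exact: sml_nat.
pose Phi l (f : nat -> V -> M) (t : V -> M) :=
  teq (join (join E0 b) t) (join (join E0 b) a0) /\ ndiv E0 t (join b (restr (n := l) f)).
have [||a Ha] := @dependent_choice _ a0 Phi.
- move=> l f f' t ff'; rewrite /Phi.
  suff -> : restr (n := l) f = restr (n := l) f' by [].
  by apply: funext => -[i p]; rewrite /restr /= ff'.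
- by move=> l f _; exact: ab.
have [X [mu [i [sX Mmu Ei mua]]]] := independent_model (flat a) sX0 sN eE0.
have a_a0 l : teq (join E0 (a l)) (join E0 a0).
  have [H _] := Ha l.
  by apply: (teq_re (fun z => match z with inl x => inl (inl x) | inr v => inr v end) H) => -[].
have fa l : full E0 a0 (a l) := full_single (a_a0 l).
have Ia l : ndiv E0 (a l) (restr (n := l) a).
  have [_ H] := Ha l.
  by apply: (ndiv_sub sX0 (sml_sum sY (sO l)) (sO l) H) => z; [exists z|exists (inr z)].
have fra l : full E0 a0 (restr (n := l) a) := full_family (x := fun j : 'I_l => a j) (fun j => fa j).
(* Over [E0], both the earlier terms and the model are independent from [a l]; symmetry turns this
   around, and base monotonicity moves the model into the base. *)
have Ia_mu l : ndiv mu (a l) (restr (n := l) a).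
  have H1 : ndiv E0 (restr (n := l) a) (a l).
    exact: (full_ndiv_sym sX0 sV (sO l) (i := id) (fun=> erefl) fd0 (fra l) (Ia l)).
  have H2 : ndiv E0 mu (join (restr (n := l) a) (a l)).
    apply: (ndiv_sub sX0 sN (sml_sum (sO l) sV) mua) => [x|[[j v]|v]].
    - by exists x.
    - by exists (j : nat, v).
    - by exists (l, v).
  have H3 : ndiv E0 (a l) (join (restr (n := l) a) mu).
    apply: (full_ndiv_sym sX0 (sml_sum (sO l) sX) sV (i := id) (fun=> erefl) fd0 (fa l)).
    exact: ndiv_join.
  exact: (ndiv_base (s := fun x => inr (inr x)) (t := i) (r := inl) sX0 sX
    (sml_sum (sO l) sX) (sO l) H3).
pose phi' y (m : X -> M) w := phi y (fun z => m (i z)) w.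
have dphi' : def3 phi' by rewrite /phi'; definable.
have Dphi l : Div mu (a l) phi' k.
  apply: (Div_over_model sX0 sX sV dphi Ei _ (Div_teq (teq_sym (a_a0 l)) Hk)).
  by apply: (ndiv_sub sX0 sN sV mua) => [x|v]; [exists x|exists (l, v)].
have [k' Hk'] := independent_array sX Mmu Ei fa Ia_mu dphi' Dphi.
have [N HN] := no_arrays_over ntp2 k' sX sV dphi'.
have [A [kA pA]] := Hk' N.
apply: (HN mu A); split=> // f.
have := teq_sym (pA f) (P := fun w => exists y, forall l : 'I_N, phi' y (fun x => w (inl x))
  (fun v => w (inr (l, v)))).
case=> [||y Hy]; [by definable| |by exists y => l lN; exact: (Hy (Ordinal lN))].
(* [b] satisfies the formula at every [a l], and each path has the type of [a]. *)
exists b => l; rewrite /phi' /restr /= -(funext Ei).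
have [H _] := Ha l.
have := teq_sym H (P := fun w => phi (fun y => w (inl (inr y))) (fun x => w (inl (inl x)))
  (fun v => w (inr v))).
by apply; [definable|].
Qed.

End Full.

End Symmetry.

(** * Cardinals *)

(** A maximal partial injection, given by its graph, is total on one side. *)
Lemma embeds_total (T U : Type) : embeds T U \/ embeds U T.
Proof.
pose P (G : set (T * U)) := forall p q, G p -> G q -> (p.1 = q.1 <-> p.2 = q.2).
have [|G [PG maxG]] := @Zorn_bigcup _ P.
  move=> H HP Htot p q [G HG Gp] [G' HG' G'q].
  have [GG'|G'G] := Htot _ _ HG HG'.
    by apply: (HP _ HG') => //; exact: GG'.
  by apply: (HP _ HG) => //; exact: G'G.
have [domG|ndom] := pselect (forall t, exists u, G (t, u)).
  have [f Hf] := choice domG; left; exists f => t t' E.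
  by have [_ /(_ E)] := PG _ _ (Hf t) (Hf t').
have [ranG|nran] := pselect (forall u, exists t, G (t, u)).
  have [f Hf] := choice ranG; right; exists f => t t' E.
  by have [/(_ E)] := PG _ _ (Hf t) (Hf t').
move: ndom nran => /existsNP [t nt] /existsNP [u nu].
have nG p : G p -> p.1 <> t /\ p.2 <> u.
  by case: p => a b Gab; split=> /= E; subst; [apply: nt; exists b|apply: nu; exists a].
have [] := maxG (G `|` [set (t, u)]).
  split; first by move=> p Gp; left.
  by move=> /(_ (t, u) (or_intror erefl)) /nG [].
move=> p q [Gp|->] [Gq|->] //=; first exact: PG.
  by have [? ?] := nG _ Gp; split.
by have [? ?] := nG _ Gq; split=> E; [case: (nG _ Gq) => /(_ (esym E))|case: (nG _ Gq) => _ /(_ (esym E))].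
Qed.

Lemma embeds_sub (T : Type) (P Q : T -> Prop) : embeds {x | P x} {x | Q x} ->
  exists h : T -> T, (forall x, P x -> Q (h x)) /\
    forall x y, P x -> P y -> h x = h y -> x = y.
Proof.
move=> [h hi].
have /choice [e He] : forall x, exists y, forall Px : P x, sval (h (exist _ x Px)) = y.
  move=> x; have [Px|nP] := pselect (P x); last by exists x.
  by exists (sval (h (exist _ x Px))) => Px'; rewrite (Prop_irrelevance Px' Px).
exists e; split=> [x Px|x y Px Py].
  by rewrite -(He x Px); exact: svalP.
rewrite -(He x Px) -(He y Py) => E.
suff /hi [] : h (exist _ x Px) = h (exist _ y Py) by [].
by move: E (svalP (h (exist _ x Px))) (svalP (h (exist _ y Py)));
  case: (h _) => a Qa; case: (h _) => b Qb /= E _ _; exact: eq_exist.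
Qed.

(* A maximal subset A of T carrying an injection of A * A into A that extends a
   pairing of nat dominates its complement. *)
Theorem embeds_square (T : Type) : embeds nat T -> embeds (T * T) T.
Proof.
move=> [nu nui]; have [un unK] := embeds_left_inverse 0 nui.
pose good (p : set T * (T -> T -> T)) :=
  [/\ forall n, p.1 (nu n),
      forall x y, p.1 x -> p.1 y -> p.1 (p.2 x y) &
      forall x y x' y', p.1 x -> p.1 y -> p.1 x' -> p.1 y' ->
        p.2 x y = p.2 x' y' -> x = x' /\ y = y'].
pose S := {p | good p}.
pose le (s t : S) := (sval s).1 `<=` (sval t).1 /\
  forall x y, (sval s).1 x -> (sval s).1 y -> (sval s).2 x y = (sval t).2 x y.
pose p0 : set T * (T -> T -> T) := (range nu, fun x y => nu (pickle (un x, un y))).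
have gp0 : good p0.
  split=> [n|x y _ _|x y x' y' [a _ <-] [b _ <-] [a' _ <-] [b' _ <-]] /=.
  - by exists n.
  - by exists (pickle (un x, un y)).
  by rewrite !unK => /nui /(pcan_inj pickleK) [-> ->].
have [|||s smax] := @ZL_preorder S (exist _ p0 gp0) (fun s t => `[< le s t >]).
- by move=> s; apply/asboolP; split=> [x|].
- move=> r s t /asboolP [rs Hrs] /asboolP [st Hst]; apply/asboolP; split.
    by move=> x /rs/st.
  by move=> x y rx ry; rewrite Hrs // Hst //; exact: rs.
- move=> C Ctot; have [[c0 Cc0]|nC] := pselect (exists c, C c); last first.
    by exists (exist _ p0 gp0) => c Cc; case: nC; exists c.
  have tot s t : C s -> C t -> le s t \/ le t s.
    by move=> Cs Ct; have [/asboolP|/asboolP] := Ctot _ _ Cs Ct; [left|right].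
  pose A : set T := [set x | exists s, C s /\ (sval s).1 x].
  have two x y : A x -> A y -> exists s, [/\ C s, (sval s).1 x & (sval s).1 y].
    move=> [s [Cs sx]] [t [Ct ty]]; have [[st _]|[ts _]] := tot s t Cs Ct.
      by exists t; split=> //; exact: st.
    by exists s; split=> //; exact: ts.
  have /choice [f Hf] : forall p : T * T, exists z, forall s, C s -> (sval s).1 p.1 ->
      (sval s).1 p.2 -> (sval s).2 p.1 p.2 = z.
    move=> [x y] /=; have [[s [Cs sx sy]]|H] := pselect (exists s, [/\ C s, (sval s).1 x & (sval s).1 y]).
      exists ((sval s).2 x y) => t Ct tx ty.
      by have [[_ ->]|[_ ->]] := tot s t Cs Ct.
    by exists x => t Ct tx ty; case: H; exists t.
  have gA : good (A, fun x y => f (x, y)).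
    split=> [n|x y Ax Ay|x y x' y' Ax Ay Ax' Ay'] /=.
    - by exists c0; split=> //; have [] := svalP c0.
    - have [s [Cs sx sy]] := two x y Ax Ay.
      rewrite -(Hf (x, y) s) //; exists s; split=> //.
      by have [_ H _] := svalP s; exact: H.
    have [s [Cs sx sy]] := two x y Ax Ay; have [t [Ct tx ty]] := two x' y' Ax' Ay'.
    have [u [Cu [ux uy ux' uy']]] : exists u, C u /\
        [/\ (sval u).1 x, (sval u).1 y, (sval u).1 x' & (sval u).1 y'].
      have [[st _]|[ts _]] := tot s t Cs Ct.
        by exists t; split=> //; split=> //; exact: st.
      by exists s; split=> //; split=> //; exact: ts.
    rewrite -(Hf (x, y) u) // -(Hf (x', y') u) //=.
    by have [_ _ H] := svalP u; exact: H.
  exists (exist _ _ gA) => s Cs; apply/asboolP; split=> /=.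
    by move=> x sx; exists s.
  by move=> x y sx sy; rewrite -(Hf (x, y) s).
have [A0 Acl Ainj] := svalP s.
set A := (sval s).1 in A0 Acl Ainj *; set f := (sval s).2 in Acl Ainj *.
have nu01 : nu 0 <> nu 1 by move=> /nui.
(* If the complement embeds in [A], tags [nu 0] and [nu 1] embed all of [T] in [A]. Otherwise [A]
   has a copy in its complement, by which it can be enlarged. *)
have [/embeds_sub [h [hA hi]]|/embeds_sub [g [gA gi]]] :=
    embeds_total {x | ~ A x} {x | A x}.
  pose e x := if `[< A x >] then f (nu 0) x else f (nu 1) (h x).
  have eA x : A (e x) by rewrite /e; case: asboolP => Ax; apply: Acl => //; exact: hA.
  have ei : injective e.
    move=> x y; rewrite /e; case: asboolP => Ax; case: asboolP => Ay E.
    - by have [] := Ainj _ _ _ _ (A0 0) Ax (A0 0) Ay E.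
    - by have [] := Ainj _ _ _ _ (A0 0) Ax (A0 1) (hA _ Ay) E.
    - by have [/esym] := Ainj _ _ _ _ (A0 1) (hA _ Ax) (A0 0) Ay E.
    - by have [_ /hi] := Ainj _ _ _ _ (A0 1) (hA _ Ax) (A0 1) (hA _ Ay) E; apply.
  exists (fun p => f (e p.1) (e p.2)) => -[x y] [x' y'] /= E.
  by have [/ei -> /ei ->] := Ainj _ _ _ _ (eA x) (eA y) (eA x') (eA y') E.
(* [cd] injects the enlarged set into [A]; new pairs take their values in the copy and so avoid the
   old ones. *)
pose B x := exists2 y, A y & g y = x.
pose A' : set T := [set x | A x \/ B x].
have /choice [cd Hcd] : forall x, exists z, A' x ->
    A z /\ ((A x /\ z = f (nu 0) x) \/ exists y, [/\ A y, g y = x & z = f (nu 1) y]).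
  move=> x; have [Ax|nAx] := pselect (A x).
    by exists (f (nu 0) x) => _; split; [exact: Acl|left].
  have [[y Ay E]|nB] := pselect (B x); last by exists x => -[].
  by exists (f (nu 1) y) => _; split; [exact: Acl|right; exists y].
have cdi x y : A' x -> A' y -> cd x = cd y -> x = y.
  move=> A'x A'y E; have [_ Hx] := Hcd x A'x; have [_ Hy] := Hcd y A'y; move: Hx Hy; rewrite E.
  move=> [[Ax ->]|[x' [Ax' <- ->]]] [[Ay E']|[y' [Ay' <- E']]].
  - by have [] := Ainj _ _ _ _ (A0 0) Ax (A0 0) Ay E'.
  - by have [] := Ainj _ _ _ _ (A0 0) Ax (A0 1) Ay' E'.
  - by have [/esym] := Ainj _ _ _ _ (A0 1) Ax' (A0 0) Ay E'.
  - by have [_ ->] := Ainj _ _ _ _ (A0 1) Ax' (A0 1) Ay' E'.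
have cdA x : A' x -> A (cd x) by move=> /Hcd [].
pose f' x y := if `[< A x /\ A y >] then f x y else g (f (cd x) (cd y)).
have gp : good (A', f').
  split=> [n|x y A'x A'y|x y x' y' A'x A'y A'x' A'y'] /=.
  - by left.
  - rewrite /f'; case: asboolP => [[Ax Ay]|_]; first by left; exact: Acl.
    by right; exists (f (cd x) (cd y)) => //; apply: Acl; exact: cdA.
  rewrite /f'; case: asboolP => [[Ax Ay]|_]; case: asboolP => [[Ax' Ay']|_] E.
  - exact: Ainj E.
  - by case: (gA (f (cd x') (cd y'))); [apply: Acl; exact: cdA|rewrite -E; exact: Acl].
  - by case: (gA (f (cd x) (cd y))); [apply: Acl; exact: cdA|rewrite E; exact: Acl].
  have {}E := gi _ _ (Acl _ _ (cdA _ A'x) (cdA _ A'y)) (Acl _ _ (cdA _ A'x') (cdA _ A'y')) E.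
  have [E1 E2] := Ainj _ _ _ _ (cdA _ A'x) (cdA _ A'y) (cdA _ A'x') (cdA _ A'y') E.
  by split; exact: cdi.
have /asboolP [] : `[< le (exist _ _ gp) s >].
  apply: smax; apply/asboolP; split=> [x Ax|x y Ax Ay] /=; first by left.
  by rewrite /f' asboolT.
move=> sub _; case: (gA (nu 0) (A0 0)); apply: sub; right; by exists (nu 0).
Qed.

Definition good_index (K Th : Type) : Prop :=
  [/\ embeds (Th * Th) Th, embeds nat Th & ~ embeds K Th].

Lemma good_index_nat K : ~ embeds K nat -> good_index K nat.
Proof.
move=> nK; split=> //; last exact: embeds_refl.
exact: embeds_square (embeds_refl _).
Qed.

(** The larger of the two types is again closed under pairing and does not contain a copy of [K]. *)
Lemma good_index_absorb K Th T : good_index K Th -> ~ embeds K T ->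
  exists Th', [/\ good_index K Th', embeds T Th' & embeds Th Th'].
Proof.
move=> [sq nT nK] nKT; have [TTh|ThT] := embeds_total T Th.
  by exists Th; split=> //; exact: embeds_refl.
exists T; split=> //; last exact: embeds_refl.
by split=> //; [apply: embeds_square|]; exact: embeds_trans ThT.
Qed.

(** * Translation to the syntactic notions *)

Section Translation.
Context {L : language} {M : structure L} {F : framed M}.
Variable A : set M.
Let XA := {x | A x}.
Let E : XA -> M := @sval _ A.
Hypothesis sA : sml XA.

Lemma psat_not V (theta : pformula M V) (x : V -> M) : psat x (Not theta) <-> ~ psat x theta.
Proof. by []. Qed.

Lemma def_psat_over V (B : set M) (theta : pformula M V) : formula_over B theta ->
  exists R, def2 R /\ forall x, psat x theta <-> R x (@sval _ B).
Proof.
move=> [m [phi [b [bB ->]]]].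
pose b' j : {x | B x} := exist _ (b j) (bB j).
exists (fun x e => sat (join x (fun j => e (b' j))) phi); split; last first.
  by move=> x; rewrite psat_inst.
pose P (w : V + 'I_m -> M) := sat w phi.
have dP : def P by exists phi.
by apply: (def_selects dP); selects_tac.
Qed.

Lemma formula_of_def2 V X (e : X -> M) (R : (V -> M) -> (X -> M) -> Prop) : def2 R ->
  exists (n : nat) (g : 'I_n -> X) (phi : formula L (V + 'I_n)),
    forall x w, psat x (inst phi (fun i => w (g i))) <-> R x w.
Proof.
move=> dR; have [n [g [h Hgh]]] := def_finite dR; have [phi Hphi] := dR.
exists n, g, (rename (fun z => match z with inl v => inl v | inr y => inr (h y) end) phi) => x w.
rewrite psat_inst sat_rename Hgh.
have [H1 H2] := Hphi (join x (fun y => w (g (h y)))).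
have EE : join x (fun y => w (g (h y))) = fun z => join x (fun i => w (g i))
    match z with inl v => inl v | inr y => inr (h y) end.
  by apply: funext => -[].
by split=> [K|/H1]; [apply: H2|]; rewrite EE.
Qed.

Lemma tp_teq V (a a' : V -> M) : tp a A = tp a' A <-> teq (join E a) (join E a').
Proof.
split=> [H P dP Pa|H].
  have dP2 : def2 (fun (v : V -> M) e => P (join e v)) by definable.
  have [n [g [phi Hphi]]] := formula_of_def2 E dP2.
  have : tp a A (inst phi (fun i => E (g i))).
    split; last by rewrite Hphi.
    by exists n, phi, (fun i => E (g i)); split=> // j; exact: svalP (g j).
  by rewrite H => -[_]; rewrite Hphi.
apply/seteqP; split=> theta [ov s]; split=> //; have [R [dR HR]] := def_psat_over ov;
  move: s; rewrite !HR.
  by apply: (H (fun w => R (fun v => w (inr v)) (fun x => w (inl x)))); definable.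
by apply: (teq_sym H (P := fun w => R (fun v => w (inr v)) (fun x => w (inl x)))); definable.
Qed.

Lemma divides_Div V (theta : pformula M V) : divides A theta ->
  exists (psi : (V -> M) -> (XA -> M) -> (nat -> M) -> Prop) (b : nat -> M) k,
    [/\ def3 psi, Div E b psi k & forall x, psat x theta <-> psi x E b].
Proof.
move=> [m [phi [b [-> [k [bs [bsb bsk]]]]]]].
have [u0] := carrier_inhabited M.
pose b' j := if insub j is Some i then b i else u0.
have bb' (i : 'I_m) : b i = b' i by rewrite /b' valK.
pose P (w : V + 'I_m -> M) := sat w phi.
have dP : def P by exists phi.
have H : Div E b (fun x (_ : XA -> M) w => P (join x w)) k.
  exists bs; split=> [i|]; first exact/tp_teq.
  move/k_inconsistentE: bsk => K t ti [x Hx].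
  by apply: (K t ti); exists x => i; rewrite psat_inst; exact: Hx.
exists (fun x _ w => P (join x (fun i => w (nat_of_ord i)))), b', k; split.
- by apply: (def_selects dP); selects_tac.
- exact: (Div_re id sA sml_nat (sml_ord m) bb' H).
by move=> x; rewrite psat_inst (funext bb').
Qed.

Lemma Div_divides V Y (b : Y -> M) (psi : (V -> M) -> (XA -> M) -> (Y -> M) -> Prop) k :
  def3 psi -> Div E b psi k ->
  exists theta, divides A theta /\ forall x, psat x theta <-> psi x E b.
Proof.
move=> dpsi [bs [bsb bsk]].
have dpsi2 : def2 (fun x (w : XA + Y -> M) => psi x (fun i => w (inl i)) (fun i => w (inr i))).
  by definable.
have [n [g [phi Hphi]]] := formula_of_def2 (join E b) dpsi2.
exists (inst phi (fun i => join E b (g i))); split; last by move=> x; rewrite (Hphi x (join E b)).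
exists n, phi, (fun i => join E b (g i)); split=> //.
exists k, (fun j i => join E (bs j) (g i)); split=> [j|].
  apply/tp_teq.
  by apply: (teq_re (fun z => match z with inl x => inl x | inr i => g i end) (bsb j)) => -[].
apply/k_inconsistentE => t ti [x Hx]; apply: (bsk t ti); exists x => i.
by have := Hx i; rewrite (Hphi x (join E (bs (t i)))).
Qed.

Lemma formula_over_not V (B : set M) (theta : pformula M V) :
  formula_over B theta -> formula_over B (Not theta).
Proof. by move=> [m [phi [b [bB ->]]]]; exists m, (Not phi), b. Qed.

Lemma formula_of_def3 V Y (b : Y -> M) (R : (V -> M) -> (XA -> M) -> (Y -> M) -> Prop) :
  def3 R -> exists theta, formula_over (A `|` range b) theta /\
    forall x, psat x theta <-> R x E b.
Proof.
move=> dR.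
have dR2 : def2 (fun x (w : XA + Y -> M) => R x (fun i => w (inl i)) (fun i => w (inr i))).
  by definable.
have [n [g [phi Hphi]]] := formula_of_def2 (join E b) dR2.
exists (inst phi (fun i => join E b (g i))); split; last by move=> x; rewrite (Hphi x (join E b)).
exists n, phi, (fun i => join E b (g i)); split=> // j.
by case: (g j) => [x|y] /=; [left; exact: svalP|right; exists y].
Qed.

Lemma def3_of_formula V Y (b : Y -> M) (theta : pformula M V) :
  formula_over (A `|` range b) theta ->
  exists R : (V -> M) -> (XA -> M) -> (Y -> M) -> Prop, def3 R /\
    forall x, psat x theta <-> R x E b.
Proof.
move=> /def_psat_over [R [dR HR]].
have /choice [s Hs] : forall z : {x | (A `|` range b) x}, exists t : XA + Y, join E b t = sval z.
  move=> [x xAb] /=; have [Ax|[y _ yx]] := xAb; first by exists (inl (exist _ x Ax)).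
  by exists (inr y).
exists (fun x e w => R x (fun z => join e w (s z))); split.
  apply: (def2_selects dR); first exact: selects_var.
  exists (fun z => inr (s z)) => w; apply: funext => z.
  by case: (s z).
move=> x; rewrite HR (_ : @sval _ _ = fun z => join E b (s z)) //.
by apply: funext => z; rewrite Hs.
Qed.

(** Compactness identifies the absence of a finite cover by dividing formulas with the existence of
    nondividing extensions; for the converse, [d] collects the parameters of the given cover. *)
Lemma indep_nfork V Y (a : V -> M) (b : Y -> M) (B : set M) :
  sml V -> sml Y -> B = range b -> indep A a B <-> nfork E a b.
Proof.
move=> sV sY ->; split=> [nf|nf [n [th [Hth con]]]].
  apply: nfork_criterion => // W d Q psi n k sW dQ dpsi Qa Hd.
  have /choice [th Hth] i : exists theta, i < n ->
      divides A theta /\ forall x, psat x theta <-> psi i x E (join b d).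
    have [ni|_] := boolP (i < n); last by exists Bot.
    by have [theta H] := Div_divides (dpsi i) (Hd i ni); exists theta.
  have [tQ [ovQ HQ]] := formula_of_def3 b dQ.
  apply: contrapT => nx; apply: nf; exists n, (fun i : 'I_n => th i); split.
    by move=> i; have [] := Hth i (ltn_ord i).
  move=> con; apply: nx.
  have [||x Hx] := con ([set tQ] `|` range (fun i : 'I_n => Not (th i))).
  - rewrite finite_setU; split; first exact: finite_set1.
    by apply: finite_image; exact: finite_finset.
  - by move=> theta [->|H]; [left; split=> //; rewrite HQ|right].
  exists x; split; first by rewrite -HQ; apply: Hx; left.
  move=> i ni; have [_ <-] := Hth i ni.
  by change (psat x (Not (th i))); apply: Hx; right; exists (Ordinal ni).
have /choice [psi /choice [bb /choice [k Hk]]] i := divides_Div (Hth i).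
pose d (p : 'I_n * nat) : M := bb p.1 p.2.
have sW : sml ('I_n * nat) by apply: sml_prod; [exact: sml_ord|exact: sml_nat].
have [c' [cc' c'nd]] := nf _ d sW.
apply: con => D _ DG; exists c' => theta /DG [[ov sat_a]|[i _ <-]].
  have [R [dR HR]] := def3_of_formula ov.
  rewrite HR; move: sat_a; rewrite HR.
  by apply: (teq_sym cc' (P := fun w => R (fun v => w (inr v)) (fun x => w (inl (inl x)))
    (fun y => w (inl (inr y))))); definable.
have [dpsi Hd Hpsi] := Hk i.
apply/psat_not; rewrite Hpsi => Hc.
have H : ndiv E c' (bb i).
  exact: (@ndiv_re _ _ _ V V XA (Y + 'I_n * nat) nat id (fun j => inr (i, j)) E c' _ c' (bb i) sA (sml_sum sY sW) sml_nat c'nd).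
exact: H dpsi Hc _ Hd.
Qed.

(** The global extension is complete and does not fork, so it contains the negation of each formula
    dividing over [A]; [c'] realizes its restriction to [A] and [d]. *)
Lemma ext_base_of_extension_base (K : Type) :
  (forall V : Type, sml V -> small K [set: V]) -> extension_base K A -> ext_base E.
Proof.
move=> smlK eA V W c d sV sW.
have [|q [[qov qcon qdec] pq nf]] := eA V (tp c A) (smlK V sV).
  split; first by move=> theta [].
    by move=> D _ DG; exists c => theta /DG [].
  move=> theta ov; have [s|ns] := pselect (psat c theta); [by left; split|right; split=> //].
  exact: formula_over_not.
pose G : set ((V + (XA + W) -> M) -> Prop) := [set P | def P /\ exists D : set (pformula M V),
  [/\ finite_set D, D `<=` q & forall v, realizes v D -> P (join v (join E d))]].
have [||||c' Hc'] := @realize_directed _ _ F _ _ (join E d) G sV (sml_sum sA sW).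
- by exists (fun=> True); split; [exact: def_cst|exists set0; split].
- by move=> P [].
- move=> P P' [dP [D [fD Dq DP]]] [dP' [D' [fD' Dq' DP']]].
  exists (fun w => P w /\ P' w); split=> //; split; first exact: def_and.
  exists (D `|` D'); split; first by rewrite finite_setU.
    by move=> th [/Dq|/Dq'].
  by move=> v Hv; split; [apply: DP|apply: DP'] => th Hth; apply: Hv; [left|right].
- by move=> P [dP [D [fD Dq DP]]]; have [v Hv] := qcon D fD Dq; exists v; exact: DP.
have Hq R theta : def3 R -> q theta ->
    (forall x, psat x theta <-> R x E d) -> R c' E d.
  move=> dR qt HR.
  apply: (Hc' (fun w => R (fun v => w (inl v)) (fun x => w (inr (inl x)))
    (fun y => w (inr (inr y))))).
  split; first by definable.
  exists [set theta]; split; first exact: finite_set1.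
    by move=> _ ->.
  by move=> v Hv; rewrite /= -HR; exact: Hv.
exists c'; split.
  apply: teq_sym => P dP Pc.
  have dR : def3 (fun (v : V -> M) e (_ : W -> M) => P (join e v)) by definable.
  have dR2 : def2 (fun (v : V -> M) e => P (join e v)) by definable.
  have [n [g [phi Hphi]]] := formula_of_def2 E dR2.
  apply: (Hq _ (inst phi (fun i => E (g i))) dR) => [|x]; last by rewrite (Hphi x E).
  apply: pq; split; last by rewrite (Hphi c E).
  by exists n, phi, (fun i => E (g i)); split=> // j; exact: svalP (g j).
move=> psi dpsi Hpsi k Hk.
have [theta [tdiv Ht]] := Div_divides dpsi Hk.
have ovT : formula_over [set: M] theta.
  by have [m [phi [b [-> _]]]] := tdiv; exists m, phi, b.
have [qt|qnt] := qdec theta ovT.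
  apply: nf; exists 1, (fun=> theta); split=> // con.
  have [||x Hx] := con ([set theta] `|` [set Not theta]).
  - by rewrite finite_setU; split; exact: finite_set1.
  - by move=> th [->|->]; [left|right; exists ord0].
  have /psat_not := Hx (Not theta) (or_intror erefl); apply.
  exact: Hx (or_introl erefl).
have dn : def3 (fun x e w => ~ psi x e w) by definable.
apply: (Hq _ _ dn qnt _ Hpsi) => x.
by rewrite psat_not Ht.
Qed.

Lemma simp_of_simple_type V (p : set (pformula M V)) (a : V -> M) :
  sml V -> p `<=` formula_over A -> simple_type p -> realizes a p -> simp E a.
Proof.
move=> sV pov sp ap Y psi k t dpsi sib br; apply: sp.
have dpsi2 : def2 (fun x (w : XA + Y -> M) => psi x (fun i => w (inl i)) (fun i => w (inr i))).
  by definable.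
have [n [g [phi Hphi]]] := formula_of_def2 (join E (t [::])) dpsi2.
exists n, phi, (fun eta i => join E (t eta) (g i)), k; split=> eta.
  apply/k_inconsistentE => u ui [x Hx]; apply: (sib eta u ui); exists x => i.
  by have := Hx i; rewrite (Hphi x (join E (t (rcons eta (u i))))).
have [x [xa Hx]] := br eta.
move=> D _ DG; exists x => theta /DG [[i _ <-]|pt].
  by rewrite (Hphi x (join E (t (mkseq eta i)))); exact: Hx.
have [R [dR HR]] := def_psat_over (pov theta pt).
rewrite HR; have := ap theta pt; rewrite HR.
by apply: (teq_sym xa (P := fun w => R (fun v => w (inr v)) (fun x => w (inl x)))); definable.
Qed.

End Translation.

(** The sizes of the symbols and of the four given types are absorbed one after the other, starting
    from nat. *)
Lemma monster_frame (L : language) (T : set (sentence L)) (K : Type) (M : structure L)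
    (T1 T2 T3 T4 : Type) :
  monster K T M -> ~ embeds K T1 -> ~ embeds K T2 -> ~ embeds K T3 -> ~ embeds K T4 ->
  exists F : framed M, [/\ @sml L M F T1, @sml L M F T2, @sml L M F T3 & @sml L M F T4] /\
    forall V, @sml L M F V -> small K [set: V].
Proof.
move=> [[sN sf sr] _ Msat _] n1 n2 n3 n4.
have sE U : small K [set: U] <-> ~ embeds K U.
  split=> H; first by move=> [f fi]; apply: H; apply/card_le_inj; exists f.
  by move=> /card_le_inj [f [fi _]]; apply: H; exists f.
have g0 := good_index_nat ((sE _).1 sN).
have [Ha [ga fa _]] := good_index_absorb g0 ((sE _).1 sf).
have [Hb [gb rb ab]] := good_index_absorb ga ((sE _).1 sr).
have [H1 [g1 e1 b1]] := good_index_absorb gb n1.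
have [H2 [g2 e2 b2]] := good_index_absorb g1 n2.
have [H3 [g3 e3 b3]] := good_index_absorb g2 n3.
have [H4 [g4 e4 b4]] := good_index_absorb g3 n4.
have [[pr pri] [nt nti] nK] := g4.
have s4 : small K [set: H4] by apply/sE.
have b24 := embeds_trans b3 b4; have b14 := embeds_trans b2 b24.
have bb4 := embeds_trans b1 b14.
have ef := embeds_trans fa (embeds_trans ab bb4).
have er := embeds_trans rb bb4.
have sat V X (e : X -> M) (G : set (pformula M V)) : embeds V H4 -> embeds X H4 ->
    G `<=` formula_over (range e) -> consistent G -> exists a, realizes a G.
  move=> [f fi] [h hi]; apply: Msat; first exact: small_embeds fi s4.
  move=> Ke; have := card_le_trans Ke (card_image_le _ _).
  exact: small_embeds hi s4.
exists (@Framed L M H4 pr pri nt nti ef er sat); split; last first.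
  by move=> V [f fi]; exact: small_embeds fi s4.
split; rewrite /sml /=; [exact: embeds_trans e1 b14|exact: embeds_trans e2 b24| |exact: e4].
exact: embeds_trans e3 b4.
Qed.

(** * Symmetry and right transitivity in the syntactic setting *)

Section Symmetry.
Context {L : language} {M : structure L} {F : framed M}.
Variables (K I : Type) (A : set M) (p : set (pformula M I)) (a : I -> M).
Hypothesis ntp2 : NTP2 M.
Hypothesis smlK : forall V : Type, sml V -> small K [set: V].
Hypothesis sI : sml I.
Hypothesis sA : sml {x | A x}.
Hypothesis A_base : extension_base K A.
Hypothesis p_over : p `<=` formula_over A.
Hypothesis p_simple : simple_type p.
Hypothesis a_p : realizes a p.

Let E : {x | A x} -> M := @sval _ A.
Let sim : simp E a := simp_of_simple_type sI p_over p_simple a_p.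
Let eE : ext_base E := ext_base_of_extension_base sA smlK A_base.
Let fd : forks_divides E := forks_divides_ext ntp2 sA eE.

Lemma indep_sym J (b : J -> M) : sml J -> indep A a (range b) <-> indep A b (range a).
Proof.
move=> sJ; rewrite (indep_nfork sA _ sI sJ erefl) (indep_nfork sA _ sJ sI erefl).
split=> H; apply: nfork_of_ndiv => //.
  exact: simple_symmetry_left H.
exact: simple_symmetry H.
Qed.

Lemma range_sval (B : set M) : B = range (@sval _ B).
Proof.
apply/seteqP; split=> [x Bx|_ [x _ <-]]; last exact: svalP x.
by exists (exist _ x Bx).
Qed.

Lemma indep_right_trans (B C : set M) : sml {x | B x} -> sml {x | C x} ->
  A `<=` B -> extension_base K B -> indep A a B -> indep B a C -> indep A a C.
Proof.
move=> sB sC AB B_base.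
rewrite (indep_nfork sA a sI sB (range_sval B)) (indep_nfork sB a sI sC (range_sval C)).
rewrite (indep_nfork sA a sI sC (range_sval C)).
set EB := @sval _ B; set EC := @sval _ C => aB aC.
have eB : ext_base EB := ext_base_of_extension_base sB smlK B_base.
pose inc (x : {x | A x}) : {x | B x} := exist _ (sval x) (AB _ (svalP x)).
have simB : simp EB a by apply: (simp_base (i := inc) _ _ sim).
have Ba : ndiv E EB a := simple_symmetry_left ntp2 sim sI sA sB eE aB.
have Ca : ndiv EB EC a := simple_symmetry_left ntp2 simB sI sB sC eB aC.
have sAB : sml ({x | A x} + {x | B x}) by exact: sml_sum.
(* Left transitivity needs the base [(E, EB)], which is [EB] with coordinates repeated. *)
have Ca' : ndiv (join E EB) EC a.
  apply: (@ndiv_base _ _ _ _ _ _ _ _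
    (fun z => match z with inl x => inl (inc x) | inr y => inl y end) inr id EB) Ca _ _ _ => //.
  by case.
have BCa := ndiv_join_base sB sA sI Ba Ca'.
have aBC : ndiv E a (join EB EC).
  apply: simple_symmetry sim _ => //; first exact: sml_sum.
  by apply: nfork_of_ndiv => //; exact: sml_sum.
apply: nfork_of_ndiv => //.
exact: (@ndiv_re _ _ _ _ _ _ _ _ id inr E a (join EB EC) a EC sA (sml_sum sB sC) sC aBC).
Qed.

End Symmetry.

Lemma small_embedsN (K T : Type) (A : set T) : small K A -> ~ embeds K {x | A x}.
Proof.
move=> sA [f fi]; apply: sA; apply/card_le_inj; exists (fun x => sval (f x)); split.
  move=> x y; move: (f x) (f y) (@fi x y) => [u Au] [v Av] inj /= uv; apply: inj.
  by case: v / uv Av => Av; congr exist; exact: Prop_irrelevance.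
by move=> x; exact: svalP (f x).
Qed.

Lemma small_setTN (K T : Type) : small K [set: T] -> ~ embeds K T.
Proof. by move=> sT [f fi]; apply: sT; apply/card_le_inj; exists f. Qed.

Theorem corollary6p18 (L : language) (T : set (sentence L))
    (K : Type) (M : structure L) (A : set M)
    (I : Type) (p : set (pformula M I))
    (T_complete : complete_theory T) (M_monster : monster K T M)
    (M_NTP2 : NTP2 M)
    (A_small : small K A) (A_base : extension_base K A)
    (I_small : small K [set: I])
    (p_type : complete_type A p) (p_simple : simple_type p) :
  (forall (a : I -> M) (J : Type) (b : J -> M),
      small K [set: J] -> realizes a p ->
      (indep A a (range b) <-> indep A b (range a))) /\
  (forall (a : I -> M) (B C : set M),
      small K B -> small K C -> realizes a p ->
      A `<=` B -> extension_base K B ->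
      indep A a B -> indep B a C -> indep A a C).
Proof.
have [p_over _ _] := p_type.
have nA := small_embedsN A_small; have nI := small_setTN I_small.
(* The frame is chosen after the tuples, since it has to dominate [J], respectively [B] and [C]. *)
split=> [a J b /small_setTN nJ ap|a B C /small_embedsN nB /small_embedsN nC ap].
  have [F [[sA sI sJ _] smlK]] := monster_frame M_monster nA nI nJ nJ.
  exact: (indep_sym M_NTP2 smlK sI sA A_base p_over p_simple ap).
have [F [[sA sI sB sC] smlK]] := monster_frame M_monster nA nI nB nC.
exact: (indep_right_trans M_NTP2 smlK sI sA A_base p_over p_simple ap).
Qed.
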